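(* The following evaluations hold: $$V(-e^{-\pi\sqrt5})=\frac{(3-\sqrt5)(\sqrt3-\sqrt5)}{4},\qquad V(-e^{-\pi/\sqrt5})=\frac{(\sqrt3+\sqrt5)(\sqrt5-3)}{4},$$ $$V(-e^{-\pi/\sqrt3})=-\frac{1}{\sqrt[3]4},\qquad V(-e^{-\pi\sqrt3})=\frac{1-\sqrt[3]4}{2+\sqrt[3]4},$$ $$V(-e^{-\pi/(3\sqrt3)})=-\frac{1}{\sqrt[3]{\tfrac13(\sqrt[3]4-1)^4+1}},\qquad V(-e^{-\pi})=\frac{1-\sqrt3}{2},\qquad V(-e^{-\pi/3})=-\frac{1}{\sqrt[3]{2(\sqrt3-1)}}.$$
   Context: Ramanujan's cubic continued fraction is $$V(q)=\cfrac{q^{1/3}}{1+\cfrac{q+q^2}{1+\cfrac{q^2+q^4}{1+\cdots}}},\qquad |q|<1,$$ the $n$-th partial numerator after the first being $q^n+q^{2n}$; for real $q$ (including negative $q$), $q^{1/3}$ denotes the real cube root of $q$. Cube roots of positive numbers in the claim are positive real roots. *)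

(* Defs.v *)
From Stdlib Require Import Reals.
Open Scope R_scope.

Definition cbrt (x : R) : R :=
  if Rlt_dec 0 x then Rpower x (1/3)
  else if Rlt_dec x 0 then - Rpower (- x) (1/3) else 0.

Fixpoint cf_tail (q : R) (k n : nat) : R :=
  match n with
  | O => 1
  | S n' => 1 + (q ^ k + q ^ (2 * k)) / cf_tail q (S k) n'
  end.

(* N-th convergent of Ramanujan's cubic continued fraction V(q). *)
Definition V_conv (q : R) (N : nat) : R := cbrt q / cf_tail q 1 N.

Definition V_eq (q v : R) : Prop := Un_cv (V_conv q) v.

(* Main.v *)
(* With theta(y) = sum over Z of exp(-y n^2) and q = exp(-y), the continued fraction at -q equals
   (1 - theta(y/3)/theta(3y))/2.  Indeed F(k) = F(k+1) + (x^k + x^(2k)) F(k+2), x = -q, has an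
   explicit q-series solution tending to 1, and a Bailey pair together with a limiting case of
   Heine's summation turns F(1) and F(2) into theta series.
   Two facts then give the values at 1, 3, 1/3, 1/9, 1/27: the transformation
   theta(pi/t) = sqrt t theta(pi t), obtained by Polya's argument (periodise a random walk on Z,
   compare with its expansion in cosines, and let the period grow), and the relation
   (theta(y)/theta(3y))^4 = 1 - 8 V^3, which counts vectors in a sublattice of Z^4.
   For the values at 5 and 1/5 write V = - f(y)/f(3y)^3, where f is Weber's function, invariant
   under y -> pi^2/y; the relation theta(y)^2 = theta(5y)^2 (1 + 4 f(y)/f(5y)^5), from Z[i] and the
   triple product, gives f^4 = 1 + sqrt 5 at y = pi sqrt 5, and V is then a root of a quartic. *)

Require Import Defs.
From Stdlib Require Import Reals Lra Lia ZArith List Classical ClassicalEpsilon FinFun.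
From Coquelicot Require Import Coquelicot.
Open Scope R_scope.

(** * Unordered sums of nonnegative families *)

(** Each value comes from a coincidence of points dual under y -> pi^2/y. At pi, pi/sqrt 3 and pi
    sqrt 3 two of y/3, y, 3y are dual, so V is explicit or the root of a cubic; pi/3 and pi/(3 sqrt
    3) follow because y -> pi^2/(3y) turns (theta(y)/theta(3y))^4 into 9 over itself. At pi sqrt 5
    no two of the three points are dual. There the invariance of f makes the quintic relation an
    equation in one unknown, and the values of V at pi sqrt 5 and pi/(3 sqrt 5) involve the same two
    values of f, one of which is then eliminated by the duality. Convergence is an obstacle of its
    own: at a negative argument the partial numerators can be negative, but never below -1/4,
    exactly the bound that keeps all tails at least 1/2. Lattice identities use unordered sums,
    since reindexing Z^2 or Z^4 respects no order. Most q-series recurrences are proved by a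
    telescoping certificate, usually called [Y], which reduces them to identities between rational
    functions. *)

Definition fsum {A : Type} (f : A -> R) (l : list A) : R :=
  fold_right (fun a s => f a + s) 0 l.

(** A supremum over finite duplicate-free lists: no enumeration of the index type is chosen, so
    reindexing and products need no rearrangement argument. Meant for nonnegative families. *)
Definition is_sum {A : Type} (f : A -> R) (s : R) : Prop :=
  is_lub (fun x => exists l, NoDup l /\ x = fsum f l) s.

Lemma fsum_app {A} (f : A -> R) l1 l2 : fsum f (l1 ++ l2) = fsum f l1 + fsum f l2.
Proof. induction l1 as [|a l1 IH]; simpl; [ring|rewrite IH; ring]. Qed.

Lemma fsum_map {A B} (phi : A -> B) (g : B -> R) l :
  fsum g (map phi l) = fsum (fun a => g (phi a)) l.
Proof. induction l as [|a l IH]; simpl; [reflexivity|rewrite IH; reflexivity]. Qed.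

Lemma fsum_ext {A} (f g : A -> R) l : (forall a, f a = g a) -> fsum f l = fsum g l.
Proof. intros H; induction l as [|a l IH]; simpl; [reflexivity|rewrite IH, H; reflexivity]. Qed.

Lemma fsum_plus {A} (f g : A -> R) l :
  fsum (fun a => f a + g a) l = fsum f l + fsum g l.
Proof. induction l as [|a l IH]; simpl; [ring|rewrite IH; ring]. Qed.

Lemma fsum_scal {A} c (f : A -> R) l : fsum (fun a => c * f a) l = c * fsum f l.
Proof. induction l as [|a l IH]; simpl; [ring|rewrite IH; ring]. Qed.

Lemma fsum_ge0 {A} (f : A -> R) l : (forall a, 0 <= f a) -> 0 <= fsum f l.
Proof. intros H; induction l as [|a l IH]; simpl; [lra|specialize (H a); lra]. Qed.

Lemma fsum_incl {A} (f : A -> R) l l' :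
  (forall a, 0 <= f a) -> NoDup l -> incl l l' -> fsum f l <= fsum f l'.
Proof.
  intros Hf; revert l'; induction l as [|a l IH]; intros l' Hn Hi; simpl.
  - now apply fsum_ge0.
  - inversion Hn as [|? ? Ha Hl]; subst.
    destruct (in_split a l') as (l1 & l2 & ->); [apply Hi; now left|].
    enough (fsum f l <= fsum f (l1 ++ l2)) as H
      by (rewrite fsum_app in *; simpl; lra).
    apply IH; [assumption|].
    intros b Hb; specialize (Hi b (or_intror Hb)).
    apply in_app_or in Hi; apply in_or_app; simpl in Hi.
    destruct Hi as [?|[->|?]]; auto; contradiction.
Qed.

Definition class_dec {A : Type} (x y : A) : {x = y} + {x <> y} :=
  excluded_middle_informative (x = y).

Lemma is_sum_unique {A} (f : A -> R) s t : is_sum f s -> is_sum f t -> s = t.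
Proof. intros H K; exact (is_lub_u _ _ _ H K). Qed.

Lemma is_sum_ext {A} (f g : A -> R) s :
  (forall a, f a = g a) -> is_sum f s -> is_sum g s.
Proof.
  intros E [U L]; split.
  - intros x (l & Hl & ->); apply U; exists l; split; [assumption|].
    symmetry; now apply fsum_ext.
  - intros b Hb; apply L; intros x (l & Hl & ->); apply Hb; exists l.
    split; [assumption|now apply fsum_ext].
Qed.

Lemma is_sum_ge0 {A} (f : A -> R) s : is_sum f s -> 0 <= s.
Proof. intros [U _]; apply U; exists nil; split; [constructor|reflexivity]. Qed.

Lemma is_sum_fsum_le {A} (f : A -> R) s l : is_sum f s -> NoDup l -> fsum f l <= s.
Proof. intros [U _] H; apply U; now exists l. Qed.

Lemma is_sum_le_bound {A} (f : A -> R) s b :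
  is_sum f s -> (forall l, NoDup l -> fsum f l <= b) -> s <= b.
Proof. intros [_ L] H; apply L; intros x (l & Hl & ->); now apply H. Qed.

Lemma is_sum_0 {A} (f : A -> R) : (forall a, f a = 0) -> is_sum f 0.
Proof.
  intros H; split.
  - intros x (l & _ & ->); induction l as [|a l IH]; simpl; [lra|rewrite H; lra].
  - intros b Hb; apply Hb; exists nil; split; [constructor|reflexivity].
Qed.

(** Indices outside the image of [phi] are allowed as long as [g] vanishes there: a finite list in
    [B] is pulled back after its zero terms are dropped. *)
Lemma is_sum_inj {A B} (phi : A -> B) (g : B -> R) s :
  (forall a a', phi a = phi a' -> a = a') ->
  (forall b, g b <> 0 -> exists a, phi a = b) ->
  is_sum (fun a => g (phi a)) s -> is_sum g s.
Proof.
  intros Hi Hc [U L]; split.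
  - intros x (l & Hl & ->); apply U.
    cut (exists l', NoDup l' /\ (forall a, In a l' -> In (phi a) l)
           /\ fsum g l = fsum (fun a => g (phi a)) l').
    { intros (l' & H1 & _ & H2); now exists l'. }
    induction Hl as [|b l Hb Hl IH]; [exists nil; repeat split; [constructor|easy]|].
    destruct IH as (l' & H1 & H2 & H3).
    destruct (Req_dec (g b) 0) as [E|E].
    + exists l'; repeat split; [assumption|intros a Ha; right; auto|].
      simpl; rewrite E, H3; ring.
    + destruct (Hc b E) as [a <-]; exists (a :: l'); repeat split.
      * constructor; auto.
      * intros a' [->|Ha]; [now left|right; auto].
      * simpl; now rewrite H3.
  - intros b Hb; apply L; intros x (l & Hl & ->); apply Hb.
    exists (map phi l); split; [|now rewrite fsum_map].
    apply Injective_map_NoDup; assumption.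
Qed.

Lemma is_sum_plus {A} (f g : A -> R) s t :
  (forall a, 0 <= f a) -> (forall a, 0 <= g a) ->
  is_sum f s -> is_sum g t -> is_sum (fun a => f a + g a) (s + t).
Proof.
  intros Hf Hg Hs Ht; split.
  - intros x (l & Hl & ->); rewrite fsum_plus.
    apply Rplus_le_compat; eapply is_sum_fsum_le; eassumption.
  - intros b Hb.
    (* Lists adapted to [f] and to [g] separately are merged into one, which loses nothing because
       the terms are nonnegative. *)
    assert (H : forall l1 l2, NoDup l1 -> NoDup l2 -> fsum f l1 + fsum g l2 <= b).
    { intros l1 l2 N1 N2; set (l := nodup class_dec (l1 ++ l2)).
      assert (Hl : fsum (fun a => f a + g a) l <= b)
        by (apply Hb; exists l; split; [apply NoDup_nodup|reflexivity]).
      rewrite fsum_plus in Hl.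
      assert (fsum f l1 <= fsum f l)
        by (apply fsum_incl; auto; intros a Ha; apply nodup_In, in_or_app; auto).
      assert (fsum g l2 <= fsum g l)
        by (apply fsum_incl; auto; intros a Ha; apply nodup_In, in_or_app; auto).
      lra. }
    enough (s <= b - t) by lra.
    apply (is_sum_le_bound f); [assumption|]; intros l1 N1.
    enough (t <= b - fsum f l1) by lra.
    apply (is_sum_le_bound g); [assumption|]; intros l2 N2.
    specialize (H l1 l2 N1 N2); lra.
Qed.

Lemma is_sum_scal {A} c (f : A -> R) s :
  0 <= c -> is_sum f s -> is_sum (fun a => c * f a) (c * s).
Proof.
  intros Hc Hs; destruct (Rle_lt_or_eq_dec 0 c Hc) as [Hp|<-].
  - split.
    + intros x (l & Hl & ->); rewrite fsum_scal.
      apply Rmult_le_compat_l; [assumption|eapply is_sum_fsum_le; eassumption].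
    + intros b Hb; apply (Rmult_le_reg_l (/ c)); [now apply Rinv_0_lt_compat|].
      rewrite <- Rmult_assoc, Rinv_l, Rmult_1_l by lra.
      apply (is_sum_le_bound f); [assumption|]; intros l Hl.
      apply (Rmult_le_reg_l c); [assumption|].
      rewrite <- Rmult_assoc, Rinv_r, Rmult_1_l by lra.
      apply Hb; exists l; split; [assumption|now rewrite fsum_scal].
  - rewrite Rmult_0_l; apply is_sum_0; intros; ring.
Qed.

Lemma fsum_list_prod {A B} (f : A -> R) (g : B -> R) l1 l2 :
  fsum (fun p => f (fst p) * g (snd p)) (list_prod l1 l2) = fsum f l1 * fsum g l2.
Proof.
  induction l1 as [|a l1 IH]; simpl; [ring|].
  rewrite fsum_app, fsum_map, IH; simpl; rewrite fsum_scal; ring.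
Qed.

Lemma NoDup_list_prod {A B} (l1 : list A) (l2 : list B) :
  NoDup l1 -> NoDup l2 -> NoDup (list_prod l1 l2).
Proof.
  intros H1 H2; induction H1 as [|a l1 Ha H1 IH]; simpl; [constructor|].
  apply NoDup_app; [|assumption|].
  - apply Injective_map_NoDup; [intros x y E; congruence|assumption].
  - intros [x y] Hx Hy; apply in_map_iff in Hx; destruct Hx as (z & E & _).
    apply in_prod_iff in Hy; injection E as -> ->; tauto.
Qed.

Lemma is_sum_prod {A B} (f : A -> R) (g : B -> R) s t :
  (forall a, 0 <= f a) -> (forall b, 0 <= g b) ->
  is_sum f s -> is_sum g t -> is_sum (fun p => f (fst p) * g (snd p)) (s * t).
Proof.
  intros Hf Hg Hs Ht; split.
  - intros x (l & Hl & ->).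
    (* A finite set of pairs lies in the rectangle spanned by its two projections. *)
    set (l1 := nodup class_dec (map fst l)); set (l2 := nodup class_dec (map snd l)).
    apply Rle_trans with (fsum f l1 * fsum g l2).
    + rewrite <- fsum_list_prod; apply fsum_incl; auto.
      * intros p; now apply Rmult_le_pos.
      * intros [a b] H; apply in_prod; apply nodup_In.
        -- apply (in_map fst) in H; exact H.
        -- apply (in_map snd) in H; exact H.
    + apply Rmult_le_compat;
        [now apply fsum_ge0|now apply fsum_ge0|
         apply (is_sum_fsum_le _ _ _ Hs)|apply (is_sum_fsum_le _ _ _ Ht)];
        apply NoDup_nodup.
  - intros b Hb.
    assert (Hb' : forall l1 l2, NoDup l1 -> NoDup l2 -> fsum f l1 * fsum g l2 <= b).
    { intros l1 l2 N1 N2; rewrite <- fsum_list_prod; apply Hb; eexists.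
      split; [apply (NoDup_list_prod l1 l2); assumption|reflexivity]. }
    apply (is_sum_scal t) in Hs; [|now apply is_sum_ge0 in Ht].
    rewrite Rmult_comm; apply (is_sum_le_bound _ _ _ Hs); intros l1 N1.
    rewrite fsum_scal, Rmult_comm.
    apply (is_sum_scal (fsum f l1)) in Ht; [|now apply fsum_ge0].
    apply (is_sum_le_bound _ _ _ Ht); intros l2 N2.
    rewrite fsum_scal; auto.
Qed.

(** The engine of the lattice identities: the maps [psi c], for finitely many classes [c],
    parametrise disjoint pieces covering the support of [g]. The injectivity hypothesis expresses at
    once that the pieces are disjoint and that each map is injective. The induction splits [g] into
    its restriction to the first piece and the rest. *)
Lemma is_sum_cover {A B C} (cs : list C) (psi : C -> A -> B) (g : B -> R) (S : C -> R) :
  NoDup cs -> (forall b, 0 <= g b) ->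
  (forall b, g b <> 0 -> exists c a, In c cs /\ psi c a = b) ->
  (forall c c' a a', In c cs -> In c' cs -> psi c a = psi c' a' -> c = c' /\ a = a') ->
  (forall c, In c cs -> is_sum (fun a => g (psi c a)) (S c)) ->
  is_sum g (fsum S cs).
Proof.
  intros Hn; revert g; induction Hn as [|c cs Hc Hn IH]; intros g Hg Hcov Hinj Hs; simpl.
  - apply is_sum_0; intros b; destruct (Req_dec (g b) 0) as [|E]; [assumption|].
    destruct (Hcov b E) as (c & a & [] & _).
  - pose (P := fun b => exists a, psi c a = b).
    pose (D := fun b => excluded_middle_informative (P b)).
    pose (g1 := fun b => if D b then g b else 0).
    pose (g2 := fun b => if D b then 0 else g b).
    apply (is_sum_ext (fun b => g1 b + g2 b)).
    { intros b; unfold g1, g2; destruct (D b); ring. }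
    apply is_sum_plus.
    + intros b; unfold g1; destruct (D b); auto with real.
    + intros b; unfold g2; destruct (D b); auto with real.
    + apply (is_sum_inj (psi c)).
      * intros a a' E; eapply Hinj; try eassumption; now left.
      * intros b; unfold g1; destruct (D b) as [[a Ha]|]; [|easy]; intros _; now exists a.
      * apply (is_sum_ext (fun a => g (psi c a))); [|apply Hs; now left].
        intros a; unfold g1; destruct (D (psi c a)) as [|N]; [reflexivity|].
        exfalso; apply N; now exists a.
    + apply IH.
      * intros b; unfold g2; destruct (D b); auto with real.
      * intros b; unfold g2; destruct (D b) as [|N]; [easy|]; intros E.
        destruct (Hcov b E) as (c' & a & [<-|H] & Ha); [exfalso; apply N; now exists a|].
        now exists c', a.
      * intros; apply Hinj; simpl; auto.
      * intros c' H; apply (is_sum_ext (fun a => g (psi c' a))); [|apply Hs; now right].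
        intros a; unfold g2; destruct (D (psi c' a)) as [[a' E]|]; [|reflexivity].
        exfalso; destruct (Hinj c c' a' a) as [-> _]; simpl; auto.
Qed.

(** * Two-sided series *)

Definition zpair (f : Z -> R) (n : nat) : R :=
  match n with O => f 0%Z | S _ => f (Z.of_nat n) + f (- Z.of_nat n)%Z end.

Definition zseries (f : Z -> R) (s : R) : Prop := is_series (zpair f) s.

Fixpoint zrange (n : nat) : list Z :=
  match n with
  | O => 0%Z :: nil
  | S m => Z.of_nat n :: (- Z.of_nat n)%Z :: zrange m
  end.

Lemma in_zrange n z : In z (zrange n) <-> (Z.abs z <= Z.of_nat n)%Z.
Proof.
  induction n as [|n IH]; cbn [zrange In]; [lia|].
  rewrite IH; lia.
Qed.

Lemma NoDup_zrange n : NoDup (zrange n).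
Proof.
  induction n as [|n IH]; cbn [zrange]; [repeat constructor; easy|].
  repeat constructor; [|rewrite in_zrange; lia|assumption].
  intros [H|H]; [lia|rewrite in_zrange in H; lia].
Qed.

Lemma fsum_zrange f n : fsum f (zrange n) = sum_n (zpair f) n.
Proof.
  induction n as [|n IH].
  - rewrite sum_O; simpl; ring.
  - rewrite sum_Sn; cbn [zrange fsum fold_right].
    change (fold_right (fun a s => f a + s) 0 (zrange n)) with (fsum f (zrange n)).
    rewrite IH; unfold plus; simpl; ring.
Qed.

(** The symmetric intervals absorb every finite list, and the partial sums increase, so the ordered
    limit is the supremum. *)
Lemma zseries_is_sum f s : (forall z, 0 <= f z) -> zseries f s -> is_sum f s.
Proof.
  intros Hf Hs.
  assert (Hz : forall n, 0 <= zpair f n)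
    by (intros [|n]; simpl; auto using Rplus_le_le_0_compat).
  assert (Hle : forall n, sum_n (zpair f) n <= s).
  { intros n; apply (is_lim_seq_incr_compare (sum_n (zpair f))).
    - exact Hs.
    - intros m; rewrite sum_Sn; unfold plus; simpl.
      specialize (Hz (S m)); simpl in Hz; lra. }
  split.
  - intros x (l & Hl & ->).
    set (N := fold_right Nat.max 0%nat (map Z.abs_nat l)).
    apply Rle_trans with (fsum f (zrange N)); [|rewrite fsum_zrange; apply Hle].
    apply fsum_incl; auto; intros z H; apply in_zrange.
    assert (G : (Z.abs_nat z <= N)%nat).
    { unfold N; clear -H; induction l as [|a l IH]; simpl in *; [easy|].
      destruct H as [->|H]; [lia|specialize (IH H); lia]. }
    lia.
  - intros b Hb.
    apply (is_lim_seq_le (sum_n (zpair f)) (fun _ => b) s b);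
      [|exact Hs|apply is_lim_seq_const].
    intros n; rewrite <- fsum_zrange; apply Hb; eexists; split;
      [apply NoDup_zrange|reflexivity].
Qed.

(** * Dominated convergence for series *)

Lemma ex_series_dominated (a b : nat -> R) :
  (forall n, Rabs (a n) <= b n) -> ex_series b -> ex_series a.
Proof. intros H; apply (@ex_series_le R_AbsRing R_CompleteNormedModule); exact H. Qed.

(** Past a suitable [M] the majorant bounds both tails uniformly in [N]; the finitely many remaining
    terms converge one by one. *)
Lemma tannery (a : nat -> nat -> R) (b c : nat -> R) :
  (forall n, is_lim_seq (fun N => a N n) (c n)) ->
  (forall N n, Rabs (a N n) <= b n) -> ex_series b ->
  ex_series c /\ is_lim_seq (fun N => Series (a N)) (Series c).
Proof.
  intros Hl Hd Hb.
  assert (Hc : forall n, Rabs (c n) <= b n).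
  { intros n; apply (is_lim_seq_le (fun N => Rabs (a N n)) (fun _ => b n)
      (Rabs (c n)) (b n)); [intros N; apply Hd| |apply is_lim_seq_const].
    apply (is_lim_seq_abs _ (c n)), Hl. }
  assert (Ea : forall N, ex_series (a N)) by (intros N; now apply (ex_series_dominated _ b)).
  assert (Ec : ex_series c) by now apply (ex_series_dominated _ b).
  split; [exact Ec|].
  apply is_lim_seq_spec; intros eps.
  assert (Hr : exists M, Series (fun k => b (M + k)%nat) < eps / 4).
  { assert (H : is_lim_seq (fun M => Series b - sum_n b M) 0).
    { replace (Finite 0) with (Rbar_minus (Series b) (Series b))
        by (simpl; f_equal; ring).
      apply is_lim_seq_minus'; [apply is_lim_seq_const|].
      apply Series_correct, Hb. }
    apply is_lim_seq_spec in H.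
    destruct (H (mkposreal (eps / 4) ltac:(destruct eps; simpl; lra))) as [M HM].
    specialize (HM M (le_n _)); simpl in HM; exists (S M).
    rewrite (Series_incr_n b (S M)) in HM by (auto with arith).
    simpl pred in HM; rewrite <- sum_n_Reals in HM.
    apply Rabs_def2 in HM; lra. }
  destruct Hr as [M HM].
  assert (Hfin : is_lim_seq (fun N => sum_n (a N) M) (sum_n c M)).
  { clear HM; induction M as [|M IH].
    - rewrite sum_O; eapply is_lim_seq_ext; [|apply Hl].
      intros N; now rewrite sum_O.
    - rewrite sum_Sn; apply (is_lim_seq_ext (fun N => sum_n (a N) M + a N (S M)));
        [intros N; now rewrite sum_Sn|].
      apply (is_lim_seq_plus' _ _ _ _ IH (Hl (S M))). }
  apply is_lim_seq_spec in Hfin.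
  destruct (Hfin (mkposreal (eps / 4) ltac:(destruct eps; simpl; lra))) as [N0 HN0].
  exists N0; intros N HN; specialize (HN0 N HN); simpl in HN0.
  assert (Tail : forall d, (forall n, Rabs (d n) <= b n) ->
    Rabs (Series d - sum_n d M) < eps / 4).
  { intros d Hdb.
    assert (Ed : ex_series d) by now apply (ex_series_dominated _ b).
    rewrite (Series_incr_n d (S M)) by (auto with arith).
    simpl pred; rewrite <- sum_n_Reals.
    replace (_ + _ - _) with (Series (fun k => d (S M + k)%nat)) by ring.
    assert (Eb' : ex_series (fun k => b (S M + k)%nat)) by now apply (ex_series_incr_n b).
    apply Rle_lt_trans with (Series (fun k => b (S M + k)%nat)).
    - eapply Rle_trans; [apply Series_Rabs|].
      + apply (ex_series_dominated _ (fun k => b (S M + k)%nat)); [|assumption].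
        intros k; rewrite Rabs_Rabsolu; apply Hdb.
      + apply Series_le; [|assumption]; intros k; split; [apply Rabs_pos|apply Hdb].
    - apply Rle_lt_trans with (2 := HM).
      rewrite (Series_incr_1 (fun k => b (M + k)%nat)) by (now apply (ex_series_incr_n b)).
      rewrite Nat.add_0_r, (Series_ext (fun k => b (M + S k)%nat) (fun k => b (S M + k)%nat))
        by (intros k; f_equal; lia).
      assert (0 <= b M) by (eapply Rle_trans; [apply Rabs_pos|apply Hdb]). lra. }
  pose proof (Tail (a N) (Hd N)) as T1; pose proof (Tail c Hc) as T2.
  destruct eps as [e He]; simpl in *.
  apply Rabs_def2 in T1; apply Rabs_def2 in T2; apply Rabs_def2 in HN0.
  apply Rabs_def1; lra.
Qed.

(** * Infinite products *)

Fixpoint prodn (f : nat -> R) (n : nat) : R :=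
  match n with O => 1 | S m => prodn f m * f m end.

Lemma prodn_pos f n : (forall k, 0 < f k) -> 0 < prodn f n.
Proof. intros H; induction n; simpl; [lra|now apply Rmult_lt_0_compat]. Qed.

Lemma prodn_ext f g n : (forall k, f k = g k) -> prodn f n = prodn g n.
Proof. intros H; induction n as [|n IH]; simpl; [reflexivity|now rewrite IH, H]. Qed.

Lemma prodn_mult f g n : prodn (fun k => f k * g k) n = prodn f n * prodn g n.
Proof. induction n as [|n IH]; simpl; [ring|rewrite IH; ring]. Qed.

(** The inequality 1 + x <= exp x bounds the increasing partial products by the exponential of the
    sum. *)
Lemma prodn_cvg_incr (g : nat -> R) :
  (forall n, 0 <= g n) -> ex_series g ->
  exists l : R, is_lim_seq (prodn (fun n => 1 + g n)) l /\
    forall n, 1 <= prodn (fun n => 1 + g n) n <= l.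
Proof.
  intros Hg Hs; set (P := prodn (fun n => 1 + g n)).
  assert (H1 : forall n, 1 <= P n).
  { intros n; induction n as [|n IH]; unfold P in *; simpl; [lra|].
    specialize (Hg n); nra. }
  assert (Hi : forall n, P n <= P (S n)).
  { intros n; specialize (H1 n); specialize (Hg n); unfold P in *; simpl; nra. }
  assert (Hb : forall n, P n <= exp (Series g)).
  { assert (H : forall n, P n <= exp (match n with O => 0 | S m => sum_n g m end)).
    { intros n; induction n as [|n IH]; unfold P in *; simpl prodn.
      - rewrite exp_0; lra.
      - replace (sum_n g n) with (match n with O => 0 | S m => sum_n g m end + g n).
        + rewrite exp_plus; apply Rmult_le_compat; [|specialize (Hg n); lra|exact IH|].
          * specialize (H1 n); lra.
          * apply exp_ineq1_le.
        + destruct n; [rewrite sum_O; ring|rewrite sum_Sn; reflexivity]. }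
    intros n; eapply Rle_trans; [apply H|].
    assert (Hsum : forall m, sum_n g m <= Series g).
    { intros m; apply (is_lim_seq_incr_compare (sum_n g)); [apply Series_correct, Hs|].
      intros k; rewrite sum_Sn; unfold plus; simpl; specialize (Hg (S k)); lra. }
    assert (H0 : 0 <= Series g)
      by (specialize (Hsum 0%nat); rewrite sum_O in Hsum; specialize (Hg 0%nat); lra).
    assert (Hm : forall a b, a <= b -> exp a <= exp b)
      by (intros a b [L| ->]; [left; now apply exp_increasing|now right]).
    destruct n; apply Hm; [assumption|apply Hsum]. }
  destruct (ex_finite_lim_seq_incr P (exp (Series g)) Hi Hb) as [l Hl].
  exists l; split; [exact Hl|]; intros n; split; [apply H1|].
  now apply is_lim_seq_incr_compare.
Qed.

(** Since 1 - g = 1 / (1 + g / (1 - g)), reciprocals reduce this to the increasing case and keep the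
    limit away from 0; the uniform bound [d] makes g / (1 - g) summable. *)
Lemma prodn_cvg_decr (g : nat -> R) (d : R) :
  d < 1 -> (forall n, 0 <= g n <= d) -> ex_series g ->
  exists l : R, 0 < l /\ is_lim_seq (prodn (fun n => 1 - g n)) l /\
    forall n, l <= prodn (fun n => 1 - g n) n <= 1.
Proof.
  intros Hd Hg Hs.
  assert (Hh : forall n, 0 <= g n / (1 - g n) <= / (1 - d) * g n).
  { intros n; specialize (Hg n); split.
    - apply Rmult_le_pos; [lra|left; apply Rinv_0_lt_compat; lra].
    - unfold Rdiv; rewrite (Rmult_comm (g n)); apply Rmult_le_compat_r; [lra|].
      apply Rinv_le_contravar; lra. }
  destruct (prodn_cvg_incr (fun n => g n / (1 - g n))) as (L & HL & HB).
  { intros n; apply Hh. }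
  { apply (ex_series_dominated _ (fun n => / (1 - d) * g n)).
    - intros n; rewrite Rabs_right; [apply Hh|apply Rle_ge, Hh].
    - apply (@ex_series_scal R_AbsRing R_NormedModule (/ (1 - d)) g Hs). }
  assert (E : forall n, prodn (fun n => 1 - g n) n = / prodn (fun n => 1 + g n / (1 - g n)) n).
  { intros n; induction n as [|n IH]; simpl; [field|]; rewrite IH.
    specialize (HB n); specialize (Hg n); field; repeat split; lra. }
  assert (HL1 : 1 <= L) by (specialize (HB 0%nat); simpl in HB; lra).
  exists (/ L); repeat split.
  - apply Rinv_0_lt_compat; lra.
  - eapply is_lim_seq_ext; [intros n; symmetry; apply E|].
    apply (is_lim_seq_inv _ L HL); injection; lra.
  - rewrite E; specialize (HB n); apply Rinv_le_contravar; [lra|apply HB].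
  - rewrite E; specialize (HB n); apply Rle_trans with (/ 1); [|rewrite Rinv_1; lra].
    apply Rinv_le_contravar; [lra|apply HB].
Qed.

(** [tannery] applied to the partial sums over [n], which are dominated by the total of [a] times
    [b s]. *)
Lemma series_swap (f : nat -> nat -> R) (a b : nat -> R) :
  (forall n s, Rabs (f n s) <= a n * b s) -> ex_series a -> ex_series b ->
  Series (fun n => Series (fun s => f n s)) = Series (fun s => Series (fun n => f n s))
  /\ ex_series (fun s => Series (fun n => f n s)).
Proof.
  intros Hf Ha Hb.
  assert (Hrow : forall n, ex_series (fun s => f n s)).
  { intros n; apply (ex_series_dominated _ (fun s => a n * b s)); [apply Hf|].
    apply (@ex_series_scal R_AbsRing R_NormedModule (a n) b Hb). }
  assert (Hcol : forall s, ex_series (fun n => f n s)).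
  { intros s; apply (ex_series_dominated _ (fun n => b s * a n)).
    - intros n; rewrite Rmult_comm; apply Hf.
    - apply (@ex_series_scal R_AbsRing R_NormedModule (b s) a Ha). }
  assert (Hab : forall n s, 0 <= a n * b s) by
    (intros n s; eapply Rle_trans; [apply Rabs_pos|apply Hf]).
  destruct (tannery (fun N s => sum_n (fun n => f n s) N)
    (fun s => Series a * b s) (fun s => Series (fun n => f n s))) as [E L].
  - intros s; apply (Series_correct _ (Hcol s)).
  - intros N s; unfold sum_n; eapply Rle_trans; [apply (norm_sum_n_m (V := R_NormedModule))|].
    apply Rle_trans with (sum_n (fun n => a n * b s) N).
    + apply sum_n_m_le; intros n; apply Hf.
    + rewrite <- Series_scal_r.
      apply (is_lim_seq_incr_compare (sum_n (fun n => a n * b s))).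
      * apply Series_correct, (ex_series_scal_r (b s) a Ha).
      * intros n; rewrite sum_Sn; unfold plus; simpl; specialize (Hab (S n) s); lra.
  - apply (@ex_series_scal R_AbsRing R_NormedModule (Series a) b Hb).
  - split; [|exact E].
    apply is_series_unique.
    refine (is_lim_seq_ext _ _ _ _ L); intros N.
    induction N as [|N IH].
    + rewrite sum_O; apply Series_ext; intros s; now rewrite sum_O.
    + rewrite sum_Sn, <- IH; unfold plus; simpl.
      rewrite <- Series_plus; [|clear IH; induction N as [|N IH]|apply Hrow].
      * apply Series_ext; intros s; now rewrite sum_Sn.
      * eapply ex_series_ext; [|apply (Hrow 0%nat)]; intros s; now rewrite sum_O.
      * eapply ex_series_ext; [|apply (@ex_series_plus R_AbsRing R_NormedModule _ _ IH (Hrow (S N)))];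
          intros s; now rewrite sum_Sn.
Qed.

(** * Elementary facts on products, powers and series *)

Lemma prodn_shift f n : prodn f (S n) = f 0%nat * prodn (fun i => f (S i)) n.
Proof.
  induction n as [|n IH]; [simpl; ring|].
  change (prodn f (S (S n))) with (prodn f (S n) * f (S n)); rewrite IH; simpl; ring.
Qed.

Lemma ex_series_pow r : 0 <= r < 1 -> ex_series (fun n => r ^ n).
Proof. intros H; apply ex_series_geom; rewrite Rabs_right; lra. Qed.

Lemma pow_le_pow r m n : 0 <= r <= 1 -> (m <= n)%nat -> r ^ n <= r ^ m.
Proof.
  intros Hr H; replace n with (m + (n - m))%nat by lia; rewrite pow_add.
  rewrite <- (Rmult_1_r (r ^ m)) at 2; apply Rmult_le_compat_l; [apply pow_le; lra|].
  rewrite <- (pow1 (n - m)); apply pow_incr; lra.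
Qed.

Lemma ex_series_scal_R c (a : nat -> R) : ex_series a -> ex_series (fun n => c * a n).
Proof. apply (@ex_series_scal R_AbsRing R_NormedModule). Qed.

Lemma ex_series_plus_R (a b : nat -> R) :
  ex_series a -> ex_series b -> ex_series (fun n => a n + b n).
Proof. apply (@ex_series_plus R_AbsRing R_NormedModule). Qed.

Lemma telescoping_series (a Y : nat -> R) :
  (forall n, a n = Y n - Y (S n)) -> is_lim_seq Y 0 -> is_series a (Y 0%nat).
Proof.
  intros Ha HY; change (is_lim_seq (sum_n a) (Y 0%nat)).
  apply (is_lim_seq_ext (fun n => Y 0%nat - Y (S n))).
  - intros n; induction n as [|n IH]; [rewrite sum_O, Ha; ring|].
    rewrite sum_Sn, <- IH, Ha; unfold plus; simpl; ring.
  - replace (Finite (Y 0%nat)) with (Finite (Y 0%nat - 0)) by (f_equal; ring).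
    apply is_lim_seq_minus'; [apply is_lim_seq_const|].
    now apply (is_lim_seq_incr_1 Y).
Qed.

(** * Convergence of the continued fraction *)

Lemma pow_opp r n : (- r) ^ n = (-1) ^ n * r ^ n.
Proof. rewrite <- Rpow_mult_distr; f_equal; ring. Qed.

Lemma pow_m1_even n : (-1) ^ (2 * n) = 1.
Proof. rewrite pow_mult; replace ((-1) ^ 2) with 1 by ring; apply pow1. Qed.

Lemma pow_m1_odd n : (-1) ^ (2 * n + 1) = -1.
Proof. rewrite pow_add, pow_m1_even; ring. Qed.

Lemma pow_m1_abs n : Rabs ((-1) ^ n) = 1.
Proof. apply pow_1_abs. Qed.

(** With t = r^k the worst case is t^2 - t, for odd [k], whose minimum -1/4 is reached at t =
    1/2. *)
Lemma cf_coef_bounds r k : 0 < r < 1 ->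
  -(1/4) <= (- r) ^ k + (- r) ^ (2 * k) /\
  Rabs ((- r) ^ k + (- r) ^ (2 * k)) <= 2 * r ^ k.
Proof.
  intros Hr; rewrite !pow_opp, pow_m1_even.
  replace (r ^ (2 * k)) with (r ^ k * r ^ k) by (rewrite <- pow_add; f_equal; lia).
  assert (H0 : 0 < r ^ k) by (apply pow_lt; lra).
  assert (H1 : r ^ k <= 1) by (rewrite <- (pow1 k); apply pow_incr; lra).
  pose proof (pow_m1_abs k) as Hs.
  assert (Hc : (-1) ^ k = 1 \/ (-1) ^ k = -1).
  { revert Hs; unfold Rabs; destruct (Rcase_abs _); [right|left]; lra. }
  split.
  - destruct Hc as [-> | ->]; [nra|].
    pose proof (Rle_0_sqr (r ^ k - 1/2)); unfold Rsqr in *; lra.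
  - eapply Rle_trans; [apply Rabs_triang|]; rewrite !Rabs_mult, Hs, Rabs_R1.
    rewrite Rabs_right by lra; nra.
Qed.

(** Worpitzky's bound: 1/2 is the fixed point of t -> 1 - (1/4) / t, so numerators at least -1/4
    preserve it. *)
Lemma cf_tail_ge r n : 0 < r < 1 -> forall k, 1/2 <= cf_tail (- r) k n.
Proof.
  intros Hr; induction n as [|n IH]; intros k; [simpl; lra|].
  cbn [cf_tail]; specialize (IH (S k)).
  destruct (cf_coef_bounds r k Hr) as [Hc _].
  set (c := (- r) ^ k + (- r) ^ (2 * k)) in *; set (t := cf_tail (- r) (S k) n) in *.
  assert (Ht : 0 < / t <= 2).
  { split; [apply Rinv_0_lt_compat; lra|].
    replace 2 with (/ (1/2)) by field; apply Rinv_le_contravar; lra. }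
  unfold Rdiv; nra.
Qed.

Lemma eventually_backward (P : nat -> Prop) :
  (exists N, forall k, (N <= k)%nat -> P k) -> (forall k, P (S k) -> P k) -> forall k, P k.
Proof.
  intros [N HN] Hb k; destruct (Nat.le_gt_cases N k) as [H|H]; [auto|].
  assert (G : forall d, (d <= N)%nat -> P (N - d)%nat).
  { induction d as [|d IH]; intros Hd; [rewrite Nat.sub_0_r; auto|].
    apply Hb; replace (S (N - S d)) with (N - d)%nat by lia; apply IH; lia. }
  replace k with (N - (N - k))%nat by lia; apply G; lia.
Qed.

(** The quotients F k / F (k + 1) satisfy the recurrence of the tails without truncation. A
    truncated tail differs from them by at most 4 times a product of factors 8 r^i, which tends to 0
    although its first factors may exceed 1. *)
Lemma cf_tail_cvg r (F : nat -> R) : 0 < r < 1 ->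
  (forall k, F k = F (S k) + ((- r) ^ S k + (- r) ^ (2 * S k)) * F (S (S k))) ->
  is_lim_seq F 1 ->
  0 < F 0%nat /\ 0 < F 1%nat /\ is_lim_seq (cf_tail (- r) 1) (F 0%nat / F 1%nat).
Proof.
  intros Hr Hrec Hlim.
  (* Equivalent to F k / F (k + 1) >= 1/2. It holds for large k because F tends to 1, and it
     descends because F k >= F (k + 1) - F (k + 2) / 4 >= F (k + 1) / 2. *)
  assert (HF : forall k, 0 < F (S k) /\ F (S k) <= 2 * F k).
  { apply eventually_backward.
    - apply is_lim_seq_spec in Hlim.
      destruct (Hlim (mkposreal (1/4) ltac:(lra))) as [N HN]; exists N; intros k Hk.
      pose proof (HN k Hk) as A; pose proof (HN (S k) ltac:(lia)) as B; simpl in A, B.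
      apply Rabs_def2 in A; apply Rabs_def2 in B; lra.
    - intros k [H1 H2].
      destruct (cf_coef_bounds r (S k) Hr) as [Hc _].
      specialize (Hrec k); set (c := (- r) ^ S k + _) in *.
      assert (H3 : 0 < F (S k)) by lra.
      split; [assumption|]; rewrite Hrec; nra. }
  assert (HF0 : forall k, 0 < F k).
  { intros k; specialize (HF k); lra. }
  repeat split; auto.
  pose (T := fun k => F k / F (S k)).
  assert (HT : forall k, 1/2 <= T k).
  { intros k; unfold T; destruct (HF k); apply (Rmult_le_reg_r (F (S k))); [assumption|].
    replace (F k / F (S k) * F (S k)) with (F k) by (field; lra); lra. }
  pose (c := fun k => (- r) ^ S k + (- r) ^ (2 * S k)).
  assert (HTr : forall k, T k = 1 + c k / T (S k)).
  { intros k; unfold T, c; rewrite (Hrec k) at 1; pose proof (HF0 (S k)); pose proof (HF0 (S (S k))).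
    field; lra. }
  assert (Hc : forall k, Rabs (c k) <= 2 * r ^ k).
  { intros k; unfold c; destruct (cf_coef_bounds r (S k) Hr) as [_ H].
    eapply Rle_trans; [exact H|]. simpl. assert (0 < r ^ k) by (apply pow_lt; lra). nra. }
  (* The constant is 2 * 4: the numerator is at most 2 r^k and each of the two reciprocals at most
     2. *)
  assert (Hq : forall k x y, 1/2 <= x -> 1/2 <= y ->
     Rabs ((1 + c k / x) - (1 + c k / y)) <= 8 * r ^ k * Rabs (x - y)).
  { intros k x y Hx Hy.
    replace (1 + c k / x - (1 + c k / y)) with (c k * ((y - x) * (/ x * / y))) by (field; lra).
    rewrite !Rabs_mult, (Rabs_minus_sym y x).
    assert (Hi : forall z, 1/2 <= z -> 0 <= Rabs (/ z) <= 2).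
    { intros z Hz; rewrite Rabs_right by (left; apply Rinv_0_lt_compat; lra).
      split; [left; apply Rinv_0_lt_compat; lra|].
      replace 2 with (/ (1/2)) by field; apply Rinv_le_contravar; lra. }
    pose proof (Hi x Hx); pose proof (Hi y Hy).
    pose proof (Rabs_pos (x - y)); pose proof (Hc k); pose proof (Rabs_pos (c k)).
    apply Rle_trans with (Rabs (c k) * (Rabs (x - y) * 4)).
    - apply Rmult_le_compat_l; [assumption|]; apply Rmult_le_compat_l; [assumption|nra].
    - replace (8 * r ^ k * Rabs (x - y)) with (2 * r ^ k * (Rabs (x - y) * 4)) by ring.
      apply Rmult_le_compat_r; [lra|assumption]. }
  assert (HT4 : forall k, Rabs (1 - T k) <= 4).
  { intros k; rewrite HTr; replace (1 - (1 + c k / T (S k))) with (- (c k * / T (S k))) by (unfold Rdiv; ring).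
    rewrite Rabs_Ropp, Rabs_mult.
    assert (r ^ k <= 1) by (rewrite <- (pow1 k); apply pow_incr; lra).
    pose proof (Hc k); pose proof (Rabs_pos (c k)); pose proof (HT (S k)).
    rewrite (Rabs_right (/ _)) by (left; apply Rinv_0_lt_compat; lra).
    assert (/ T (S k) <= 2) by (replace 2 with (/ (1/2)) by field; apply Rinv_le_contravar; lra).
    assert (0 < / T (S k)) by (apply Rinv_0_lt_compat; lra).
    nra. }
  assert (He : forall n k, Rabs (cf_tail (- r) (S k) n - T k)
             <= 4 * prodn (fun i => 8 * r ^ (k + i)) n).
  { induction n as [|n IH]; intros k.
    - simpl; rewrite Rmult_1_r; apply HT4.
    - rewrite prodn_shift, HTr; cbn [cf_tail].
      eapply Rle_trans; [apply (Hq k _ (T (S k))); [now apply cf_tail_ge|apply HT]|].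
      rewrite Nat.add_0_r.
      replace (4 * _) with (8 * r ^ k * (4 * prodn (fun i => 8 * r ^ (S k + i)) n)).
      + apply Rmult_le_compat_l; [|apply IH].
        assert (0 < r ^ k) by (apply pow_lt; lra); lra.
      + rewrite (prodn_ext (fun i => 8 * r ^ (k + S i)) (fun i => 8 * r ^ (S k + i)));
          [ring|intros i; do 2 f_equal; lia]. }
  apply is_lim_seq_ext with (fun n => (cf_tail (- r) 1 n - T 0%nat) + T 0%nat); [intros; ring|].
  replace (Finite (F 0%nat / F 1%nat)) with (Finite (0 + T 0%nat)) by (unfold T; f_equal; ring).
  apply is_lim_seq_plus'; [|apply is_lim_seq_const].
  apply is_lim_seq_abs_0.
  apply (is_lim_seq_le_le (fun _ => 0) _ (fun n => 4 * prodn (fun i => 8 * r ^ i) n)).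
  - intros n; split; [apply Rabs_pos|apply He].
  - apply is_lim_seq_const.
  - replace (Finite 0) with (Rbar_mult 4 0) by (simpl; f_equal; ring).
    apply is_lim_seq_scal_l.
    assert (HP : forall n, 0 < prodn (fun i => 8 * r ^ i) n).
    { intros n; apply prodn_pos; intros i; assert (0 < r ^ i) by (apply pow_lt; lra); lra. }
    apply ex_series_lim_0, ex_series_Rabs.
    apply (ex_series_DAlembert _ 0); [lra|intros n; specialize (HP n); lra|].
    apply (is_lim_seq_ext (fun n => 8 * r ^ n)).
    + intros n; cbn [prodn Nat.add]; rewrite Rabs_right.
      * field; specialize (HP n); lra.
      * apply Rle_ge, Rlt_le, Rdiv_lt_0_compat; [|apply HP].
        apply Rmult_lt_0_compat; [apply HP|]; assert (0 < r ^ n) by (apply pow_lt; lra); lra.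
    + replace (Finite 0) with (Rbar_mult 8 0) by (simpl; f_equal; ring).
      apply is_lim_seq_scal_l, is_lim_seq_geom; rewrite Rabs_right; lra.
Qed.

(** * The q-series behind the continued fraction *)

(** Exponents are quadratic in the indices. They are rewritten as sums of common monomials, so that
    after [pow_add] both sides of an identity are rational functions of the same powers. *)
Ltac pw_step r a b :=
  replace (r ^ a) with b in * by (rewrite <- ?pow_add; f_equal; lia).
Ltac pw a b c d e :=
  match goal with |- context [?r ^ a] => pw_step r a (r ^ b * r ^ c * r ^ d * r ^ e) end.
Ltac pw1 a b := replace a with b in * by lia.

(** With q = r, the next three are the q-Pochhammer symbols (q^(2k+1); q^2)_n, (q^2; q^2)_n and
    (-q^2; q^2)_n. *)
Definition qodd (r : R) (k n : nat) : R := prodn (fun i => 1 - r ^ (2 * (k + i) + 1)) n.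
Definition qev (r : R) (n : nat) : R := prodn (fun i => 1 - r ^ (2 * (i + 1))) n.
Definition qevp (r : R) (n : nat) : R := prodn (fun i => 1 + r ^ (2 * (i + 1))) n.

Lemma pow_bounds r n : 0 < r < 1 -> 0 < r ^ n <= 1.
Proof.
  intros Hr; split; [apply pow_lt; lra|].
  rewrite <- (pow1 n); apply pow_incr; lra.
Qed.

Lemma pow_S_bounds r n : 0 < r < 1 -> 0 < r ^ S n <= r.
Proof. intros Hr; simpl; pose proof (pow_bounds r n Hr); nra. Qed.

Lemma ex_series_pow_le r (a : nat -> nat) : 0 < r < 1 ->
  (forall n, (n <= a n)%nat) -> ex_series (fun n => r ^ a n).
Proof.
  intros Hr Ha; apply (ex_series_dominated _ (fun n => r ^ n)); [|apply ex_series_pow; lra].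
  intros n; rewrite Rabs_right by (apply Rle_ge, pow_le; lra).
  apply pow_le_pow; [lra|apply Ha].
Qed.

Lemma qodd_cvg r k : 0 < r < 1 -> exists l : R, 0 < l /\ is_lim_seq (qodd r k) l /\
  forall n, l <= qodd r k n <= 1.
Proof.
  intros Hr; apply (prodn_cvg_decr (fun i => r ^ (2 * (k + i) + 1)) r); [lra| |].
  - intros n; replace (2 * (k + n) + 1)%nat with (S (2 * (k + n))) by lia.
    pose proof (pow_S_bounds r (2 * (k + n)) Hr); lra.
  - apply ex_series_pow_le; [assumption|intros; lia].
Qed.

Lemma qev_cvg r : 0 < r < 1 -> exists l : R, 0 < l /\ is_lim_seq (qev r) l /\
  forall n, l <= qev r n <= 1.
Proof.
  intros Hr; apply (prodn_cvg_decr (fun i => r ^ (2 * (i + 1))) r); [lra| |].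
  - intros n; replace (2 * (n + 1))%nat with (S (2 * n + 1)) by lia.
    pose proof (pow_S_bounds r (2 * n + 1) Hr); lra.
  - apply ex_series_pow_le; [assumption|intros; lia].
Qed.

Lemma qevp_cvg r : 0 < r < 1 -> exists l : R, is_lim_seq (qevp r) l /\
  forall n, 1 <= qevp r n <= l.
Proof.
  intros Hr; apply (prodn_cvg_incr (fun i => r ^ (2 * (i + 1)))).
  - intros n; apply pow_le; lra.
  - apply ex_series_pow_le; [assumption|intros; lia].
Qed.

Lemma qodd_S r k n : qodd r k (S n) = qodd r k n * (1 - r ^ (2 * (k + n) + 1)).
Proof. reflexivity. Qed.

Lemma qodd_shift r k n : qodd r k (S n) = (1 - r ^ (2 * k + 1)) * qodd r (S k) n.
Proof.
  unfold qodd; rewrite prodn_shift; rewrite Nat.add_0_r; f_equal.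
  apply prodn_ext; intros i; do 2 f_equal; lia.
Qed.

Lemma qev_S r n : qev r (S n) = qev r n * (1 - r ^ (2 * (n + 1))).
Proof. reflexivity. Qed.

Lemma qevp_S r n : qevp r (S n) = qevp r n * (1 + r ^ (2 * (n + 1))).
Proof. reflexivity. Qed.

Lemma qev_pos r n : 0 < r < 1 -> 0 < qev r n.
Proof.
  intros Hr; apply prodn_pos; intros k; replace (2 * (k + 1))%nat with (S (2 * k + 1)) by lia.
  pose proof (pow_S_bounds r (2 * k + 1) Hr); lra.
Qed.

Lemma qevp_pos r n : 0 < r < 1 -> 0 < qevp r n.
Proof. intros Hr; apply prodn_pos; intros k; pose proof (pow_bounds r (2 * (k + 1)) Hr); lra. Qed.

Lemma qodd_bounds r k n : 0 < r < 1 -> 0 < qodd r k n <= 1.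
Proof.
  intros Hr; destruct (qodd_cvg r k Hr) as (l & Hl & _ & H); specialize (H n); lra.
Qed.

(* Ramanujan's solution of the three-term recurrence: cf_sum k is F(k+1), and the indices 2j+1 and
   2j+2 share the coefficients cf_coef n j. *)
Definition cf_coef (r E : R) (n j : nat) : R :=
  (-1) ^ n * r ^ (n * n) * qodd r j n / qev r n * (E / qevp r (n + j)).

Definition cf_sum (r E : R) (k : nat) : R :=
  Series (fun n => cf_coef r E n (Nat.div2 k) * r ^ (2 * Nat.div2 (S k) * n)).

Lemma cf_coef_bound r E : 0 < r < 1 -> 0 <= E ->
  exists C, 0 <= C /\ forall n j, Rabs (cf_coef r E n j) <= C * r ^ n.
Proof.
  intros Hr HE.
  destruct (qev_cvg r Hr) as (P & HP & _ & HPb).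
  destruct (qevp_cvg r Hr) as (Q & _ & HQb).
  exists (/ P * E); split.
  { apply Rmult_le_pos; [left; now apply Rinv_0_lt_compat|assumption]. }
  intros n j; unfold cf_coef, Rdiv; rewrite !Rabs_mult, pow_m1_abs.
  rewrite (Rabs_right (r ^ _)) by (apply Rle_ge, pow_le; lra).
  pose proof (qodd_bounds r j n Hr).
  rewrite (Rabs_right (qodd _ _ _)) by lra.
  specialize (HPb n); specialize (HQb (n + j)%nat).
  rewrite (Rabs_right (/ qev _ _)) by (left; apply Rinv_0_lt_compat; lra).
  rewrite (Rabs_right E) by lra.
  rewrite (Rabs_right (/ qevp _ _)) by (left; apply Rinv_0_lt_compat; lra).
  assert (H1 : r ^ (n * n) <= r ^ n) by (apply pow_le_pow; [lra|nia]).
  assert (H2 : 0 < / qev r n <= / P)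
    by (split; [apply Rinv_0_lt_compat; lra|apply Rinv_le_contravar; lra]).
  assert (H3 : 0 < / qevp r (n + j) <= 1).
  { split; [apply Rinv_0_lt_compat; lra|].
    rewrite <- Rinv_1; apply Rinv_le_contravar; lra. }
  assert (H4 : 0 < r ^ (n * n)) by (apply pow_lt; lra).
  assert (H5 : 0 <= r ^ (n * n) * qodd r j n <= r ^ n) by nra.
  assert (H6 : 0 <= r ^ (n * n) * qodd r j n * / qev r n <= r ^ n * / P)
    by (split; [apply Rmult_le_pos; lra|apply Rmult_le_compat; lra]).
  assert (H7 : 0 <= E * / qevp r (n + j) <= E) by nra.
  rewrite Rmult_1_l; replace (/ P * E * r ^ n) with (r ^ n * / P * E) by ring.
  apply Rmult_le_compat; lra.
Qed.

Lemma ex_series_cf_coef r E j k : 0 < r < 1 -> 0 <= E ->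
  ex_series (fun n => cf_coef r E n j * r ^ (2 * k * n)).
Proof.
  intros Hr HE; destruct (cf_coef_bound r E Hr HE) as (C & HC & H).
  apply (ex_series_dominated _ (fun n => C * r ^ n)).
  - intros n; rewrite Rabs_mult, (Rabs_right (r ^ _)) by (apply Rle_ge, pow_le; lra).
    specialize (H n j); pose proof (pow_bounds r (2 * k * n) Hr).
    pose proof (Rabs_pos (cf_coef r E n j)); nra.
  - apply ex_series_scal_R, ex_series_pow; lra.
Qed.

(** The difference of the first two summands carries 1 - r^(2n), which kills n = 0 and cancels the
    last factor of [qev]; index n + 1 on one side then meets index n on the other, term by term. *)
Lemma cf_sum_odd_rec r E j : 0 < r < 1 -> 0 <= E ->
  Series (fun n => cf_coef r E n j * r ^ (2 * j * n)) =
  Series (fun n => cf_coef r E n j * r ^ (2 * S j * n)) +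
  (- r ^ (2 * j + 1) + r ^ (4 * j + 2)) * Series (fun n => cf_coef r E n (S j) * r ^ (2 * S j * n)).
Proof.
  intros Hr HE.
  pose proof (ex_series_cf_coef r E j j Hr HE) as E1.
  pose proof (ex_series_cf_coef r E j (S j) Hr HE) as E2.
  match goal with |- ?a = ?b + ?c => enough (a - b = c) by lra end.
  rewrite <- Series_minus by assumption.
  rewrite Series_incr_1_aux by (rewrite !Nat.mul_0_r; ring).
  rewrite <- Series_scal_l; apply Series_ext; intros n.
  unfold cf_coef; rewrite qodd_shift, qev_S.
  replace (S n + j)%nat with (n + S j)%nat by lia.
  pose proof (qev_pos r n Hr); pose proof (qevp_pos r (n + S j) Hr).
  assert (H1 : 0 < 1 - r ^ (2 * (n + 1))).
  { replace (2 * (n + 1))%nat with (S (2 * n + 1)) by lia.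
    pose proof (pow_S_bounds r (2 * n + 1) Hr); lra. }
  pw (S n * S n)%nat (n * n)%nat n n 1%nat.
  pw (2 * j * S n)%nat (j * n)%nat (j * n)%nat j j.
  pw (2 * S j * S n)%nat (j * n)%nat (j * n)%nat (j + j)%nat (n + n + 2)%nat.
  pw (2 * S j * n)%nat (j * n)%nat (j * n)%nat n n.
  pw1 (2 * j + 1)%nat (j + j + 1)%nat.
  pw1 (4 * j + 2)%nat ((j + j) + (j + j) + 2)%nat.
  pw1 (2 * (n + 1))%nat (n + n + 2)%nat.
  rewrite !pow_add in *; rewrite !pow_1.
  simpl ((-1) ^ S n).
  field; repeat split; try lra.
Qed.

Lemma is_lim_seq_geom_dominated (a : nat -> R) C r : 0 < r < 1 ->
  (forall n, Rabs (a n) <= C * r ^ n) -> is_lim_seq a 0.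
Proof.
  intros Hr H; apply is_lim_seq_abs_0.
  apply (is_lim_seq_le_le (fun _ => 0) _ (fun n => C * r ^ n)).
  - intros n; split; [apply Rabs_pos|apply H].
  - apply is_lim_seq_const.
  - replace (Finite 0) with (Rbar_mult C 0) by (simpl; f_equal; ring).
    apply is_lim_seq_scal_l, is_lim_seq_geom; rewrite Rabs_right; lra.
Qed.

Lemma cf_sum_even_rec r E j : 0 < r < 1 -> 0 <= E ->
  Series (fun n => cf_coef r E n j * r ^ (2 * S j * n)) =
  Series (fun n => cf_coef r E n (S j) * r ^ (2 * S j * n)) +
  (r ^ (2 * j + 2) + r ^ (4 * j + 4)) *
    Series (fun n => cf_coef r E n (S j) * r ^ (2 * S (S j) * n)).
Proof.
  intros Hr HE.
  pose proof (ex_series_cf_coef r E j (S j) Hr HE) as E1.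
  pose proof (ex_series_cf_coef r E (S j) (S j) Hr HE) as E2.
  pose proof (ex_series_cf_coef r E (S j) (S (S j)) Hr HE) as E3.
  match goal with |- ?a = ?b + ?c => enough (a - b - c = 0) by lra end.
  rewrite <- Series_scal_l, <- Series_minus by assumption.
  rewrite <- Series_minus;
    [|apply (@ex_series_minus R_AbsRing R_NormedModule); assumption
     |now apply ex_series_scal_R].
  (* Here the summands do not match individually. The certificate at n is a power of r times summand
     n - 1 of the second series, and 0 at n = 0. *)
  pose (Y := fun n => match n with O => 0 | S m =>
      r ^ (2 * (2 * j + 2 + m)) * (cf_coef r E m (S j) * r ^ (2 * S j * m)) end).
  apply is_series_unique, (telescoping_series _ Y).
  - intros [|m]; unfold Y, cf_coef.
    + rewrite !Nat.mul_0_r, !Nat.add_0_l, qevp_S; unfold qodd, qev; simpl prodn; simpl (_ ^ 0).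
      pose proof (qevp_pos r j Hr); pose proof (pow_bounds r (2 * (j + 1)) Hr).
      pw1 (2 * (2 * j + 2 + 0))%nat ((j + j) + (j + j) + 4)%nat.
      pw1 (4 * j + 4)%nat ((j + j) + (j + j) + 4)%nat.
      pw1 (2 * (j + 1))%nat (j + j + 2)%nat.
      pw1 (2 * j + 2)%nat (j + j + 2)%nat.
      rewrite !pow_add in *; field; repeat split; lra.
    + rewrite (qodd_shift r j m), (qodd_S r (S j) m), qev_S.
      replace (S m + j)%nat with (m + S j)%nat by lia.
      replace (S m + S j)%nat with (S (m + S j)) by lia; rewrite qevp_S.
      pose proof (qev_pos r m Hr); pose proof (qevp_pos r (m + S j) Hr).
      pose proof (pow_bounds r (2 * (m + S j + 1)) Hr) as H4.
      assert (H5 : 0 < 1 - r ^ (2 * (m + 1))).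
      { replace (2 * (m + 1))%nat with (S (2 * m + 1)) by lia.
        pose proof (pow_S_bounds r (2 * m + 1) Hr); lra. }
      pw (S m * S m)%nat (m * m)%nat m m 1%nat.
      pw (2 * S j * S m)%nat (j * m)%nat (j * m)%nat (j + j)%nat (m + m + 2)%nat.
      pw (2 * S (S j) * S m)%nat (j * m)%nat (j * m)%nat (j + j)%nat (m + m + m + m + 4)%nat.
      pw (2 * S j * m)%nat (j * m)%nat (j * m)%nat m m.
      pw1 (2 * j + 1)%nat (j + j + 1)%nat.
      pw1 (2 * (S j + m) + 1)%nat (j + j + m + m + 3)%nat.
      pw1 (4 * j + 4)%nat ((j + j) + (j + j) + 4)%nat.
      pw1 (2 * (m + 1))%nat (m + m + 2)%nat.
      pw1 (2 * (m + S j + 1))%nat (m + m + j + j + 4)%nat.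
      pw1 (2 * (2 * j + 2 + m))%nat (j + j + j + j + m + m + 4)%nat.
      pw1 (2 * (2 * j + 2 + S m))%nat (j + j + j + j + m + m + 6)%nat.
      pw1 (2 * j + 2)%nat (j + j + 2)%nat.
      rewrite !pow_add in *; rewrite !pow_1.
      simpl ((-1) ^ S m).
      field; repeat split; try lra.
  - destruct (cf_coef_bound r E Hr HE) as (C & HC & HB).
    apply is_lim_seq_incr_1, (is_lim_seq_geom_dominated _ C r Hr); intros m; unfold Y.
    rewrite !Rabs_mult, !(Rabs_right (r ^ _)) by (apply Rle_ge, pow_le; lra).
    specialize (HB m (S j)); pose proof (pow_bounds r (2 * (2 * j + 2 + m)) Hr).
    pose proof (pow_bounds r (2 * S j * m) Hr).
    pose proof (Rabs_pos (cf_coef r E m (S j))).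
    assert (0 <= r ^ (2 * (2 * j + 2 + m)) * r ^ (2 * S j * m) <= 1) by nra.
    nra.
Qed.

Lemma cf_sum_rec r E k : 0 < r < 1 -> 0 <= E ->
  cf_sum r E k = cf_sum r E (S k) +
    ((- r) ^ S k + (- r) ^ (2 * S k)) * cf_sum r E (S (S k)).
Proof.
  intros Hr HE; unfold cf_sum; rewrite !pow_opp, pow_m1_even.
  change (Nat.div2 (S (S k))) with (S (Nat.div2 k)); change (Nat.div2 (S (S (S k)))) with (S (Nat.div2 (S k))).
  destruct (Nat.Even_or_Odd k) as [[j ->]|[j ->]].
  - rewrite Nat.div2_double, (Nat.div2_succ_double j).
    rewrite cf_sum_odd_rec by assumption.
    replace (S (2 * j)) with (2 * j + 1)%nat by lia; rewrite pow_m1_odd.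
    pw1 (2 * (2 * j + 1))%nat (4 * j + 2)%nat; ring.
  - replace (Nat.div2 (S (2 * j + 1))) with (S j)
      by (replace (S (2 * j + 1)) with (2 * S j)%nat by lia; now rewrite Nat.div2_double).
    replace (Nat.div2 (2 * j + 1)) with j
      by (replace (2 * j + 1)%nat with (S (2 * j)) by lia; now rewrite Nat.div2_succ_double).
    rewrite cf_sum_even_rec by assumption.
    replace (S (2 * j + 1)) with (2 * S j)%nat by lia; rewrite pow_m1_even.
    pw1 (2 * S j)%nat (2 * j + 2)%nat; pw1 (2 * (2 * j + 2))%nat (4 * j + 4)%nat.
    ring.
Qed.

(** Only the term n = 0 survives for large k, and it is E / qevp (div2 k); this is why [cf_coef] is
    normalised by the limit [E]. *)
Lemma cf_sum_lim r E : 0 < r < 1 -> 0 < E -> is_lim_seq (qevp r) E ->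
  is_lim_seq (cf_sum r E) 1.
Proof.
  intros Hr HE HQ; destruct (cf_coef_bound r E Hr (Rlt_le _ _ HE)) as (C & HC & HB).
  assert (Hb : forall n k, Rabs (cf_coef r E n (Nat.div2 k) * r ^ (2 * Nat.div2 (S k) * n))
     <= C * r ^ n * r ^ (2 * Nat.div2 (S k) * n)).
  { intros n k; rewrite Rabs_mult, (Rabs_right (r ^ _)) by (apply Rle_ge, pow_le; lra).
    apply Rmult_le_compat_r; [apply pow_le; lra|apply HB]. }
  destruct (tannery (fun k n => cf_coef r E n (Nat.div2 k) * r ^ (2 * Nat.div2 (S k) * n))
    (fun n => C * r ^ n) (fun n => match n with O => 1 | S _ => 0 end)) as [Ec L].
  - intros [|n].
    + apply (is_lim_seq_ext (fun k => E / qevp r (Nat.div2 k))).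
      * intros k; unfold cf_coef, qodd, qev; rewrite !Nat.mul_0_r; cbn [prodn Nat.add Nat.mul pow]; field.
        pose proof (qevp_pos r (Nat.div2 k) Hr); lra.
      * replace (Finite 1) with (Rbar_div E E) by (simpl; f_equal; field; lra).
        apply is_lim_seq_div'; [apply is_lim_seq_const| |lra].
        apply (is_lim_seq_subseq (qevp r)); [|exact HQ].
        intros P [N HN]; exists (2 * N)%nat; intros k Hk; apply HN.
        rewrite <- (Nat.div2_double N); now apply Nat.div2_le_mono.
    + apply (is_lim_seq_geom_dominated _ C r Hr); intros k.
      eapply Rle_trans; [apply Hb|].
      pose proof (pow_bounds r (S n) Hr).
      assert (r ^ (2 * Nat.div2 (S k) * S n) <= r ^ k).
      { apply pow_le_pow; [lra|]. pose proof (Nat.div2_odd (S k)) as D.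
        destruct (Nat.odd (S k)); simpl Nat.b2n in D; nia. }
      pose proof (pow_bounds r (2 * Nat.div2 (S k) * S n) Hr).
      assert (0 <= C * r ^ S n <= C) by nra; nra.
  - intros k n; eapply Rle_trans; [apply Hb|].
    pose proof (pow_bounds r (2 * Nat.div2 (S k) * n) Hr).
    pose proof (pow_bounds r n Hr); assert (0 <= C * r ^ n) by nra; nra.
  - apply ex_series_scal_R, ex_series_pow; lra.
  - replace 1 with (Series (fun n => match n with O => 1 | S _ => 0 end)); [exact L|].
    rewrite Series_incr_1 by exact Ec.
    replace 1 with (1 + 0) at 2 by ring; f_equal.
    apply (is_series_unique _ 0), (telescoping_series _ (fun _ => 0));
      [intros; ring|apply is_lim_seq_const].
Qed.

(** * A Bailey pair *)

(** The reciprocal of (q^2; q^2)_z, with the customary value 0 for negative z, so that finite sums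
    can be written as infinite ones. *)
Definition iqev (r : R) (z : Z) : R :=
  if Z_lt_dec z 0 then 0 else / qev r (Z.to_nat z).

Lemma iqev_nat r n : iqev r (Z.of_nat n) = / qev r n.
Proof. unfold iqev; destruct (Z_lt_dec _ _); [lia|now rewrite Nat2Z.id]. Qed.

Lemma iqev_neg r z : (z < 0)%Z -> iqev r z = 0.
Proof. intros H; unfold iqev; destruct (Z_lt_dec _ _); [reflexivity|lia]. Qed.

Lemma one_minus_pow_pos r n : 0 < r < 1 -> 0 < 1 - r ^ (2 * (n + 1)).
Proof.
  intros Hr; replace (2 * (n + 1))%nat with (S (2 * n + 1)) by lia.
  pose proof (pow_S_bounds r (2 * n + 1) Hr); lra.
Qed.

(** The convention at -1 makes this valid at n = 0 too, where 1 - r^0 = 0. *)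
Lemma iqev_pred r n : 0 < r < 1 ->
  iqev r (Z.of_nat n - 1) = iqev r (Z.of_nat n) * (1 - r ^ (2 * n)).
Proof.
  intros Hr; rewrite iqev_nat; destruct n as [|n].
  - rewrite iqev_neg by lia; simpl; ring.
  - replace (Z.of_nat (S n) - 1)%Z with (Z.of_nat n) by lia; rewrite iqev_nat.
    rewrite qev_S; pose proof (qev_pos r n Hr); pose proof (one_minus_pow_pos r n Hr).
    replace (2 * S n)%nat with (2 * (n + 1))%nat by lia.
    field; lra.
Qed.

Lemma iqev_bound r : 0 < r < 1 -> exists C, 0 <= C /\ forall z, 0 <= iqev r z <= C.
Proof.
  intros Hr; destruct (qev_cvg r Hr) as (P & HP & _ & HB); exists (/ P).
  assert (0 < / P) by now apply Rinv_0_lt_compat.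
  split; [lra|]; intros z; unfold iqev; destruct (Z_lt_dec z 0); [lra|].
  specialize (HB (Z.to_nat z)); split; [left; apply Rinv_0_lt_compat; lra|].
  apply Rinv_le_contravar; lra.
Qed.

(** Summand of a Bailey pair relative to 1 in base q^2, with alpha_s = (-1)^s q^(2 s^2), to be
    doubled for s > 0 by [two_sided]. *)
Definition bailey (r : R) (n s : nat) : R :=
  (-1) ^ s * r ^ (2 * (s * s)) * iqev r (Z.of_nat n - Z.of_nat s) *
  iqev r (Z.of_nat n + Z.of_nat s).

(* Weights folding a two-sided series with even terms onto the natural numbers. *)
Definition two_sided (s : nat) : R := match s with O => 1 | S _ => 2 end.

Lemma bailey_bound r : 0 < r < 1 -> exists C, 0 <= C /\
  forall n s, Rabs (bailey r n s) <= C * r ^ (2 * (s * s)).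
Proof.
  intros Hr; destruct (iqev_bound r Hr) as (C & HC & HB); exists (C * C).
  split; [nra|]; intros n s; unfold bailey.
  rewrite !Rabs_mult, pow_m1_abs, (Rabs_right (r ^ _)) by (apply Rle_ge, pow_le; lra).
  pose proof (HB (Z.of_nat n - Z.of_nat s)%Z); pose proof (HB (Z.of_nat n + Z.of_nat s)%Z).
  rewrite !Rabs_right by lra.
  pose proof (pow_bounds r (2 * (s * s)) Hr).
  rewrite Rmult_1_l, (Rmult_comm (C * C)), Rmult_assoc.
  apply Rmult_le_compat_l; [lra|]; apply Rmult_le_compat; lra.
Qed.

Lemma ex_series_bailey r n : 0 < r < 1 -> ex_series (bailey r n).
Proof.
  intros Hr; destruct (bailey_bound r Hr) as (C & HC & HB).
  apply (ex_series_dominated _ _ (HB n)), ex_series_scal_R, ex_series_pow_le; [assumption|].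
  intros; nia.
Qed.

Lemma ex_series_two_sided (a : nat -> R) : ex_series a -> ex_series (fun s => two_sided s * a s).
Proof.
  intros H; apply ex_series_incr_1; unfold two_sided.
  apply ex_series_scal_R; now apply ex_series_incr_1 in H.
Qed.

(** Telescoping certificate in s for the recurrence in n of [bailey_sum]. For s <= n all terms are
    multiples of one product of reciprocals; for s > n all of them vanish. *)
Lemma bailey_step r n s : 0 < r < 1 ->
  (1 - r ^ (4 * S n)) * bailey r (S n) (S s) - bailey r n (S s) =
  (-1) ^ S s * r ^ (2 * (s * S s + S n)) * iqev r (Z.of_nat n - Z.of_nat s)
     * iqev r (Z.of_nat n + Z.of_nat s + 1) -
  (-1) ^ S (S s) * r ^ (2 * (S s * S (S s) + S n)) * iqev r (Z.of_nat n - Z.of_nat (S s))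
     * iqev r (Z.of_nat n + Z.of_nat (S s) + 1).
Proof.
  intros Hr; unfold bailey.
  replace (Z.of_nat (S n) - Z.of_nat (S s))%Z with (Z.of_nat n - Z.of_nat s)%Z by lia.
  replace (Z.of_nat n - Z.of_nat (S s))%Z with (Z.of_nat n - Z.of_nat s - 1)%Z by lia.
  replace (Z.of_nat (S n) + Z.of_nat (S s))%Z with (Z.of_nat (n + s + 2)) by lia.
  replace (Z.of_nat n + Z.of_nat (S s) + 1)%Z with (Z.of_nat (n + s + 2)) by lia.
  replace (Z.of_nat n + Z.of_nat (S s))%Z with (Z.of_nat (n + s + 2) - 1)%Z by lia.
  replace (Z.of_nat n + Z.of_nat s + 1)%Z with (Z.of_nat (n + s + 2) - 1)%Z by lia.
  rewrite (iqev_pred r (n + s + 2)) by assumption.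
  set (b := iqev r (Z.of_nat (n + s + 2))).
  destruct (Nat.le_gt_cases s n) as [H|H].
  - destruct (Nat.le_exists_sub s n H) as (d & -> & _).
    replace (Z.of_nat (d + s) - Z.of_nat s)%Z with (Z.of_nat d) by lia.
    rewrite (iqev_pred r d) by assumption; set (a := iqev r (Z.of_nat d)).
    simpl ((-1) ^ S (S s)); simpl ((-1) ^ S s).
    pw1 (2 * (S s * S s))%nat (2 * (s * s) + s + s + s + s + 2)%nat.
    pw1 (2 * (s * S s + S (d + s)))%nat (2 * (s * s) + s + s + s + s + d + d + 2)%nat.
    pw1 (2 * (S s * S (S s) + S (d + s)))%nat (2 * (s * s) + s + s + s + s + s + s + s + s + d + d + 6)%nat.
    pw1 (4 * S (d + s))%nat (d + d + s + s + d + d + s + s + 4)%nat.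
    pw1 (2 * (d + s + s + 2))%nat (d + d + s + s + s + s + 4)%nat.
    pw1 (2 * d)%nat (d + d)%nat.
    rewrite !pow_add; ring.
  - rewrite !iqev_neg by lia; ring.
Qed.

(** The right side is 1 / (q^4; q^4)_n; both sides satisfy (1 - q^(4(n+1))) X(n+1) = X(n). *)
Lemma bailey_sum r n : 0 < r < 1 ->
  Series (fun s => two_sided s * bailey r n s) = / (qev r n * qevp r n).
Proof.
  intros Hr; induction n as [|n IH].
  - rewrite Series_incr_1 by apply ex_series_two_sided, ex_series_bailey, Hr.
    rewrite (Series_ext _ (fun _ => 0 * 0)).
    + rewrite Series_scal_l; unfold bailey, two_sided; simpl; rewrite !(iqev_nat r 0 : iqev r 0 = _).
      unfold qev, qevp; simpl; field.
    + intros s; unfold bailey; rewrite iqev_neg by lia; ring.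
  - assert (H : (1 - r ^ (4 * S n)) * Series (fun s => two_sided s * bailey r (S n) s)
       - Series (fun s => two_sided s * bailey r n s) = 0).
    { rewrite <- Series_scal_l, <- Series_minus;
        [|apply ex_series_scal_R, ex_series_two_sided, ex_series_bailey, Hr
         |apply ex_series_two_sided, ex_series_bailey, Hr].
      pose (Y := fun s => match s with O => 0 | S s =>
         2 * ((-1) ^ S s * r ^ (2 * (s * S s + S n)) * iqev r (Z.of_nat n - Z.of_nat s)
         * iqev r (Z.of_nat n + Z.of_nat s + 1)) end).
      apply is_series_unique, (telescoping_series _ Y).
      - intros [|s]; unfold Y, two_sided.
        + unfold bailey; rewrite !Nat.mul_0_l, !Nat.mul_0_r, Nat.add_0_l, !Z.sub_0_r, !Z.add_0_r.
          replace (Z.of_nat n) with (Z.of_nat (S n) - 1)%Z by lia.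
          rewrite iqev_pred by assumption.
          replace (Z.of_nat (S n) - 1 + 1)%Z with (Z.of_nat (S n)) by lia.
          simpl ((-1) ^ _); simpl (r ^ 0); rewrite ?Nat.add_0_l.
          pw1 (4 * S n)%nat (2 * S n + 2 * S n)%nat; rewrite pow_add; ring.
        + rewrite <- Rmult_minus_distr_l, <- bailey_step by assumption; ring.
      - apply (is_lim_seq_ext_loc (fun _ => 0)); [|apply is_lim_seq_const].
        exists (S (S n)); intros [|s] Hs; [lia|]; unfold Y.
        rewrite iqev_neg by lia; ring. }
    rewrite IH in H; rewrite qev_S, qevp_S.
    pose proof (qev_pos r n Hr); pose proof (qevp_pos r n Hr).
    pose proof (pow_bounds r (2 * (n + 1)) Hr).
    pose proof (one_minus_pow_pos r n Hr).
    replace (4 * S n)%nat with (2 * (n + 1) + 2 * (n + 1))%nat in H by lia; rewrite pow_add in H.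
    set (x := r ^ (2 * (n + 1))) in *.
    apply (Rmult_eq_reg_l (1 - x * x)); [|nra].
    rewrite (Rminus_diag_uniq _ _ H).
    field; repeat split; lra.
Qed.

(** The companion pair relative to q^2, which serves for F(2). Its summand at s is the sum of the
    [bailey] summands at s and s + 1, so the series regroups into the two-sided one. *)
Lemma bailey_sum_shifted r n : 0 < r < 1 ->
  Series (fun s => (-1) ^ s * r ^ (2 * (s * s)) * (1 - r ^ (2 * (2 * s + 1))) *
    iqev r (Z.of_nat n - Z.of_nat s) * iqev r (Z.of_nat n + Z.of_nat s + 1)) =
  / (qev r n * qevp r n).
Proof.
  intros Hr; rewrite <- bailey_sum by assumption.
  pose proof (ex_series_bailey r n Hr) as E.
  assert (E1 : ex_series (fun s => bailey r n (S s))) by now apply ex_series_incr_1 in E.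
  rewrite (Series_incr_1 (fun s => two_sided s * bailey r n s))
    by now apply ex_series_two_sided.
  unfold two_sided; rewrite Series_scal_l.
  transitivity (Series (fun s => bailey r n s + bailey r n (S s))).
  - apply Series_ext; intros s; unfold bailey.
    destruct (Nat.le_gt_cases s n) as [H|H];
      [|rewrite (iqev_neg r (Z.of_nat n - Z.of_nat s)), (iqev_neg r (Z.of_nat n - Z.of_nat (S s)))
          by lia; ring].
    destruct (Nat.le_exists_sub s n H) as (d & -> & _).
    replace (Z.of_nat (d + s) - Z.of_nat (S s))%Z with (Z.of_nat d - 1)%Z by lia.
    replace (Z.of_nat (d + s) - Z.of_nat s)%Z with (Z.of_nat d) by lia.
    replace (Z.of_nat (d + s) + Z.of_nat s + 1)%Z with (Z.of_nat (d + s + s + 1)) by lia.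
    replace (Z.of_nat (d + s) + Z.of_nat (S s))%Z with (Z.of_nat (d + s + s + 1)) by lia.
    replace (Z.of_nat (d + s) + Z.of_nat s)%Z with (Z.of_nat (d + s + s + 1) - 1)%Z by lia.
    rewrite !iqev_pred by assumption; simpl ((-1) ^ S s).
    pw1 (2 * (S s * S s))%nat (2 * (s * s) + s + s + s + s + 2)%nat.
    pw1 (2 * (2 * s + 1))%nat (s + s + s + s + 2)%nat.
    pw1 (2 * (d + s + s + 1))%nat (d + d + s + s + s + s + 2)%nat.
    pw1 (2 * d)%nat (d + d)%nat.
    rewrite !pow_add; ring.
  - rewrite Series_plus by assumption; rewrite (Series_incr_1 (bailey r n)) by assumption; ring.
Qed.

(* A limiting q-Gauss sum; its value follows from letting j tend to infinity in [heine_rec]. *)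
Definition heine (r : R) (s j : nat) : R :=
  Series (fun m => (-1) ^ m * r ^ (m * m) * r ^ (2 * j * m) * qodd r 0 (s + m)
    / (qev r m * qev r (s + j + m))).

Lemma heine_term_bound r : 0 < r < 1 -> exists C, 0 <= C /\ forall s j m,
  Rabs ((-1) ^ m * r ^ (m * m) * r ^ (2 * j * m) * qodd r 0 (s + m)
    / (qev r m * qev r (s + j + m))) <= C * r ^ m * r ^ (2 * j * m).
Proof.
  intros Hr; destruct (iqev_bound r Hr) as (C & HC & HB); exists (C * C).
  split; [nra|]; intros s j m; unfold Rdiv; rewrite Rinv_mult, <- !iqev_nat.
  rewrite !Rabs_mult, pow_m1_abs, !(Rabs_right (r ^ _)) by (apply Rle_ge, pow_le; lra).
  pose proof (HB (Z.of_nat m)) as H1; pose proof (HB (Z.of_nat (s + j + m))) as H2.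
  pose proof (qodd_bounds r 0 (s + m) Hr).
  rewrite !Rabs_right by lra.
  assert (H3 : r ^ (m * m) <= r ^ m) by (apply pow_le_pow; [lra|nia]).
  pose proof (pow_bounds r (m * m) Hr); pose proof (pow_bounds r (2 * j * m) Hr).
  set (x := r ^ (m * m)) in *; set (y := r ^ (2 * j * m)) in *; set (k := qodd r 0 (s + m)) in *.
  set (a := iqev r (Z.of_nat m)) in *; set (b := iqev r (Z.of_nat (s + j + m))) in *.
  assert (0 <= a * b <= C * C) by (split; [nra|apply Rmult_le_compat; lra]).
  assert (0 <= x * k <= r ^ m) by nra.
  replace (1 * x * y * k * (a * b)) with (y * ((a * b) * (x * k))) by ring.
  rewrite (Rmult_comm _ y); apply Rmult_le_compat_l; [lra|].
  apply Rmult_le_compat; lra.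
Qed.

Lemma ex_series_heine r s j : 0 < r < 1 ->
  ex_series (fun m => (-1) ^ m * r ^ (m * m) * r ^ (2 * j * m) * qodd r 0 (s + m)
    / (qev r m * qev r (s + j + m))).
Proof.
  intros Hr; destruct (heine_term_bound r Hr) as (C & HC & HB).
  apply (ex_series_dominated _ (fun m => C * r ^ m)); [|apply ex_series_scal_R, ex_series_pow; lra].
  intros m; eapply Rle_trans; [apply HB|].
  pose proof (pow_bounds r (2 * j * m) Hr); pose proof (pow_bounds r m Hr).
  assert (0 <= C * r ^ m) by nra; nra.
Qed.

Lemma heine_rec r s j : 0 < r < 1 -> heine r s j = (1 - r ^ (2 * j + 1)) * heine r s (S j).
Proof.
  intros Hr; apply Rminus_diag_uniq; unfold heine.
  rewrite <- Series_scal_l, <- Series_minus;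
    [|now apply ex_series_heine|now apply ex_series_scal_R, ex_series_heine].
  pose (Y := fun m => match m with O => 0 | S m =>
    - ((-1) ^ m * r ^ (S m * S m) * r ^ (2 * j * S m) * qodd r 0 (s + S m)
    / (qev r m * qev r (s + j + S m))) end).
  apply is_series_unique, (telescoping_series _ Y).
  - assert (H0 : forall m, Y m = (-1) ^ m * r ^ (m * m) * r ^ (2 * j * m) * qodd r 0 (s + m)
        * (1 - r ^ (2 * m)) / (qev r m * qev r (s + j + m))).
    { intros [|m]; unfold Y; [simpl; unfold Rdiv; ring|].
      rewrite (qev_S r m); simpl ((-1) ^ S m).
      replace (2 * S m)%nat with (2 * (m + 1))%nat by lia.
      pose proof (one_minus_pow_pos r m Hr); pose proof (qev_pos r m Hr);
      pose proof (qev_pos r (s + j + S m) Hr).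
      field; repeat split; lra. }
    intros m; rewrite H0; unfold Y; simpl ((-1) ^ S m).
    replace (s + S m)%nat with (S (s + m)) by lia; rewrite qodd_S.
    replace (s + j + S m)%nat with (S (s + j + m)) by lia.
    replace (s + S j + m)%nat with (S (s + j + m)) by lia; rewrite qev_S.
    pose proof (qev_pos r m Hr); pose proof (qev_pos r (s + j + m) Hr).
    pose proof (one_minus_pow_pos r (s + j + m) Hr).
    pw (S m * S m)%nat (m * m)%nat m m 1%nat.
    pw1 (2 * j * m)%nat (j * m + j * m)%nat.
    pw1 (2 * j * S m)%nat (j * m + j * m + j + j)%nat.
    pw1 (2 * S j * m)%nat (j * m + j * m + m + m)%nat.
    pw1 (2 * (0 + (s + m)) + 1)%nat (s + s + m + m + 1)%nat.
    pw1 (2 * (s + j + m + 1))%nat (s + s + j + j + m + m + 2)%nat.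
    pw1 (2 * j + 1)%nat (j + j + 1)%nat.
    pw1 (2 * m)%nat (m + m)%nat.
    rewrite !pow_add in *; rewrite !pow_1.
    field; repeat split; lra.
  - destruct (iqev_bound r Hr) as (C & HC & HB).
    apply is_lim_seq_incr_1, (is_lim_seq_geom_dominated _ (C * C) r Hr); intros m; unfold Y.
    rewrite Rabs_Ropp; unfold Rdiv; rewrite Rinv_mult, <- !iqev_nat.
    rewrite !Rabs_mult, pow_m1_abs, !(Rabs_right (r ^ _)) by (apply Rle_ge, pow_le; lra).
    pose proof (HB (Z.of_nat m)); pose proof (HB (Z.of_nat (s + j + S m))).
    pose proof (qodd_bounds r 0 (s + S m) Hr).
    rewrite !Rabs_right by lra.
    assert (r ^ (S m * S m) <= r ^ m) by (apply pow_le_pow; [lra|nia]).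
    pose proof (pow_bounds r (S m * S m) Hr); pose proof (pow_bounds r (2 * j * S m) Hr).
    assert (0 <= iqev r (Z.of_nat m) * iqev r (Z.of_nat (s + j + S m)) <= C * C)
      by (split; [nra|apply Rmult_le_compat; lra]).
    assert (0 <= r ^ (S m * S m) * r ^ (2 * j * S m) <= r ^ m) by nra.
    assert (0 <= r ^ (S m * S m) * r ^ (2 * j * S m) * qodd r 0 (s + S m) <= r ^ m) by nra.
    rewrite Rmult_1_l, (Rmult_comm (C * C)); apply Rmult_le_compat; lra.
Qed.

(** By [heine_rec] the left side does not depend on j, and as j grows only the term m = 0
    remains. *)
Lemma heine_value (r K P : R) : 0 < r < 1 -> 0 < P ->
  is_lim_seq (qodd r 0) K -> is_lim_seq (qev r) P ->
  forall s j, qodd r 0 j * heine r s j = K * qodd r 0 s / P.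
Proof.
  intros Hr HP HK HPl s j.
  assert (Hc : forall i, qodd r 0 (j + i) * heine r s (j + i) = qodd r 0 j * heine r s j).
  { induction i as [|i IH]; [now rewrite Nat.add_0_r|].
    rewrite <- IH, (heine_rec r s (j + i)) by assumption.
    replace (j + S i)%nat with (S (j + i)) by lia; rewrite qodd_S; simpl (0 + _)%nat; ring. }
  destruct (heine_term_bound r Hr) as (C & HC & HB).
  destruct (tannery (fun j m => (-1) ^ m * r ^ (m * m) * r ^ (2 * j * m) * qodd r 0 (s + m)
    / (qev r m * qev r (s + j + m))) (fun m => C * r ^ m)
    (fun m => match m with O => qodd r 0 s / P | S _ => 0 end)) as [Ec L].
  - intros [|m].
    + apply (is_lim_seq_ext (fun i => qodd r 0 s / qev r (i + s))).
      * intros i; rewrite !Nat.mul_0_r, !Nat.add_0_r, (Nat.add_comm i).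
        cbn [pow]; unfold qev at 2; cbn [prodn].
        pose proof (qev_pos r (s + i) Hr); field; lra.
      * apply is_lim_seq_div'; [apply is_lim_seq_const| |lra].
        now apply (is_lim_seq_incr_n (qev r) s).
    + apply (is_lim_seq_geom_dominated _ C r Hr); intros i.
      eapply Rle_trans; [apply HB|].
      assert (r ^ (2 * i * S m) <= r ^ i) by (apply pow_le_pow; [lra|nia]).
      pose proof (pow_bounds r (2 * i * S m) Hr); pose proof (pow_bounds r (S m) Hr).
      assert (0 <= C * r ^ S m <= C) by nra; nra.
  - intros i m; eapply Rle_trans; [apply HB|].
    pose proof (pow_bounds r (2 * i * m) Hr); pose proof (pow_bounds r m Hr).
    assert (0 <= C * r ^ m) by nra; nra.
  - apply ex_series_scal_R, ex_series_pow; lra.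
  - assert (EL : Series (fun m => match m with O => qodd r 0 s / P | S _ => 0 end) = qodd r 0 s / P).
    { rewrite Series_incr_1 by exact Ec.
      replace (Series _) with 0; [ring|symmetry].
      apply (is_series_unique _ 0), (telescoping_series _ (fun _ => 0));
        [intros; ring|apply is_lim_seq_const]. }
    rewrite EL in L.
    assert (L2 : is_lim_seq (fun i => qodd r 0 (i + j) * heine r s (i + j)) (K * (qodd r 0 s / P))).
    { apply is_lim_seq_mult'; [now apply (is_lim_seq_incr_n (qodd r 0) j K)|].
      apply (is_lim_seq_incr_n (heine r s) j); exact L. }
    apply is_lim_seq_unique in L2.
    rewrite (Lim_seq_ext _ (fun _ => qodd r 0 j * heine r s j)), Lim_seq_const in L2
      by (intros i; rewrite (Nat.add_comm i); apply Hc).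
    injection L2 as ->; unfold Rdiv; ring.
Qed.

(** * The first two values of the solution as theta series *)

Lemma cf_coef_0 r E n : 0 < r < 1 ->
  cf_coef r E n 0 = E * ((-1) ^ n * r ^ (n * n) * qodd r 0 n * / (qev r n * qevp r n)).
Proof.
  intros Hr; unfold cf_coef; rewrite Nat.add_0_r.
  pose proof (qev_pos r n Hr); pose proof (qevp_pos r n Hr); field; lra.
Qed.

(** The factor 1 / (qev n * qevp n) is expanded by the Bailey pair and the sums are interchanged;
    the sum over n is [heine r s s] = K / P, which leaves q^(s^2 + 2 s^2). *)
Lemma cf_sum_0_value (r E K P : R) : 0 < r < 1 -> 0 < P ->
  is_lim_seq (qodd r 0) K -> is_lim_seq (qev r) P ->
  cf_sum r E 0 = E * (K / P) * Series (fun s => two_sided s * r ^ (3 * (s * s))).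
Proof.
  intros Hr HP HK HPl; unfold cf_sum; simpl Nat.div2.
  destruct (bailey_bound r Hr) as (C & HC & HB).
  assert (Hb2 : forall s, 0 <= two_sided s <= 2) by (intros [|s]; simpl; lra).
  transitivity (E * Series (fun n => Series (fun s =>
     (-1) ^ n * r ^ (n * n) * qodd r 0 n * (two_sided s * bailey r n s)))).
  { rewrite <- Series_scal_l; apply Series_ext; intros n.
    rewrite cf_coef_0, Series_scal_l, bailey_sum by assumption; simpl; ring. }
  rewrite Rmult_assoc; f_equal.
  destruct (series_swap (fun n s => (-1) ^ n * r ^ (n * n) * qodd r 0 n * (two_sided s * bailey r n s))
    (fun n => C * r ^ n) (fun s => 2 * r ^ (2 * (s * s)))) as [-> _].
  - intros n s; rewrite !Rabs_mult, pow_m1_abs, (Rabs_right (r ^ _)) by (apply Rle_ge, pow_le; lra).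
    pose proof (qodd_bounds r 0 n Hr); pose proof (Hb2 s).
    rewrite (Rabs_right (qodd _ _ _)), (Rabs_right (two_sided s)) by lra.
    specialize (HB n s); pose proof (Rabs_pos (bailey r n s)).
    assert (r ^ (n * n) <= r ^ n) by (apply pow_le_pow; [lra|nia]).
    pose proof (pow_bounds r (n * n) Hr).
    replace (C * r ^ n * (2 * r ^ (2 * (s * s)))) with (r ^ n * (2 * (C * r ^ (2 * (s * s))))) by ring.
    apply Rmult_le_compat; [nra|nra|nra|].
    apply Rmult_le_compat; lra.
  - apply ex_series_scal_R, ex_series_pow; lra.
  - apply ex_series_scal_R, ex_series_pow_le; [assumption|intros; nia].
  - rewrite <- Series_scal_l; apply Series_ext; intros s.
    (* Terms with n < s vanish, so the inner sum runs over n = s + m. *)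
    rewrite (Series_incr_n_aux _ s).
    2:{ intros k Hk; unfold bailey; rewrite iqev_neg by lia; ring. }
    pose proof (heine_value r K P Hr HP HK HPl s s) as HV.
    pose proof (qodd_bounds r 0 s Hr).
    assert (HV' : heine r s s = K / P).
    { apply (Rmult_eq_reg_l (qodd r 0 s)); [|lra]; rewrite HV; unfold Rdiv; ring. }
    rewrite <- HV'; unfold heine.
    rewrite Rmult_comm, <- Series_scal_l; apply Series_ext; intros m; unfold bailey.
    replace (Z.of_nat (s + m) - Z.of_nat s)%Z with (Z.of_nat m) by lia.
    replace (Z.of_nat (s + m) + Z.of_nat s)%Z with (Z.of_nat (s + s + m)) by lia.
    rewrite !iqev_nat.
    pose proof (qev_pos r m Hr); pose proof (qev_pos r (s + s + m) Hr).
    assert (Hsg : (-1) ^ (s + m) * (-1) ^ s = (-1) ^ m).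
    { rewrite <- pow_add; replace (s + m + s)%nat with (2 * s + m)%nat by lia.
      rewrite pow_add, pow_m1_even; ring. }
    rewrite <- Hsg.
    pw1 ((s + m) * (s + m))%nat (s * s + s * m + s * m + m * m)%nat.
    pw1 (3 * (s * s))%nat (s * s + 2 * (s * s))%nat.
    pw1 (2 * s * m)%nat (s * m + s * m)%nat.
    rewrite !(pow_add r); field; lra.
Qed.

(** Same argument with the shifted pair and [heine r s (S s)], whose value absorbs the factor 1 -
    q^(2s+1) of 1 - q^(2(2s+1)) and leaves 1 + q^(2s+1). *)
Lemma cf_sum_1_value (r E K P : R) : 0 < r < 1 -> 0 < P ->
  is_lim_seq (qodd r 0) K -> is_lim_seq (qev r) P ->
  cf_sum r E 1 = E * (K / P) * Series (fun s => r ^ (3 * (s * s) + 2 * s) * (1 + r ^ (2 * s + 1))).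
Proof.
  intros Hr HP HK HPl; unfold cf_sum; simpl Nat.div2.
  destruct (iqev_bound r Hr) as (C & HC & HB).
  transitivity (E * Series (fun n => Series (fun s =>
     (-1) ^ n * r ^ (n * n) * qodd r 0 n * r ^ (2 * n) *
     ((-1) ^ s * r ^ (2 * (s * s)) * (1 - r ^ (2 * (2 * s + 1))) *
    iqev r (Z.of_nat n - Z.of_nat s) * iqev r (Z.of_nat n + Z.of_nat s + 1))))).
  { rewrite <- Series_scal_l; apply Series_ext; intros n.
    rewrite cf_coef_0, Series_scal_l, bailey_sum_shifted by assumption.
    pw1 (2 * 1 * n)%nat (2 * n)%nat; ring. }
  rewrite Rmult_assoc; f_equal.
  destruct (series_swap (fun n s => (-1) ^ n * r ^ (n * n) * qodd r 0 n * r ^ (2 * n) *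
     ((-1) ^ s * r ^ (2 * (s * s)) * (1 - r ^ (2 * (2 * s + 1))) *
    iqev r (Z.of_nat n - Z.of_nat s) * iqev r (Z.of_nat n + Z.of_nat s + 1)))
    (fun n => (C * C) * r ^ n) (fun s => r ^ (2 * (s * s)))) as [-> _].
  - intros n s; rewrite !Rabs_mult, !pow_m1_abs, !(Rabs_right (r ^ _)) by (apply Rle_ge, pow_le; lra).
    pose proof (qodd_bounds r 0 n Hr).
    assert (0 < 1 - r ^ (2 * (2 * s + 1)) <= 1).
    { pose proof (one_minus_pow_pos r (2 * s) Hr); pose proof (pow_bounds r (2 * (2 * s + 1)) Hr); lra. }
    pose proof (HB (Z.of_nat n - Z.of_nat s)%Z); pose proof (HB (Z.of_nat n + Z.of_nat s + 1)%Z).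
    rewrite !Rabs_right by lra.
    assert (r ^ (n * n) <= r ^ n) by (apply pow_le_pow; [lra|nia]).
    pose proof (pow_bounds r (n * n) Hr); pose proof (pow_bounds r (2 * n) Hr).
    pose proof (pow_bounds r (2 * (s * s)) Hr).
    set (a := iqev r _) in *; set (b := iqev r (_ + 1)) in *.
    set (d := 1 - r ^ (2 * (2 * s + 1))) in *; set (p := r ^ (2 * (s * s))) in *.
    replace (C * C * r ^ n * p) with (r ^ n * (p * (C * C))) by ring.
    replace (1 * r ^ (n * n) * qodd r 0 n * r ^ (2 * n) * (1 * p * d * a * b))
      with ((r ^ (n * n) * (qodd r 0 n * r ^ (2 * n))) * (p * ((d * a) * b))) by ring.
    assert (0 <= qodd r 0 n * r ^ (2 * n) <= 1) by nra.
    assert (0 <= d * a <= C) by nra.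
    assert (0 <= d * a * b <= C * C) by (split; [nra|apply Rmult_le_compat; lra]).
    apply Rmult_le_compat; [nra|nra|nra|].
    apply Rmult_le_compat; lra.
  - apply ex_series_scal_R, ex_series_pow; lra.
  - apply ex_series_pow_le; [assumption|intros; nia].
  - rewrite <- Series_scal_l; apply Series_ext; intros s.
    rewrite (Series_incr_n_aux _ s).
    2:{ intros k Hk; rewrite iqev_neg by lia; ring. }
    pose proof (heine_value r K P Hr HP HK HPl s (S s)) as HV.
    pose proof (qodd_bounds r 0 s Hr); rewrite qodd_S in HV.
    assert (0 < 1 - r ^ (2 * s + 1)).
    { replace (2 * s + 1)%nat with (S (2 * s)) by lia; pose proof (pow_S_bounds r (2 * s) Hr); lra. }
    assert (HV' : (1 - r ^ (2 * s + 1)) * heine r s (S s) = K / P).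
    { apply (Rmult_eq_reg_l (qodd r 0 s)); [|lra]; rewrite <- Rmult_assoc.
      simpl in HV |- *; rewrite HV; unfold Rdiv; ring. }
    rewrite <- HV'; unfold heine.
    rewrite <- !Series_scal_l, <- Series_scal_r; apply Series_ext; intros m.
    replace (Z.of_nat (s + m) - Z.of_nat s)%Z with (Z.of_nat m) by lia.
    replace (Z.of_nat (s + m) + Z.of_nat s + 1)%Z with (Z.of_nat (s + S s + m)) by lia.
    rewrite !iqev_nat.
    pose proof (qev_pos r m Hr); pose proof (qev_pos r (s + S s + m) Hr).
    assert (Hsg : (-1) ^ (s + m) * (-1) ^ s = (-1) ^ m).
    { rewrite <- pow_add; replace (s + m + s)%nat with (2 * s + m)%nat by lia.
      rewrite pow_add, pow_m1_even; ring. }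
    rewrite <- Hsg.
    pw1 ((s + m) * (s + m))%nat (s * s + s * m + s * m + m * m)%nat.
    pw1 (3 * (s * s) + 2 * s)%nat (s * s + 2 * (s * s) + s + s)%nat.
    pw1 (2 * S s * m)%nat (s * m + s * m + m + m)%nat.
    pw1 (2 * (2 * s + 1))%nat (s + s + s + s + 2)%nat.
    pw1 (2 * s + 1)%nat (s + s + 1)%nat.
    pw1 (2 * (s + m))%nat (s + s + m + m)%nat.
    rewrite !(pow_add r); field; lra.
Qed.

(** The constant E K / P, common to F(1) and F(2), cancels in the quotient. *)
Lemma cf_tail_lim r : 0 < r < 1 ->
  is_lim_seq (cf_tail (- r) 1)
    (Series (fun s => two_sided s * r ^ (3 * (s * s))) /
     Series (fun s => r ^ (3 * (s * s) + 2 * s) * (1 + r ^ (2 * s + 1)))).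
Proof.
  intros Hr.
  destruct (qodd_cvg r 0 Hr) as (K & HK & HKl & _).
  destruct (qev_cvg r Hr) as (P & HP & HPl & _).
  destruct (qevp_cvg r Hr) as (E & HEl & HE); specialize (HE 0%nat).
  destruct (cf_tail_cvg r (cf_sum r E) Hr) as (F0 & F1 & L).
  - intros k; apply cf_sum_rec; lra.
  - apply cf_sum_lim; [assumption|lra|assumption].
  - rewrite (cf_sum_0_value r E K P), (cf_sum_1_value r E K P) in L by assumption.
    rewrite (cf_sum_1_value r E K P) in F1 by assumption.
    match type of L with is_lim_seq _ (Finite ?a) => match goal with |- is_lim_seq _ (Finite ?b) =>
      replace b with a; [exact L|] end end.
    field; repeat split; try lra; intros Z; rewrite Z in F1; lra.
Qed.

(** * The theta transformation *)

(** The lazy walk with steps 0, 1, -1 of probability 1/2, 1/4, 1/4, that is binomial(2m, m + j) /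
    4^m. *)
Fixpoint walk (m : nat) (j : Z) : R :=
  match m with
  | O => if Z.eq_dec j 0 then 1 else 0
  | S m => walk m j / 2 + (walk m (j - 1) + walk m (j + 1)) / 4
  end.

(** Ratio of neighbouring binomial coefficients, cleared of denominators so as to hold for every
    integer j, also outside the support. *)
Lemma walk_ratio m j :
  (INR m + 1 + IZR j) * walk m (j + 1) = (INR m - IZR j) * walk m j.
Proof.
  revert j; induction m as [|m IH]; intros j.
  - simpl; destruct (Z.eq_dec j 0) as [Hj|Hj]; destruct (Z.eq_dec (j + 1) 0) as [Hj'|Hj'];
      try lia; try lra.
    + subst j; lra.
    + replace j with (-1)%Z by lia; lra.
  - rewrite S_INR; cbn [walk].
    pose proof (IH j) as H0; pose proof (IH (j + 1)%Z) as H1; pose proof (IH (j - 1)%Z) as H2.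
    replace (j - 1 + 1)%Z with j in H2 by lia; replace (j + 1 - 1)%Z with j by lia.
    rewrite plus_IZR in H1; rewrite minus_IZR in H2.
    set (a := walk m (j - 1)) in *; set (b := walk m j) in *.
    set (c := walk m (j + 1)) in *; set (d := walk m (j + 1 + 1)) in *.
    lra.
Qed.

Lemma walk_opp m j : walk m (- j) = walk m j.
Proof.
  revert j; induction m as [|m IH]; intros j; cbn [walk].
  - destruct (Z.eq_dec (- j) 0), (Z.eq_dec j 0); lia || reflexivity.
  - replace (- j - 1)%Z with (- (j + 1))%Z by lia; replace (- j + 1)%Z with (- (j - 1))%Z by lia.
    rewrite !IH; lra.
Qed.

Lemma walk_0 m j : (Z.of_nat m < Z.abs j)%Z -> walk m j = 0.
Proof.
  revert j; induction m as [|m IH]; intros j H; cbn [walk].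
  - destruct (Z.eq_dec j 0); [lia|reflexivity].
  - rewrite !IH by lia; lra.
Qed.

(** Weight at j relative to the centre, binomial(2m, m + j) / binomial(2m, m); the factor i = m
    makes it vanish for j > m. *)
Definition walk_weight (m j : nat) : R :=
  prodn (fun i => (INR m - INR i) / (INR m + INR i + 1)) j.

Lemma walk_weight_eq m j : walk m (Z.of_nat j) = walk m 0 * walk_weight m j.
Proof.
  induction j as [|j IH]; unfold walk_weight; cbn [prodn]; [simpl (Z.of_nat 0); ring|].
  fold (walk_weight m j); replace (Z.of_nat (S j)) with (Z.of_nat j + 1)%Z by lia.
  pose proof (walk_ratio m (Z.of_nat j)) as H; rewrite <- INR_IZR_INZ, IH in H.
  pose proof (pos_INR m); pose proof (pos_INR j).
  apply (Rmult_eq_reg_l (INR m + 1 + INR j)); [|lra].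
  rewrite H; field; lra.
Qed.

Lemma fsum_single (f : Z -> R) c l :
  NoDup l -> In c l -> (forall z, z <> c -> f z = 0) -> fsum f l = f c.
Proof.
  intros Hn Hc Hf; induction Hn as [|a l Ha Hn IH]; simpl in *; [easy|].
  destruct Hc as [->|Hc].
  - enough (fsum f l = 0) by lra.
    clear IH Hn; induction l as [|b l IH]; simpl in *; [reflexivity|].
    rewrite Hf by (intros ->; tauto); rewrite IH by tauto; ring.
  - rewrite IH by assumption; rewrite Hf by (intros ->; contradiction); ring.
Qed.

Lemma zseries_single (f : Z -> R) c :
  (forall z, z <> c -> f z = 0) -> zseries f (f c).
Proof.
  intros Hf; change (is_lim_seq (sum_n (zpair f)) (f c)).
  apply (is_lim_seq_ext_loc (fun _ => f c)); [|apply is_lim_seq_const].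
  exists (Z.abs_nat c); intros n Hn; rewrite <- fsum_zrange; symmetry.
  apply fsum_single; [apply NoDup_zrange|apply in_zrange; lia|assumption].
Qed.

Lemma ex_series_eventually_0 (a : nat -> R) N :
  (forall n, (N <= n)%nat -> a n = 0) -> ex_series a.
Proof.
  intros H; apply (ex_series_incr_n _ N), (ex_series_ext (fun _ => 0)).
  - intros n; symmetry; apply H; lia.
  - exists 0; apply (telescoping_series _ (fun _ => 0)); [intros; ring|apply is_lim_seq_const].
Qed.

(* The walk periodised modulo l; [cos_sum] is its expansion in the characters of Z/l, for odd l. *)
Definition pwalk (l m : nat) (x : Z) : R :=
  Series (zpair (fun k => walk m (x + k * Z.of_nat l))).

Lemma ex_series_pwalk l m x : (0 < l)%nat ->
  ex_series (zpair (fun k => walk m (x + k * Z.of_nat l))).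
Proof.
  intros Hl; apply (ex_series_eventually_0 _ (S (m + Z.abs_nat x))); intros [|n] Hn; [lia|].
  cbn [zpair]; rewrite !walk_0 by nia; ring.
Qed.

Lemma pwalk_rec l m x : (0 < l)%nat ->
  pwalk l (S m) x = pwalk l m x / 2 + (pwalk l m (x - 1) + pwalk l m (x + 1)) / 4.
Proof.
  intros Hl; unfold pwalk.
  pose proof (ex_series_pwalk l m x Hl) as E0.
  pose proof (ex_series_pwalk l m (x - 1) Hl) as E1.
  pose proof (ex_series_pwalk l m (x + 1) Hl) as E2.
  unfold Rdiv; rewrite <- Series_plus, <- !Series_scal_r, <- Series_plus by
    (assumption || apply ex_series_scal_r; try apply ex_series_plus_R; assumption).
  apply Series_ext; intros [|n]; cbn [zpair walk].
  - replace (x + 0 * Z.of_nat l - 1)%Z with (x - 1 + 0 * Z.of_nat l)%Z by lia.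
    replace (x + 0 * Z.of_nat l + 1)%Z with (x + 1 + 0 * Z.of_nat l)%Z by lia.
    field.
  - replace (x + Z.of_nat (S n) * Z.of_nat l - 1)%Z
      with (x - 1 + Z.of_nat (S n) * Z.of_nat l)%Z by lia.
    replace (x + Z.of_nat (S n) * Z.of_nat l + 1)%Z
      with (x + 1 + Z.of_nat (S n) * Z.of_nat l)%Z by lia.
    replace (x + - Z.of_nat (S n) * Z.of_nat l - 1)%Z
      with (x - 1 + - Z.of_nat (S n) * Z.of_nat l)%Z by lia.
    replace (x + - Z.of_nat (S n) * Z.of_nat l + 1)%Z
      with (x + 1 + - Z.of_nat (S n) * Z.of_nat l)%Z by lia.
    field.
Qed.

Lemma dirichlet_kernel h a :
  sin (a / 2) * sum_n (fun v => two_sided v * cos (INR v * a)) h = sin ((INR h + 1 / 2) * a).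
Proof.
  induction h as [|h IH].
  - rewrite sum_O; simpl; rewrite Rmult_0_l, cos_0.
    replace ((0 + 1 / 2) * a) with (a / 2) by field; ring.
  - rewrite sum_Sn; unfold plus; simpl AbelianMonoid.plus.
    change (sin (a / 2) * (sum_n (fun v => two_sided v * cos (INR v * a)) h
      + 2 * cos (INR (S h) * a)) = sin ((INR (S h) + 1 / 2) * a)).
    rewrite Rmult_plus_distr_l, IH, S_INR.
    replace ((INR h + 1 / 2) * a) with ((INR h + 1) * a - a / 2) by field.
    replace ((INR h + 1 + 1 / 2) * a) with ((INR h + 1) * a + a / 2) by field.
    rewrite sin_minus, sin_plus; ring.
Qed.

Lemma sum_n_walk (f g k : nat -> R) n :
  sum_n (fun v => f v / 2 + (g v + k v) / 4) n
  = sum_n f n / 2 + (sum_n g n + sum_n k n) / 4.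
Proof.
  induction n as [|n IH]; [now rewrite !sum_O|].
  rewrite !sum_Sn, IH; unfold plus; simpl; field.
Qed.

Definition cos_sum (h m : nat) (x : Z) : R :=
  sum_n (fun v => two_sided v * cos (PI * INR v / INR (2 * h + 1)) ^ (2 * m) *
     cos (2 * PI * INR v * IZR x / INR (2 * h + 1))) h.

(** One step of the walk multiplies a character by (1 + cos 2b) / 2 = cos^2 b. *)
Lemma cos_sum_rec h m x :
  cos_sum h (S m) x = cos_sum h m x / 2 + (cos_sum h m (x - 1) + cos_sum h m (x + 1)) / 4.
Proof.
  assert (HL : 0 < INR (2 * h + 1)) by (apply lt_0_INR; lia).
  assert (Hv : forall v, two_sided v * cos (PI * INR v / INR (2 * h + 1)) ^ (2 * S m) *
     cos (2 * PI * INR v * IZR x / INR (2 * h + 1)) =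
     (two_sided v * cos (PI * INR v / INR (2 * h + 1)) ^ (2 * m) *
     cos (2 * PI * INR v * IZR x / INR (2 * h + 1))) / 2 +
     ((two_sided v * cos (PI * INR v / INR (2 * h + 1)) ^ (2 * m) *
     cos (2 * PI * INR v * IZR (x - 1) / INR (2 * h + 1))) +
     (two_sided v * cos (PI * INR v / INR (2 * h + 1)) ^ (2 * m) *
     cos (2 * PI * INR v * IZR (x + 1) / INR (2 * h + 1)))) / 4).
  { intros v; rewrite minus_IZR, plus_IZR.
    replace (2 * S m)%nat with (2 * m + 2)%nat by lia; rewrite pow_add.
    set (b := PI * INR v / INR (2 * h + 1)).
    set (a := 2 * PI * INR v * IZR x / INR (2 * h + 1)).
    replace (2 * PI * INR v * (IZR x - 1) / INR (2 * h + 1)) with (a - 2 * b)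
      by (unfold a, b; field; lra).
    replace (2 * PI * INR v * (IZR x + 1) / INR (2 * h + 1)) with (a + 2 * b)
      by (unfold a, b; field; lra).
    rewrite cos_minus, cos_plus, cos_2a_cos; simpl; field. }
  unfold cos_sum; rewrite (sum_n_ext _ _ _ Hv); apply sum_n_walk.
Qed.

(** Orthogonality of characters: if the period divides x every cosine is 1; otherwise the Dirichlet
    kernel has numerator sin (pi x) = 0 and denominator sin (a / 2) different from 0. *)
Lemma cos_sum_0 h x : cos_sum h 0 x = INR (2 * h + 1) * pwalk (2 * h + 1) 0 x.
Proof.
  assert (HL : 0 < INR (2 * h + 1)) by (apply lt_0_INR; lia).
  set (L := INR (2 * h + 1)) in *.
  assert (HLh : L = 2 * INR h + 1) by (unfold L; rewrite plus_INR, mult_INR; simpl; ring).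
  pose (a := 2 * PI * IZR x / L).
  assert (E : cos_sum h 0 x = sum_n (fun v => two_sided v * cos (INR v * a)) h).
  { unfold cos_sum; apply sum_n_ext; intros v; fold L; rewrite pow_O, Rmult_1_r.
    do 2 f_equal; unfold a; field; lra. }
  rewrite E; clear E.
  destruct (excluded_middle_informative (exists c, x = c * Z.of_nat (2 * h + 1))%Z) as [[c Hc]|Hc].
  - assert (Ha : forall v, cos (INR v * a) = 1).
    { intros v; replace (INR v * a) with (2 * (IZR (Z.of_nat v * c) * PI)).
      - rewrite cos_2a_sin, sin_eq_0_1 by now exists (Z.of_nat v * c)%Z.
        ring.
      - unfold a; rewrite Hc, !mult_IZR, <- !INR_IZR_INZ; fold L; field; lra. }
    unfold pwalk; rewrite (is_series_unique _ _ (zseries_single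
      (fun k => walk 0 (x + k * Z.of_nat (2 * h + 1))) (- c)
      ltac:(intros z Hz; cbn [walk]; destruct (Z.eq_dec _ 0); [nia|reflexivity]))).
    cbn [walk]; destruct (Z.eq_dec _ 0) as [_|N]; [|lia].
    rewrite Rmult_1_r, HLh; clearbody a; clear - Ha.
    induction h as [|h IH]; [rewrite sum_O, Ha; simpl; ring|].
    rewrite sum_Sn, IH, Ha, S_INR; unfold plus; simpl; ring.
  - unfold pwalk; rewrite (Series_ext _ (fun _ => 0 * 0)).
    2:{ intros [|n]; cbn [zpair walk]; repeat match goal with |- context [Z.eq_dec ?u 0] =>
          destruct (Z.eq_dec u 0); [exfalso; apply Hc|] end; try ring.
        - now exists 0%Z; lia.
        - exists (- Z.of_nat (S n))%Z; lia.
        - exists (Z.of_nat (S n))%Z; lia. }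
    rewrite Series_scal_l, Rmult_0_l, Rmult_0_r.
    apply (Rmult_eq_reg_l (sin (a / 2))).
    + rewrite dirichlet_kernel, Rmult_0_r.
      replace ((INR h + 1 / 2) * a) with (IZR x * PI) by (unfold a; rewrite HLh; field; lra).
      apply sin_eq_0_1; now exists x.
    + intros Hs; apply sin_eq_0_0 in Hs; destruct Hs as [k Hk]; apply Hc; exists k.
      apply eq_IZR; rewrite mult_IZR, <- INR_IZR_INZ; fold L.
      pose proof PI_RGT_0; apply (Rmult_eq_reg_r PI); [|lra].
      replace (IZR k * L * PI) with (IZR k * PI * L) by ring; rewrite <- Hk; unfold a; field; lra.
Qed.

Lemma cos_sum_pwalk h m x : cos_sum h m x = INR (2 * h + 1) * pwalk (2 * h + 1) m x.
Proof.
  revert x; induction m as [|m IH]; intros x; [apply cos_sum_0|].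
  rewrite cos_sum_rec, pwalk_rec, !IH by lia; field.
Qed.

Lemma polya_identity h m :
  sum_n (fun v => two_sided v * cos (PI * INR v / INR (2 * h + 1)) ^ (2 * m)) h =
  INR (2 * h + 1) * walk m 0 *
    Series (fun k => two_sided k * walk_weight m (k * (2 * h + 1))).
Proof.
  transitivity (cos_sum h m 0).
  - unfold cos_sum; apply sum_n_ext; intros v.
    replace (2 * PI * INR v * 0 / INR (2 * h + 1)) with 0 by (unfold Rdiv; ring).
    rewrite cos_0, Rmult_1_r; reflexivity.
  - rewrite cos_sum_pwalk, Rmult_assoc; f_equal.
    rewrite <- Series_scal_l; unfold pwalk; apply Series_ext; intros k.
    assert (E : forall k, walk m (0 + Z.of_nat k * Z.of_nat (2 * h + 1))
       = walk m 0 * walk_weight m (k * (2 * h + 1))).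
    { intros i; rewrite <- walk_weight_eq; f_equal; lia. }
    destruct k as [|k]; cbn [zpair two_sided].
    + pose proof (E 0%nat) as E0; cbn [Z.of_nat] in E0; rewrite E0; ring.
    + rewrite E; replace (0 + - Z.of_nat (S k) * Z.of_nat (2 * h + 1))%Z
        with (- (0 + Z.of_nat (S k) * Z.of_nat (2 * h + 1)))%Z by lia.
      rewrite walk_opp, E; ring.
Qed.

(** * Gaussian limits of the two expansions *)

Lemma sum_Sn_R (a : nat -> R) n : sum_n a (S n) = sum_n a n + a (S n).
Proof. rewrite sum_Sn; reflexivity. Qed.

Lemma exp_pow x n : exp x ^ n = exp (INR n * x).
Proof.
  induction n as [|n IH]; [simpl; now rewrite Rmult_0_l, exp_0|].
  rewrite S_INR; simpl; rewrite IH, <- exp_plus; f_equal; ring.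
Qed.

Lemma exp_le x y : x <= y -> exp x <= exp y.
Proof. intros [H| ->]; [left; now apply exp_increasing|now right]. Qed.

Lemma exp_neg_bounds c : 0 < c -> 0 < exp (- c) < 1.
Proof.
  intros Hc; split; [apply exp_pos|]; rewrite <- exp_0; apply exp_increasing; lra.
Qed.

Lemma INR_sq_ge n : INR n <= INR n ^ 2.
Proof.
  destruct n as [|n]; [simpl; lra|].
  assert (1 <= INR (S n)) by (rewrite S_INR; pose proof (pos_INR n); lra); nra.
Qed.

Lemma two_sided_bounds n : 0 < two_sided n <= 2.
Proof. destruct n; simpl; lra. Qed.

Lemma ex_series_gauss c : 0 < c -> ex_series (fun n => two_sided n * exp (- (c * INR n ^ 2))).
Proof.
  intros Hc; apply (ex_series_dominated _ (fun n => 2 * exp (- c) ^ n)).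
  - intros n; pose proof (two_sided_bounds n).
    rewrite Rabs_right by (apply Rle_ge, Rmult_le_pos; [lra|left; apply exp_pos]).
    apply Rmult_le_compat; [lra|left; apply exp_pos|lra|].
    rewrite exp_pow; apply exp_le; pose proof (INR_sq_ge n); nra.
  - apply ex_series_scal_R, ex_series_pow; pose proof (exp_neg_bounds c Hc); lra.
Qed.

Definition theta (y : R) : R := Series (fun n => two_sided n * exp (- (y * INR n ^ 2))).

Lemma Series_ge_0 (a : nat -> R) : (forall n, 0 <= a n) -> ex_series a -> 0 <= Series a.
Proof.
  intros Ha Hs; apply (is_lim_seq_le (fun _ => 0) (sum_n a) 0 (Series a));
    [|apply is_lim_seq_const|apply Series_correct, Hs].
  intros n; induction n as [|n IH]; [rewrite sum_O; apply Ha|].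
  rewrite sum_Sn; unfold plus; simpl; specialize (Ha (S n)); lra.
Qed.

Lemma theta_ge_1 y : 0 < y -> 1 <= theta y.
Proof.
  intros Hy; unfold theta; pose proof (ex_series_gauss y Hy) as E.
  rewrite Series_incr_1 by exact E.
  replace (exp (- (y * INR 0 ^ 2))) with 1 by (rewrite <- exp_0; f_equal; simpl; ring).
  enough (0 <= Series (fun k => two_sided (S k) * exp (- (y * INR (S k) ^ 2)))) by (simpl two_sided at 1; lra).
  apply Series_ge_0; [|now apply ex_series_incr_1 in E].
  intros n; apply Rmult_le_pos; [simpl; lra|left; apply exp_pos].
Qed.

(** Writes a finite sum of varying length as a series, the form to which [tannery] applies. *)
Lemma series_trunc (f : nat -> R) h :
  Series (fun v => if le_dec v h then f v else 0) = sum_n f h.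
Proof.
  assert (E : ex_series (fun v => if le_dec v h then f v else 0)).
  { apply (ex_series_eventually_0 _ (S h)); intros n Hn; destruct (le_dec n h); [lia|reflexivity]. }
  apply is_series_unique; change (is_lim_seq (sum_n (fun v => if le_dec v h then f v else 0)) (sum_n f h)).
  apply (is_lim_seq_ext_loc (fun _ => sum_n f h)); [|apply is_lim_seq_const].
  exists h; intros n Hn; induction Hn as [|n Hn IH].
  - apply sum_n_ext_loc; intros n Hn; destruct (le_dec n h); [reflexivity|lia].
  - rewrite sum_Sn_R, <- IH; destruct (le_dec (S n) h); [lia|lra].
Qed.

(** Each factor is 1 - (2i + 1) / (m + i + 1) <= exp (- (2i + 1) / (m + j)), and the first j odd
    numbers sum to j^2. *)
Lemma walk_weight_upper m j : (j <= m)%nat ->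
  0 <= walk_weight m j <= exp (- (INR j ^ 2 / (INR m + INR j))).
Proof.
  intros Hj; destruct (Nat.eq_dec m 0) as [->|Hm].
  { replace j with 0%nat by lia; unfold walk_weight; simpl; replace (- _) with 0 by (unfold Rdiv; ring).
    rewrite exp_0; lra. }
  assert (Hm' : 0 < INR m) by (apply lt_0_INR; lia); pose proof (pos_INR j) as Hj0.
  assert (G : forall k, (k <= j)%nat ->
    0 <= walk_weight m k <= exp (- (INR k ^ 2 / (INR m + INR j)))).
  { induction k as [|k IH]; intros Hk; unfold walk_weight; cbn [prodn].
    - simpl INR; replace (- _) with 0 by (unfold Rdiv; ring); rewrite exp_0; lra.
    - fold (walk_weight m k); destruct IH as [IH1 IH2]; [lia|].
      assert (Hk1 : INR k + 1 <= INR j) by (rewrite <- S_INR; apply le_INR; lia).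
      assert (Hjm : INR j <= INR m) by (apply le_INR; lia).
      pose proof (pos_INR k).
      assert (Hf : 0 <= (INR m - INR k) / (INR m + INR k + 1)
         <= exp (- ((2 * INR k + 1) / (INR m + INR j)))).
      { split; [apply Rmult_le_pos; [lra|left; apply Rinv_0_lt_compat; lra]|].
        apply Rle_trans with (1 + - ((2 * INR k + 1) / (INR m + INR j))); [|apply exp_ineq1_le].
        replace ((INR m - INR k) / (INR m + INR k + 1))
          with (1 + - ((2 * INR k + 1) * / (INR m + INR k + 1))) by (field; lra).
        apply Rplus_le_compat_l, Ropp_le_contravar, Rmult_le_compat_l; [lra|].
        apply Rinv_le_contravar; lra. }
      split; [now apply Rmult_le_pos|].
      replace (exp (- (INR (S k) ^ 2 / (INR m + INR j)))) with
        (exp (- (INR k ^ 2 / (INR m + INR j))) * exp (- ((2 * INR k + 1) / (INR m + INR j)))).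
      + apply Rmult_le_compat; lra.
      + rewrite <- exp_plus, S_INR; f_equal; field; lra. }
  now apply G.
Qed.

(** Each factor is the reciprocal of 1 + (2i + 1) / (m - i), and m - i >= m - j + 1. *)
Lemma walk_weight_lower m j : (j <= m)%nat ->
  exp (- (INR j ^ 2 / (INR m - INR j + 1))) <= walk_weight m j.
Proof.
  intros Hj; assert (Hjm : INR j <= INR m) by (apply le_INR; lia).
  assert (G : forall k, (k <= j)%nat ->
    exp (- (INR k ^ 2 / (INR m - INR j + 1))) <= walk_weight m k).
  { induction k as [|k IH]; intros Hk; unfold walk_weight; cbn [prodn].
    - simpl INR; replace (- _) with 0 by (unfold Rdiv; ring); rewrite exp_0; lra.
    - fold (walk_weight m k); specialize (IH ltac:(lia)).
      assert (Hk1 : INR k + 1 <= INR j) by (rewrite <- S_INR; apply le_INR; lia).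
      pose proof (pos_INR k).
      assert (Hf : exp (- ((2 * INR k + 1) / (INR m - INR j + 1)))
         <= (INR m - INR k) / (INR m + INR k + 1)).
      { replace ((INR m - INR k) / (INR m + INR k + 1))
          with (/ (1 + (2 * INR k + 1) * / (INR m - INR k))) by (field; lra).
        rewrite exp_Ropp; apply Rinv_le_contravar.
        - assert (0 < (2 * INR k + 1) * / (INR m - INR k))
            by (apply Rmult_lt_0_compat; [lra|apply Rinv_0_lt_compat; lra]); lra.
        - eapply Rle_trans; [|apply exp_ineq1_le].
          apply Rplus_le_compat_l, Rmult_le_compat_l; [lra|].
          apply Rinv_le_contravar; lra. }
      replace (exp (- (INR (S k) ^ 2 / (INR m - INR j + 1)))) with
        (exp (- (INR k ^ 2 / (INR m - INR j + 1))) * exp (- ((2 * INR k + 1) / (INR m - INR j + 1)))).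
      + apply Rmult_le_compat; [left; apply exp_pos|left; apply exp_pos|assumption|assumption].
      + rewrite <- exp_plus, S_INR; f_equal; field; lra. }
  now apply G.
Qed.

Lemma walk_weight_gt m j : (m < j)%nat -> walk_weight m j = 0.
Proof.
  induction j as [|j IH]; [lia|]; intros H; unfold walk_weight; cbn [prodn].
  fold (walk_weight m j); destruct (Nat.eq_dec j m) as [->|N].
  - unfold Rdiv; ring.
  - rewrite IH by lia; ring.
Qed.

(** A majorant valid for all j, as domination requires. *)
Lemma walk_weight_gauss m j : (0 < m)%nat ->
  0 <= walk_weight m j <= exp (- (INR j ^ 2 / (2 * INR m))).
Proof.
  intros Hm; destruct (Nat.le_gt_cases j m) as [H|H].
  - destruct (walk_weight_upper m j H) as [H1 H2]; split; [assumption|].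
    eapply Rle_trans; [exact H2|]; apply exp_le, Ropp_le_contravar, Rmult_le_compat_l.
    + apply pow2_ge_0.
    + assert (0 < INR m) by (apply lt_0_INR; lia); pose proof (pos_INR j).
      assert (INR j <= INR m) by (apply le_INR; lia).
      apply Rinv_le_contravar; lra.
  - rewrite walk_weight_gt by assumption; split; [lra|left; apply exp_pos].
Qed.

Lemma exp_continuous_seq (u : nat -> R) (l : R) :
  is_lim_seq u l -> is_lim_seq (fun n => exp (- u n)) (exp (- l)).
Proof.
  intros H; apply (is_lim_seq_continuous exp (fun n => - u n) (- l)).
  - apply derivable_continuous_pt, derivable_pt_exp.
  - apply (is_lim_seq_opp u l), H.
Qed.

(** The scale 1 / sqrt m for a walk of m = n + 1 steps; the shift avoids m = 0. *)
Definition Msq (n : nat) : R := / sqrt (INR (S n)).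

Lemma Msq_pos n : 0 < Msq n.
Proof. apply Rinv_0_lt_compat, sqrt_lt_R0, lt_0_INR; lia. Qed.

Lemma Msq_sq n : INR (S n) * (Msq n * Msq n) = 1.
Proof.
  assert (0 < INR (S n)) by (apply lt_0_INR; lia).
  unfold Msq; rewrite <- Rinv_mult, sqrt_sqrt by lra; field; lra.
Qed.

Lemma Msq_le_1 n : Msq n <= 1.
Proof.
  pose proof (Msq_sq n); pose proof (Msq_pos n); rewrite S_INR in *; pose proof (pos_INR n).
  destruct (Rle_dec (Msq n) 1); [assumption|nra].
Qed.

Lemma is_lim_seq_Msq : is_lim_seq Msq 0.
Proof.
  apply (is_lim_seq_ext (fun n => sqrt (/ INR (S n)))).
  - intros n; unfold Msq; now rewrite sqrt_inv.
  - replace (Finite 0) with (Finite (sqrt 0)) by now rewrite sqrt_0.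
    apply (is_lim_seq_continuous sqrt); [apply continuity_pt_sqrt; lra|].
    apply (is_lim_seq_incr_1 (fun n => / INR n)).
    replace (Finite 0) with (Rbar_inv p_infty) by reflexivity.
    apply is_lim_seq_inv; [apply is_lim_seq_INR|easy].
Qed.

(** De Moivre-Laplace relative to the centre: at j = k l(n), about k s sqrt m, the upper and lower
    exponential bounds share their limit because [a n] = j / m tends to 0. *)
Lemma walk_weight_limit (l : nat -> nat) (s : R) k :
  is_lim_seq (fun n => INR (l n) * Msq n) s ->
  is_lim_seq (fun n => walk_weight (S n) (k * l n)) (exp (- (s ^ 2 * INR k ^ 2))).
Proof.
  intros HL; pose (a := fun n => INR k * (INR (l n) * Msq n) * Msq n).
  assert (Ha : is_lim_seq a 0).
  { replace (Finite 0) with (Finite (INR k * s * 0)) by (f_equal; ring).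
    apply is_lim_seq_mult'; [|apply is_lim_seq_Msq].
    apply is_lim_seq_mult'; [apply is_lim_seq_const|exact HL]. }
  assert (HaE : forall n, INR (k * l n) = INR (S n) * a n).
  { intros n; unfold a; rewrite mult_INR.
    replace (INR (S n) * (INR k * (INR (l n) * Msq n) * Msq n))
      with (INR k * INR (l n) * (INR (S n) * (Msq n * Msq n))) by ring.
    rewrite Msq_sq; ring. }
  assert (HN : is_lim_seq (fun n => INR k ^ 2 * (INR (l n) * Msq n) ^ 2) (s ^ 2 * INR k ^ 2)).
  { rewrite (Rmult_comm (s ^ 2)); apply is_lim_seq_mult'; [apply is_lim_seq_const|].
    replace (s ^ 2) with (s * (s * 1)) by ring.
    simpl; repeat apply is_lim_seq_mult'; try exact HL; apply is_lim_seq_const. }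
  assert (Hsq : forall n, INR (k * l n) ^ 2 = INR (S n) * (INR k ^ 2 * (INR (l n) * Msq n) ^ 2)).
  { intros n; rewrite mult_INR.
    replace (INR (S n) * (INR k ^ 2 * (INR (l n) * Msq n) ^ 2))
      with (INR k ^ 2 * INR (l n) ^ 2 * (INR (S n) * (Msq n * Msq n))) by ring.
    rewrite Msq_sq; ring. }
  assert (Hev : eventually (fun n => (k * l n <= S n)%nat)).
  { apply is_lim_seq_spec in Ha; destruct (Ha (mkposreal 1 Rlt_0_1)) as [N H]; exists N.
    intros n Hn; specialize (H n Hn); simpl in H; apply Rabs_def2 in H.
    apply INR_le; rewrite HaE; assert (0 < INR (S n)) by (apply lt_0_INR; lia); nra. }
  apply (is_lim_seq_le_le_loc
    (fun n => exp (- (INR k ^ 2 * (INR (l n) * Msq n) ^ 2 / (1 - a n + Msq n * Msq n)))) _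
    (fun n => exp (- (INR k ^ 2 * (INR (l n) * Msq n) ^ 2 / (1 + a n))))).
  - apply (filter_imp _ _) with (2 := Hev); intros n Hn.
    destruct (walk_weight_upper (S n) (k * l n) Hn) as [_ Hu].
    pose proof (walk_weight_lower (S n) (k * l n) Hn) as Hl.
    assert (HM : 0 < INR (S n)) by (apply lt_0_INR; lia).
    assert (Ha0 : 0 <= a n).
    { apply (Rmult_le_reg_l (INR (S n))); [assumption|]; rewrite <- HaE, Rmult_0_r; apply pos_INR. }
    assert (Ha1 : INR (S n) * a n <= INR (S n)) by (rewrite <- HaE; now apply le_INR).
    pose proof (Msq_pos n) as HMs; pose proof (Msq_sq n) as HMq.
    assert (Ha2 : a n <= 1) by nra.
    rewrite Hsq, HaE in Hu, Hl; split.
    + eapply Rle_trans; [right|exact Hl]; do 2 f_equal.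
      replace (INR (S n) - INR (S n) * a n + 1)
        with (INR (S n) * (1 - a n + Msq n * Msq n)) by lra.
      field; split; nra.
    + eapply Rle_trans; [exact Hu|right]; do 2 f_equal; field; split; nra.
  - apply exp_continuous_seq.
    replace (Finite (s ^ 2 * INR k ^ 2)) with (Finite (s ^ 2 * INR k ^ 2 / (1 - 0 + 0 * 0)))
      by (f_equal; field).
    apply is_lim_seq_div'; [exact HN| |lra].
    apply is_lim_seq_plus'; [apply is_lim_seq_minus'; [apply is_lim_seq_const|exact Ha]|].
    apply is_lim_seq_mult'; apply is_lim_seq_Msq.
  - apply exp_continuous_seq.
    replace (Finite (s ^ 2 * INR k ^ 2)) with (Finite (s ^ 2 * INR k ^ 2 / (1 + 0)))
      by (f_equal; field).
    apply is_lim_seq_div'; [exact HN| |lra].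
    apply is_lim_seq_plus'; [apply is_lim_seq_const|exact Ha].
Qed.

Lemma pow_exp_upper y m : 0 <= y <= 1 -> (1 - y) ^ m <= exp (- (INR m * y)).
Proof.
  intros Hy; replace (- (INR m * y)) with (INR m * - y) by ring; rewrite <- exp_pow.
  apply pow_incr; split; [lra|]; pose proof (exp_ineq1_le (- y)); lra.
Qed.

Lemma pow_exp_lower y m : 0 <= y < 1 -> exp (- (INR m * (y / (1 - y)))) <= (1 - y) ^ m.
Proof.
  intros Hy; replace (- (INR m * (y / (1 - y)))) with (INR m * - (y / (1 - y))) by ring.
  rewrite <- exp_pow; apply pow_incr; split; [left; apply exp_pos|].
  replace (1 - y) with (/ (1 + y / (1 - y))) at 2 by (field; lra).
  rewrite exp_Ropp; apply Rinv_le_contravar; [|apply exp_ineq1_le].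
  assert (0 <= y / (1 - y)) by (apply Rmult_le_pos; [lra|left; apply Rinv_0_lt_compat; lra]); lra.
Qed.

(** From x - x^3 / 6 and x^2 <= 4. The constant 1/3 is crude, but a linear lower bound is all the
    domination asks for. *)
Lemma sin_ge_third x : 0 <= x <= PI / 2 -> x / 3 <= sin x.
Proof.
  intros Hx; pose proof PI_4; pose proof PI_RGT_0.
  destruct (sin_bound x 0) as [Hb _]; [lra|lra|].
  unfold sin_approx, sin_term in Hb; simpl in Hb.
  assert (x * x <= 4) by nra.
  eapply Rle_trans; [|exact Hb].
  replace (1 * (x * 1 / 1) + -1 * 1 * (x * (x * (x * 1)) / (1 + 1 + 1 + 1 + 1 + 1)))
    with (x - x * (x * x) / 6) by field.
  nra.
Qed.

Lemma cos_pow_even x m : cos x ^ (2 * m) = (1 - sin x ^ 2) ^ m.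
Proof.
  rewrite pow_mult; f_equal; pose proof (sin2_cos2 x); unfold Rsqr in *; simpl; lra.
Qed.

(** With y = sin^2 and m = n + 1, cos^(2m) = (1 - y)^m lies between exp (- m y / (1 - y)) and exp (-
    m y), and m y converges by the limit of sin x / x. *)
Lemma cos_pow_limit (l : nat -> nat) (s : R) v : 0 < s ->
  (forall n, (0 < l n)%nat) ->
  is_lim_seq (fun n => INR (l n) * Msq n) s ->
  is_lim_seq (fun n => cos (PI * INR v / INR (l n)) ^ (2 * S n)) (exp (- (PI ^ 2 / s ^ 2 * INR v ^ 2))).
Proof.
  intros Hs Hl HL; destruct (Nat.eq_dec v 0) as [->|Hv].
  { apply (is_lim_seq_ext (fun _ => 1)).
    - intros n; simpl INR; replace (PI * 0 / INR (l n)) with 0 by (unfold Rdiv; ring).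
      now rewrite cos_0, pow1.
    - replace (exp _) with 1; [apply is_lim_seq_const|].
      rewrite <- exp_0; f_equal; simpl; ring. }
  assert (Hlp : forall n, 0 < INR (l n)) by (intros n; apply lt_0_INR, Hl).
  assert (HvR : 0 < INR v) by (apply lt_0_INR; lia).
  pose proof PI_RGT_0 as HPI.
  pose (x := fun n => PI * INR v / INR (l n)).
  assert (Hxe : forall n, x n = PI * INR v / (INR (l n) * Msq n) * Msq n).
  { intros n; unfold x; specialize (Hlp n); pose proof (Msq_pos n); field; lra. }
  assert (Hx : is_lim_seq x 0).
  { apply (is_lim_seq_ext _ _ _ (fun n => eq_sym (Hxe n))).
    replace (Finite 0) with (Finite (PI * INR v / s * 0)) by (f_equal; ring).
    apply is_lim_seq_mult'; [|apply is_lim_seq_Msq].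
    apply is_lim_seq_div'; [apply is_lim_seq_const|exact HL|lra]. }
  assert (Hsinc : is_lim_seq (fun n => sin (x n) / x n) 1).
  { apply (is_lim_comp_seq (fun x => sin x / x) x 0); [apply is_lim_sinc_0| |exact Hx].
    exists 0%nat; intros n _ E; injection E; unfold x; intros E'.
    assert (0 < PI * INR v / INR (l n)) by (apply Rdiv_lt_0_compat; [nra|apply Hlp]); lra. }
  assert (Hsin2 : is_lim_seq (fun n => INR (S n) * sin (x n) ^ 2) (PI ^ 2 / s ^ 2 * INR v ^ 2)).
  { apply (is_lim_seq_ext (fun n => (sin (x n) / x n) * (sin (x n) / x n) *
      ((PI * INR v) / (INR (l n) * Msq n) * ((PI * INR v) / (INR (l n) * Msq n))))).
    - intros n; pose proof (Msq_sq n) as HM; specialize (Hlp n); pose proof (Msq_pos n).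
      assert (HS : INR (S n) = / (Msq n * Msq n)).
      { apply (Rmult_eq_reg_r (Msq n * Msq n)); [|nra]; rewrite HM; field; lra. }
      rewrite HS; unfold x; field; repeat split; lra.
    - replace (PI ^ 2 / s ^ 2 * INR v ^ 2) with (1 * 1 * (PI * INR v / s * (PI * INR v / s))) by (field; lra).
      assert (Hd : is_lim_seq (fun n => PI * INR v / (INR (l n) * Msq n)) (PI * INR v / s))
        by (apply is_lim_seq_div'; [apply is_lim_seq_const|exact HL|lra]).
      apply is_lim_seq_mult'; apply is_lim_seq_mult'; assumption. }
  assert (Hcos : is_lim_seq (fun n => 1 - sin (x n) ^ 2) 1).
  { apply (is_lim_seq_ext (fun n => cos (x n) * cos (x n))).
    - intros n; pose proof (sin2_cos2 (x n)); unfold Rsqr in *; simpl; lra.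
    - replace 1 with (cos 0 * cos 0) by (rewrite cos_0; ring).
      assert (is_lim_seq (fun n => cos (x n)) (cos 0))
        by (apply (is_lim_seq_continuous cos); [apply continuity_cos|exact Hx]).
      now apply is_lim_seq_mult'. }
  assert (Hb : forall n, 0 <= sin (x n) ^ 2 <= 1).
  { intros n; pose proof (SIN_bound (x n)); simpl; nra. }
  assert (Hev : eventually (fun n => 0 < 1 - sin (x n) ^ 2)).
  { apply is_lim_seq_spec in Hcos; destruct (Hcos (mkposreal (1/2) ltac:(lra))) as [N H]; exists N.
    intros n Hn; specialize (H n Hn); cbn [pos] in H; apply Rabs_def2 in H; lra. }
  apply (is_lim_seq_le_le_loc
    (fun n => exp (- (INR (S n) * sin (x n) ^ 2 / (1 - sin (x n) ^ 2)))) _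
    (fun n => exp (- (INR (S n) * sin (x n) ^ 2)))).
  - apply (filter_imp _ _) with (2 := Hev); intros n Hn; fold (x n); rewrite cos_pow_even.
    specialize (Hb n); split.
    + eapply Rle_trans; [right|apply pow_exp_lower; lra]; do 2 f_equal; field; lra.
    + now apply pow_exp_upper.
  - apply exp_continuous_seq.
    replace (Finite (PI ^ 2 / s ^ 2 * INR v ^ 2)) with (Finite (PI ^ 2 / s ^ 2 * INR v ^ 2 / 1))
      by (f_equal; field; lra).
    apply is_lim_seq_div'; [exact Hsin2|exact Hcos|lra].
  - apply exp_continuous_seq, Hsin2.
Qed.

(** Chosen so that the odd period 2h + 1 stays within 1 of s sqrt m, where m = n + 1. *)
Definition polya_h (s : R) (n : nat) : nat :=
  Z.to_nat (Int_part (s * sqrt (INR (S n)) / 2)).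

Lemma polya_h_bounds s n : 0 < s ->
  let x := s * sqrt (INR (S n)) in
  x - 1 < INR (2 * polya_h s n + 1) <= x + 1.
Proof.
  intros Hs x; unfold polya_h; fold x.
  assert (Hx : 0 < x).
  { apply Rmult_lt_0_compat; [assumption|]; apply sqrt_lt_R0, lt_0_INR; lia. }
  destruct (base_Int_part (x / 2)) as [H1 H2].
  assert (H0 : (0 <= Int_part (x / 2))%Z).
  { apply Z.lt_succ_r, lt_IZR; rewrite succ_IZR; lra. }
  rewrite plus_INR, mult_INR, (INR_IZR_INZ (Z.to_nat _)), Z2Nat.id by assumption.
  simpl (INR 2); simpl (INR 1); lra.
Qed.

Lemma polya_h_scaled s n : 0 < s ->
  s - Msq n < INR (2 * polya_h s n + 1) * Msq n <= s + Msq n /\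
  s / 2 <= INR (2 * polya_h s n + 1) * Msq n.
Proof.
  intros Hs; pose proof (polya_h_bounds s n Hs) as H; cbv zeta in H.
  assert (HS : 0 < sqrt (INR (S n))) by (apply sqrt_lt_R0, lt_0_INR; lia).
  pose proof (Msq_pos n) as HM.
  assert (HE : sqrt (INR (S n)) * Msq n = 1) by (unfold Msq; field; lra).
  assert (H1 : 1 <= INR (2 * polya_h s n + 1)).
  { rewrite plus_INR; pose proof (pos_INR (2 * polya_h s n)); simpl (INR 1); lra. }
  set (L := INR (2 * polya_h s n + 1)) in *; set (r := sqrt (INR (S n))) in *.
  assert (Hx : s * r * Msq n = s) by (rewrite Rmult_assoc, HE; ring).
  (* From 1 <= L when s r <= 2 and from s r - 1 < L otherwise; thus the bound holds for every n, not
     only eventually. *)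
  assert (HLh : s * r / 2 <= L) by lra.
  repeat split.
  - replace (s - Msq n) with ((s * r - 1) * Msq n) by lra; apply Rmult_lt_compat_r; lra.
  - replace (s + Msq n) with ((s * r + 1) * Msq n) by lra; apply Rmult_le_compat_r; lra.
  - replace (s / 2) with (s * r / 2 * Msq n) by lra; apply Rmult_le_compat_r; lra.
Qed.

Lemma polya_h_lim s : 0 < s -> is_lim_seq (fun n => INR (2 * polya_h s n + 1) * Msq n) s.
Proof.
  intros Hs; apply (is_lim_seq_le_le (fun n => s - Msq n) _ (fun n => s + Msq n)).
  - intros n; pose proof (polya_h_scaled s n Hs); lra.
  - replace (Finite s) with (Finite (s - 0)) by (f_equal; ring).
    apply is_lim_seq_minus'; [apply is_lim_seq_const|apply is_lim_seq_Msq].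
  - replace (Finite s) with (Finite (s + 0)) by (f_equal; ring).
    apply is_lim_seq_plus'; [apply is_lim_seq_const|apply is_lim_seq_Msq].
Qed.

Lemma walk_series_limit s : 0 < s ->
  is_lim_seq (fun n => Series (fun k => two_sided k * walk_weight (S n) (k * (2 * polya_h s n + 1))))
    (theta (s ^ 2)).
Proof.
  intros Hs; unfold theta.
  (* The constant 1/8 is (1/2)^2 / 2: the scaled period is at least s / 2. *)
  apply (tannery (fun n k => two_sided k * walk_weight (S n) (k * (2 * polya_h s n + 1)))
    (fun k => two_sided k * exp (- (s ^ 2 / 8 * INR k ^ 2)))).
  - intros k; apply is_lim_seq_mult'; [apply is_lim_seq_const|].
    apply (walk_weight_limit (fun n => 2 * polya_h s n + 1)%nat), polya_h_lim, Hs.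
  - intros n k; destruct (walk_weight_gauss (S n) (k * (2 * polya_h s n + 1))) as [H1 H2]; [lia|].
    pose proof (two_sided_bounds k).
    rewrite Rabs_right by (apply Rle_ge, Rmult_le_pos; lra).
    apply Rmult_le_compat_l; [lra|]; eapply Rle_trans; [exact H2|].
    apply exp_le, Ropp_le_contravar; rewrite mult_INR.
    destruct (polya_h_scaled s n Hs) as [_ H3].
    set (L := INR (2 * polya_h s n + 1)) in *.
    pose proof (Msq_sq n) as HM; pose proof (Msq_pos n) as HMp.
    assert (HSp : 0 < INR (S n)) by (apply lt_0_INR; lia).
    replace ((INR k * L) ^ 2 / (2 * INR (S n))) with (INR k ^ 2 * ((L * Msq n) ^ 2 / 2)).
    + rewrite (Rmult_comm (s ^ 2 / 8)); apply Rmult_le_compat_l; [apply pow2_ge_0|]; nra.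
    + replace (INR (S n)) with (/ (Msq n * Msq n)); [field; lra|].
      apply (Rmult_eq_reg_r (Msq n * Msq n)); [|nra]; rewrite HM; field; lra.
  - apply ex_series_gauss; nra.
Qed.

Lemma cos_series_limit s : 0 < s ->
  is_lim_seq (fun n => sum_n (fun v => two_sided v *
      cos (PI * INR v / INR (2 * polya_h s n + 1)) ^ (2 * S n)) (polya_h s n))
    (theta (PI ^ 2 / s ^ 2)).
Proof.
  intros Hs; unfold theta; pose proof PI_RGT_0 as HPI.
  apply (is_lim_seq_ext (fun n => Series (fun v => if le_dec v (polya_h s n) then two_sided v *
      cos (PI * INR v / INR (2 * polya_h s n + 1)) ^ (2 * S n) else 0)));
    [intros n; apply series_trunc|].
  pose proof (polya_h_lim s Hs) as HL.
  (* The 9 comes from [sin_ge_third]; s + 1 bounds the scaled period since Msq n <= 1. *)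
  apply (tannery (fun n v => if le_dec v (polya_h s n) then two_sided v *
      cos (PI * INR v / INR (2 * polya_h s n + 1)) ^ (2 * S n) else 0)
    (fun v => two_sided v * exp (- ((PI ^ 2 / 9) / (s + 1) ^ 2 * INR v ^ 2)))).
  - intros v; apply (is_lim_seq_ext_loc (fun n => two_sided v *
      cos (PI * INR v / INR (2 * polya_h s n + 1)) ^ (2 * S n))).
    + assert (H : is_lim_seq (fun n => (2 * INR v + 1) * Msq n) 0).
      { replace (Finite 0) with (Finite ((2 * INR v + 1) * 0)) by (f_equal; ring).
        apply is_lim_seq_mult'; [apply is_lim_seq_const|apply is_lim_seq_Msq]. }
      apply is_lim_seq_spec in H; destruct (H (mkposreal (s / 2) ltac:(lra))) as [N HN].
      exists N; intros n Hn; specialize (HN n Hn); cbn [pos] in HN; apply Rabs_def2 in HN.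
      destruct (le_dec v (polya_h s n)) as [|G]; [reflexivity|exfalso].
      destruct (polya_h_scaled s n Hs) as [_ H3].
      assert (INR (2 * polya_h s n + 1) <= 2 * INR v + 1).
      { replace (2 * INR v + 1) with (INR (2 * v + 1)) by (rewrite plus_INR, mult_INR; simpl; ring).
        apply le_INR; lia. }
      pose proof (Msq_pos n); nra.
    + apply is_lim_seq_mult'; [apply is_lim_seq_const|].
      apply (cos_pow_limit (fun n => 2 * polya_h s n + 1)%nat); [assumption|intros; lia|exact HL].
  - intros n v; pose proof (two_sided_bounds v).
    destruct (le_dec v (polya_h s n)) as [G|G].
    2:{ rewrite Rabs_R0; apply Rmult_le_pos; [lra|left; apply exp_pos]. }
    rewrite cos_pow_even.
    set (L := INR (2 * polya_h s n + 1)); set (x := PI * INR v / L).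
    assert (HvL : 2 * INR v + 1 <= L).
    { replace (2 * INR v + 1) with (INR (2 * v + 1)) by (rewrite plus_INR, mult_INR; simpl; ring).
      apply le_INR; lia. }
    pose proof (pos_INR v) as Hv.
    assert (Hx : 0 <= x <= PI / 2).
    { unfold x; split; [apply Rmult_le_pos; [nra|left; apply Rinv_0_lt_compat; lra]|].
      apply (Rmult_le_reg_r L); [lra|]; replace (PI * INR v / L * L) with (PI * INR v) by (field; lra).
      nra. }
    pose proof (sin_ge_third x Hx) as Hsin; pose proof (SIN_bound x).
    assert (Hs2 : 0 <= sin x ^ 2 <= 1) by (simpl; nra).
    rewrite Rabs_right by (apply Rle_ge, Rmult_le_pos; [lra|apply pow_le; lra]).
    apply Rmult_le_compat_l; [lra|]; eapply Rle_trans; [now apply pow_exp_upper|].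
    apply exp_le, Ropp_le_contravar.
    destruct (polya_h_scaled s n Hs) as [[_ H3] _]; fold L in H3.
    pose proof (Msq_sq n) as HM; pose proof (Msq_pos n) as HMp; pose proof (Msq_le_1 n).
    assert (HSp : 0 < INR (S n)) by (apply lt_0_INR; lia).
    apply Rle_trans with (INR (S n) * (x / 3) ^ 2).
    + replace (INR (S n) * (x / 3) ^ 2) with (PI ^ 2 / 9 * / (L * Msq n) ^ 2 * INR v ^ 2).
      * apply Rmult_le_compat_r; [apply pow2_ge_0|].
        apply Rmult_le_compat_l; [nra|].
        apply Rinv_le_contravar; [apply pow_lt, Rmult_lt_0_compat; lra|].
        apply pow_incr; split; [apply Rmult_le_pos; lra|lra].
      * replace (INR (S n)) with (/ (Msq n * Msq n)); [unfold x; field; lra|].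
        apply (Rmult_eq_reg_r (Msq n * Msq n)); [|nra]; rewrite HM; field; lra.
    + apply Rmult_le_compat_l; [lra|]; apply pow_incr; lra.
  - apply ex_series_gauss; apply Rmult_lt_0_compat; [nra|]; apply Rinv_0_lt_compat; nra.
Qed.

(** The sequence does not involve s: one limit is computed along a whole family of periods, and
    comparing two of them gives the transformation. *)
Lemma walk_center_limit s : 0 < s ->
  is_lim_seq (fun n => walk (S n) 0 / Msq n) (theta (PI ^ 2 / s ^ 2) / (s * theta (s ^ 2))).
Proof.
  intros Hs; assert (Hth : 1 <= theta (s ^ 2)) by (apply theta_ge_1; nra).
  pose proof (walk_series_limit s Hs) as HW.
  apply (is_lim_seq_ext_loc (fun n => sum_n (fun v => two_sided v *
      cos (PI * INR v / INR (2 * polya_h s n + 1)) ^ (2 * S n)) (polya_h s n) /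
      ((INR (2 * polya_h s n + 1) * Msq n) *
       Series (fun k => two_sided k * walk_weight (S n) (k * (2 * polya_h s n + 1)))))).
  - apply is_lim_seq_spec in HW; destruct (HW (mkposreal (1/2) ltac:(lra))) as [N HN].
    exists N; intros n Hn; specialize (HN n Hn); cbn [pos] in HN; apply Rabs_def2 in HN.
    rewrite polya_identity; pose proof (Msq_pos n).
    assert (0 < INR (2 * polya_h s n + 1)) by (apply lt_0_INR; lia).
    field; repeat split; lra.
  - apply is_lim_seq_div'; [now apply cos_series_limit| |nra].
    apply is_lim_seq_mult'; [now apply polya_h_lim|exact HW].
Qed.

(* The unknown limit of sqrt m times the central weight of the walk is eliminated by the case t = 1. *)
Lemma theta_transform t : 0 < t -> theta (PI / t) = sqrt t * theta (PI * t).
Proof.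
  intros Ht; pose proof PI_RGT_0 as HPI.
  assert (HS : forall u, 0 < u -> is_lim_seq (fun n => walk (S n) 0 / Msq n)
     (theta (PI / u) / (sqrt PI * (sqrt u * theta (PI * u))))).
  { intros u Hu; pose proof (walk_center_limit (sqrt (PI * u))) as H.
    rewrite pow2_sqrt in H by nra.
    replace (PI ^ 2 / (PI * u)) with (PI / u) in H by (field; lra).
    rewrite sqrt_mult in H by lra; rewrite <- Rmult_assoc; apply H.
    rewrite <- sqrt_mult by lra; apply sqrt_lt_R0; nra. }
  pose proof (HS t Ht) as H1; pose proof (HS 1 Rlt_0_1) as H2.
  apply is_lim_seq_unique in H1; apply is_lim_seq_unique in H2.
  rewrite H2 in H1; injection H1 as E.
  rewrite sqrt_1, Rmult_1_l, Rmult_1_r in E; unfold Rdiv in E at 2; rewrite Rinv_1, Rmult_1_r in E.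
  pose proof (theta_ge_1 PI HPI); pose proof (theta_ge_1 (PI * t) ltac:(nra)).
  pose proof (sqrt_lt_R0 PI HPI); pose proof (sqrt_lt_R0 t Ht).
  assert (E' : theta (PI / t) / (sqrt PI * (sqrt t * theta (PI * t))) = / sqrt PI).
  { rewrite <- E; field; lra. }
  apply (Rmult_eq_reg_r (/ (sqrt PI * (sqrt t * theta (PI * t))))).
  - transitivity (/ sqrt PI); [exact E'|]; field; lra.
  - apply Rinv_neq_0_compat, Rgt_not_eq; repeat apply Rmult_lt_0_compat; lra.
Qed.

(** * Lattice sums *)

Lemma theta_zseries y : 0 < y -> zseries (fun n : Z => exp (- (y * IZR n ^ 2))) (theta y).
Proof.
  intros Hy; unfold zseries, theta; eapply is_series_ext; [|apply Series_correct, ex_series_gauss, Hy].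
  intros n; match goal with |- ?a = ?b => change (a = b :> R) end.
  destruct n as [|n]; cbn [zpair two_sided]; [simpl; ring|].
  rewrite opp_IZR, <- INR_IZR_INZ.
  replace ((- INR (S n)) ^ 2) with (INR (S n) ^ 2) by ring; ring.
Qed.

Lemma theta_is_sum y : 0 < y -> is_sum (fun n : Z => exp (- (y * IZR n ^ 2))) (theta y).
Proof. intros Hy; apply zseries_is_sum; [intros; left; apply exp_pos|now apply theta_zseries]. Qed.

Lemma ex_sum_sub {A B} (phi : A -> B) (g : B -> R) s :
  (forall a a', phi a = phi a' -> a = a') -> is_sum g s ->
  exists t, is_sum (fun a => g (phi a)) t.
Proof.
  intros Hi Hs.
  destruct (completeness (fun x => exists l, NoDup l /\ x = fsum (fun a => g (phi a)) l)) as [t Ht].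
  - exists s; intros x (l & Hl & ->); rewrite <- fsum_map.
    apply (is_sum_fsum_le _ _ _ Hs), Injective_map_NoDup; assumption.
  - exists 0, nil; split; [constructor|reflexivity].
  - now exists t.
Qed.

Lemma ex_coset_sum y d c : 0 < y -> (0 < d)%Z ->
  exists t, is_sum (fun n : Z => exp (- (y * IZR (d * n + c) ^ 2))) t.
Proof.
  intros Hy Hd.
  apply (ex_sum_sub (fun n => d * n + c)%Z (fun n : Z => exp (- (y * IZR n ^ 2))) (theta y));
    [intros; nia|now apply theta_is_sum].
Qed.

(** Total by choice, with default 0 where no sum exists; for y > 0 and d > 0 the sum always
    exists. *)
Definition coset_sum (y : R) (d c : Z) : R :=
  match excluded_middle_informative (exists t, is_sum (fun n : Z => exp (- (y * IZR (d * n + c) ^ 2))) t)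
  with left H => proj1_sig (constructive_indefinite_description _ H) | right _ => 0 end.

Lemma coset_sum_is_sum y d c : 0 < y -> (0 < d)%Z ->
  is_sum (fun n : Z => exp (- (y * IZR (d * n + c) ^ 2))) (coset_sum y d c).
Proof.
  intros Hy Hd; unfold coset_sum; destruct (excluded_middle_informative _) as [H|H].
  - now destruct (constructive_indefinite_description _ H).
  - destruct H; now apply ex_coset_sum.
Qed.

Lemma coset_sum_eq y d c s : 0 < y -> (0 < d)%Z ->
  is_sum (fun n : Z => exp (- (y * IZR (d * n + c) ^ 2))) s -> coset_sum y d c = s.
Proof. intros Hy Hd; apply is_sum_unique; now apply coset_sum_is_sum. Qed.

Lemma coset_sum_0 y d : 0 < y -> (0 < d)%Z -> coset_sum y d 0 = theta (y * IZR d ^ 2).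
Proof.
  intros Hy Hd; apply coset_sum_eq; try assumption.
  assert (0 < IZR d) by now apply IZR_lt.
  eapply is_sum_ext; [|apply theta_is_sum, Rmult_lt_0_compat; [|apply pow_lt]; assumption].
  intros n; cbv beta; rewrite Z.add_0_r, mult_IZR; f_equal; ring.
Qed.

Lemma is_sum_opp (g : Z -> R) s : is_sum (fun n => g (- n)%Z) s -> is_sum g s.
Proof.
  apply is_sum_inj; [intros; lia|]; intros n _; exists (- n)%Z; lia.
Qed.

Lemma coset_sum_opp y d c : 0 < y -> (0 < d)%Z -> coset_sum y d (- c) = coset_sum y d c.
Proof.
  intros Hy Hd; apply coset_sum_eq; try assumption.
  apply is_sum_opp; eapply is_sum_ext; [|apply coset_sum_is_sum; eassumption].
  intros n; cbv beta; do 3 f_equal.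
  replace (d * - n + - c)%Z with (- (d * n + c))%Z by ring; rewrite opp_IZR; ring.
Qed.

Lemma coset_sum_shift y d c : 0 < y -> (0 < d)%Z -> coset_sum y d (c + d) = coset_sum y d c.
Proof.
  intros Hy Hd; symmetry; apply coset_sum_eq; try assumption.
  apply (is_sum_inj (fun n => n + 1)%Z); [intros; lia|intros n _; exists (n - 1)%Z; lia|].
  eapply is_sum_ext; [|apply coset_sum_is_sum; eassumption].
  intros n; cbv beta; do 5 f_equal; ring.
Qed.

Lemma balanced_mod3 z : exists r k, In r (0 :: 1 :: -1 :: nil)%Z /\ z = (3 * k + r)%Z.
Proof.
  pose proof (Z.mod_pos_bound z 3 ltac:(lia)); pose proof (Z.div_mod z 3 ltac:(lia)).
  assert (z mod 3 = 0 \/ z mod 3 = 1 \/ z mod 3 = 2)%Z as [H'|[H'|H']] by lia.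
  - exists 0%Z, (z / 3)%Z; cbn [In]; lia.
  - exists 1%Z, (z / 3)%Z; cbn [In]; lia.
  - exists (-1)%Z, (z / 3 + 1)%Z; cbn [In]; lia.
Qed.

Lemma theta_split3 y : 0 < y -> theta y = theta (9 * y) + 2 * coset_sum y 3 1.
Proof.
  intros Hy.
  apply (is_sum_unique _ _ _ (theta_is_sum y Hy)).
  replace (theta (9 * y) + 2 * coset_sum y 3 1)
    with (fsum (coset_sum y 3) (0 :: 1 :: -1 :: nil)%Z).
  2:{ simpl; change (-1)%Z with (- (1))%Z; rewrite coset_sum_opp, coset_sum_0 by (lia || assumption).
      replace (y * 3 ^ 2) with (9 * y) by ring; ring. }
  apply (is_sum_cover _ (fun c n => 3 * n + c)%Z).
  - repeat constructor; cbn [In]; lia.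
  - intros; left; apply exp_pos.
  - intros b _; destruct (balanced_mod3 b) as (r & k & Hr & ->); now exists r, k.
  - cbn [In]; lia.
  - intros c _; apply coset_sum_is_sum; [assumption|lia].
Qed.

Lemma exp_sq_sum y (l1 l2 l3 l4 : R) :
  exp (- (y * l1)) * exp (- (y * l2)) * exp (- (y * l3)) * exp (- (y * l4)) =
  exp (- (y * (l1 + l2 + l3 + l4))).
Proof. rewrite <- !exp_plus; f_equal; ring. Qed.

Lemma quadruple_sum y (c1 c2 c3 c4 d : Z) : 0 < y -> (0 < d)%Z ->
  is_sum (fun p : Z * Z * Z * Z => let '(a, b, c, e) := p in
    exp (- (y * (IZR (d * a + c1) ^ 2 + IZR (d * b + c2) ^ 2
      + IZR (d * c + c3) ^ 2 + IZR (d * e + c4) ^ 2))))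
  (coset_sum y d c1 * coset_sum y d c2 * coset_sum y d c3 * coset_sum y d c4).
Proof.
  intros Hy Hd.
  pose proof (coset_sum_is_sum y d c1 Hy Hd) as H1.
  pose proof (coset_sum_is_sum y d c2 Hy Hd) as H2.
  pose proof (coset_sum_is_sum y d c3 Hy Hd) as H3.
  pose proof (coset_sum_is_sum y d c4 Hy Hd) as H4.
  assert (Hp : forall x, 0 <= exp x) by (intros; left; apply exp_pos).
  pose proof (is_sum_prod _ _ _ _ (fun a => Hp _) (fun b => Hp _) H1 H2) as H12.
  assert (P12 : forall p : Z * Z, 0 <= exp (- (y * IZR (d * fst p + c1) ^ 2)) *
    exp (- (y * IZR (d * snd p + c2) ^ 2))) by (intros; apply Rmult_le_pos; apply Hp).
  pose proof (is_sum_prod _ _ _ _ P12 (fun b => Hp _) H12 H3) as H123.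
  assert (P123 : forall p : Z * Z * Z, 0 <= exp (- (y * IZR (d * fst (fst p) + c1) ^ 2)) *
    exp (- (y * IZR (d * snd (fst p) + c2) ^ 2)) * exp (- (y * IZR (d * snd p + c3) ^ 2)))
    by (intros; apply Rmult_le_pos; [apply P12|apply Hp]).
  pose proof (is_sum_prod _ _ _ _ P123 (fun b => Hp _) H123 H4) as H.
  eapply is_sum_ext; [|exact H].
  intros [[[a b] c] e]; cbn [fst snd]; apply exp_sq_sum.
Qed.

(* The rows (0,1,1,1), (1,0,1,-1), (1,-1,0,1), (1,1,-1,0) are orthogonal of norm 3, so they map
   Z^4 onto a sublattice containing 3 Z^4 whose nine residue classes mod 3 form the tetracode:
   zero and eight words of weight three. *)
Lemma theta_cubic y : 0 < y ->
  theta (3 * y) ^ 4 = theta (9 * y) ^ 4 + 8 * theta (9 * y) * coset_sum y 3 1 ^ 3.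
Proof.
  intros Hy.
  pose proof (quadruple_sum (3 * y) 0 0 0 0 1 ltac:(lra) ltac:(lia)) as H.
  rewrite coset_sum_0 in H by (lra || lia).
  replace (3 * y * 1 ^ 2) with (3 * y) in H by ring.
  replace (theta (3 * y) ^ 4) with (theta (3 * y) * theta (3 * y) * theta (3 * y) * theta (3 * y)) by ring.
  apply (is_sum_unique _ _ _ H); clear H.
  pose (cs := list_prod (0 :: 1 :: -1 :: nil)%Z (0 :: 1 :: -1 :: nil)%Z).
  (* A word of the tetracode is determined by its last two entries: it is (s - t, - s - t, s, t). *)
  pose (w := fun c : Z * Z => coset_sum y 3 (fst c - snd c) * coset_sum y 3 (- fst c - snd c)
               * coset_sum y 3 (fst c) * coset_sum y 3 (snd c)).
  assert (H2 : coset_sum y 3 2 = coset_sum y 3 1).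
  { replace 2%Z with (-1 + 3)%Z by lia; rewrite coset_sum_shift by (lia || assumption).
    apply (coset_sum_opp y 3 1); [assumption|lia]. }
  assert (Hm1 : coset_sum y 3 (-1) = coset_sum y 3 1)
    by (apply (coset_sum_opp y 3 1); [assumption|lia]).
  assert (Hm2 : coset_sum y 3 (-2) = coset_sum y 3 1)
    by (rewrite <- H2; apply (coset_sum_opp y 3 2); [assumption|lia]).
  replace (theta (9 * y) ^ 4 + 8 * theta (9 * y) * coset_sum y 3 1 ^ 3) with (fsum w cs).
  2:{ unfold cs, w; simpl; rewrite H2, Hm1, Hm2, coset_sum_0 by (lia || assumption).
      replace (y * 3 ^ 2) with (9 * y) by ring; ring. }
  (* The shifts - t and s are the image of the word under one third of the transposed matrix,
     integral because the word belongs to the code. *)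
  apply (is_sum_cover _ (fun c k => let '(s, t) := c in let '(k1, k2, k3, k4) := k in
    (k2 + k3 + k4, k1 - k3 + k4, k1 + k2 - k4 - t, k1 - k2 + k3 + s)%Z)).
  - apply NoDup_list_prod; repeat constructor; cbn [In]; lia.
  - intros [[[a b] c] e]; left; apply exp_pos.
  - intros [[[a b] c] e] _.
    destruct (balanced_mod3 (a - b + e)%Z) as (s & k3 & Hs & E3).
    destruct (balanced_mod3 (a + b - c)%Z) as (t & k4 & Ht & E4).
    exists (s, t), (b + k3 - k4, a - k3 - k4, k3, k4)%Z; split; [now apply in_prod|].
    repeat f_equal; lia.
  - intros [s t] [s' t'] [[[k1 k2] k3] k4] [[[k1' k2'] k3'] k4'] Hc Hc' E.
    apply in_prod_iff in Hc; apply in_prod_iff in Hc'; cbn [In] in Hc, Hc'.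
    injection E as E1 E2 E3 E4.
    assert (s = s' /\ t = t') as [-> ->] by lia.
    split; [reflexivity|]; repeat f_equal; lia.
  - intros [s t] _; unfold w; cbn [fst snd].
    eapply is_sum_ext; [|apply quadruple_sum; [assumption|lia]].
    intros [[[k1 k2] k3] k4]; cbv beta iota; f_equal.
    rewrite !Z.add_0_r, !Z.mul_1_l, !plus_IZR, !minus_IZR, !plus_IZR, !mult_IZR, opp_IZR; ring.
Qed.

(** * The continued fraction as a theta quotient *)

Definition Vth (y : R) : R := (1 - theta (y / 3) / theta (3 * y)) / 2.

Definition rho (y : R) : R := (theta y / theta (3 * y)) ^ 4.

(** Pairs n with -(n + 1) instead of -n, as the series for F(2) does; the partial sums differ by one
    boundary term, which tends to 0. *)
Lemma zseries_shifted (f : Z -> R) s :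
  is_lim_seq (fun n => f (- Z.of_nat (S n))%Z) 0 ->
  is_series (fun n => f (Z.of_nat n) + f (- Z.of_nat (S n))%Z) s -> zseries f s.
Proof.
  intros Hf Hs; change (is_lim_seq (sum_n (zpair f)) s).
  apply (is_lim_seq_ext (fun n => sum_n (fun n => f (Z.of_nat n) + f (- Z.of_nat (S n))%Z) n
     - f (- Z.of_nat (S n))%Z)).
  - intros n; induction n as [|n IH]; [rewrite !sum_O; simpl; ring|].
    rewrite !sum_Sn_R, <- IH; cbn [zpair]; ring.
  - replace (Finite s) with (Finite (s - 0)) by (f_equal; ring).
    apply is_lim_seq_minus'; [exact Hs|exact Hf].
Qed.

(** (3n + 1)^2 / 3 = 1/3 + 3n^2 + 2n, and n = -(s + 1) turns 3n^2 + 2n into (3s^2 + 2s) + (2s +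
    1). *)
Lemma coset_sum_series y : 0 < y ->
  coset_sum (y / 3) 3 1 = exp (- (y / 3)) *
    Series (fun s => exp (- y) ^ (3 * (s * s) + 2 * s) * (1 + exp (- y) ^ (2 * s + 1))).
Proof.
  intros Hy; pose proof (exp_neg_bounds y Hy) as Hr.
  assert (E1 : ex_series (fun s => exp (- y) ^ (3 * (s * s) + 2 * s)))
    by (apply ex_series_pow_le; [assumption|intros; lia]).
  apply coset_sum_eq; [lra|lia|].
  assert (Hpos : forall n : Z, exp (- (y / 3 * IZR (3 * n + 1) ^ 2)) =
     exp (- (y / 3)) * exp (- (y * (3 * IZR n ^ 2 + 2 * IZR n)))).
  { intros n; rewrite <- exp_plus, plus_IZR, mult_IZR; f_equal; field. }
  apply zseries_is_sum; [intros; left; apply exp_pos|].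
  apply zseries_shifted.
  - apply (is_lim_seq_geom_dominated _ 1 (exp (- y)) Hr); intros n.
    rewrite Rabs_right by (left; apply exp_pos); rewrite Rmult_1_l, exp_pow; apply exp_le.
    rewrite plus_IZR, mult_IZR, opp_IZR, <- INR_IZR_INZ, S_INR; pose proof (pos_INR n).
    assert (INR n <= (3 * - (INR n + 1) + 1) ^ 2 / 3) by nra; nra.
  - rewrite <- Series_scal_l.
    eapply is_series_ext; [|apply Series_correct, ex_series_scal_R].
    + intros n; match goal with |- ?a = ?b => change (a = b :> R) end.
      rewrite !Hpos, opp_IZR, <- !INR_IZR_INZ, S_INR.
      rewrite Rmult_plus_distr_l, Rmult_1_r, <- pow_add, !exp_pow.
      rewrite !plus_INR, !mult_INR; simpl (INR 3); simpl (INR 2); simpl (INR 1).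
      rewrite Rmult_plus_distr_l, <- !exp_plus; f_equal; f_equal; ring.
    + apply (ex_series_dominated _ (fun s => 2 * exp (- y) ^ (3 * (s * s) + 2 * s)));
        [|now apply ex_series_scal_R].
      intros s; pose proof (pow_bounds _ (3 * (s * s) + 2 * s) Hr); pose proof (pow_bounds _ (2 * s + 1) Hr).
      rewrite Rabs_right by nra; nra.
Qed.

Lemma cbrt_cube x : 0 < x -> 0 < cbrt x /\ cbrt x ^ 3 = x.
Proof.
  intros Hx; unfold cbrt; destruct (Rlt_dec 0 x); [|lra].
  split; [apply exp_pos|].
  rewrite <- Rpower_pow by apply exp_pos; rewrite Rpower_mult; simpl INR.
  replace (1 / 3 * (1 + 1 + 1)) with 1 by field; now apply Rpower_1.
Qed.

(** The limit is - exp (- (y / 3)) S2 / theta(3y), and exp (- (y / 3)) S2 is the part of theta(y/3)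
    over the class of 1 modulo 3, hence half of theta(y/3) - theta(3y). *)
Lemma V_eq_theta y : 0 < y -> V_eq (- exp (- y)) (Vth y).
Proof.
  intros Hy; unfold V_eq; apply is_lim_seq_Reals.
  pose proof (exp_neg_bounds y Hy) as Hr; pose proof (theta_ge_1 (3 * y) ltac:(lra)) as Hth.
  pose proof (cf_tail_lim _ Hr) as HL.
  pose proof (coset_sum_series y Hy) as HB.
  pose proof (theta_split3 (y / 3) ltac:(lra)) as HS.
  replace (9 * (y / 3)) with (3 * y) in HS by field.
  set (S2 := Series (fun s => exp (- y) ^ (3 * (s * s) + 2 * s) * (1 + exp (- y) ^ (2 * s + 1)))) in *.
  assert (H1 : Series (fun s => two_sided s * exp (- y) ^ (3 * (s * s))) = theta (3 * y)).
  { unfold theta; apply Series_ext; intros n; rewrite exp_pow, !mult_INR; simpl (INR 3).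
    f_equal; f_equal; ring. }
  rewrite H1 in HL.
  assert (HS2 : 0 < S2).
  { unfold S2; rewrite Series_incr_1.
    - assert (0 <= Series (fun k => exp (- y) ^ (3 * (S k * S k) + 2 * S k) *
        (1 + exp (- y) ^ (2 * S k + 1)))).
      { apply Series_ge_0.
        - intros n; pose proof (pow_bounds _ (3 * (S n * S n) + 2 * S n) Hr);
            pose proof (pow_bounds _ (2 * S n + 1) Hr); nra.
        - apply (ex_series_dominated _ (fun s => 2 * exp (- y) ^ (3 * (S s * S s) + 2 * S s))).
          + intros s; pose proof (pow_bounds _ (3 * (S s * S s) + 2 * S s) Hr);
            pose proof (pow_bounds _ (2 * S s + 1) Hr).
            rewrite Rabs_right by nra; nra.
          + apply ex_series_scal_R, ex_series_pow_le; [assumption|intros; lia]. }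
      pose proof (pow_bounds _ (3 * (0 * 0) + 2 * 0) Hr); pose proof (pow_bounds _ (2 * 0 + 1) Hr).
      apply Rplus_lt_le_0_compat; [apply Rmult_lt_0_compat; lra|assumption].
    - apply (ex_series_dominated _ (fun s => 2 * exp (- y) ^ (3 * (s * s) + 2 * s))).
      + intros s; pose proof (pow_bounds _ (3 * (s * s) + 2 * s) Hr);
            pose proof (pow_bounds _ (2 * s + 1) Hr).
        rewrite Rabs_right by nra; nra.
      + apply ex_series_scal_R, ex_series_pow_le; [assumption|intros; lia]. }
  assert (Hc : cbrt (- exp (- y)) = - exp (- (y / 3))).
  { unfold cbrt; destruct (Rlt_dec 0 (- exp (- y))); [lra|].
    destruct (Rlt_dec (- exp (- y)) 0); [|lra].
    unfold Rpower; rewrite Ropp_involutive, ln_exp; do 2 f_equal; field. }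
  replace (Vth y) with (cbrt (- exp (- y)) / (theta (3 * y) / S2)).
  - apply is_lim_seq_div'; [apply is_lim_seq_const|exact HL|].
    apply Rgt_not_eq, Rdiv_lt_0_compat; lra.
  - unfold Vth; rewrite Hc, HS, HB; field; lra.
Qed.

(** [theta_cubic] at y / 3, where the coset sum is - V theta(3y) by [theta_split3]. *)
Lemma rho_Vth y : 0 < y -> rho y = 1 - 8 * Vth y ^ 3.
Proof.
  intros Hy; unfold rho, Vth.
  pose proof (theta_cubic (y / 3) ltac:(lra)) as HC.
  pose proof (theta_split3 (y / 3) ltac:(lra)) as HS.
  pose proof (theta_ge_1 (3 * y) ltac:(lra)) as Hth.
  replace (9 * (y / 3)) with (3 * y) in * by field.
  replace (3 * (y / 3)) with y in * by field.
  replace ((theta y / theta (3 * y)) ^ 4) with (theta y ^ 4 / theta (3 * y) ^ 4) by (field; lra).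
  rewrite HC, HS; field; lra.
Qed.

(** * The values at 1, 3, 1/3, 1/9 and 1/27 *)

Lemma cube_inj a b : a ^ 3 = b ^ 3 -> a = b.
Proof.
  intros H; assert (E : (a - b) * (a * a + a * b + b * b) = 0) by (simpl in H; lra).
  apply Rmult_integral in E; destruct E as [E|E]; [lra|].
  pose proof (Rle_0_sqr (a + b / 2)) as H1; pose proof (Rle_0_sqr b) as H2.
  pose proof (Rle_0_sqr (b + a / 2)) as H3; pose proof (Rle_0_sqr a) as H4.
  unfold Rsqr in *; assert (b * b = 0) by lra; assert (a * a = 0) by lra.
  transitivity 0; [|symmetry]; now apply Rsqr_0_uniq.
Qed.

Lemma sqrt_sqrt_pow4 x : 0 < x -> sqrt x ^ 4 = x ^ 2.
Proof.
  intros Hx; replace (sqrt x ^ 4) with ((sqrt x * sqrt x) * (sqrt x * sqrt x)) by ring.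
  rewrite sqrt_sqrt by lra; ring.
Qed.

Lemma rho_pos y : 0 < y -> 0 < rho y.
Proof.
  intros Hy; unfold rho; pose proof (theta_ge_1 y Hy); pose proof (theta_ge_1 (3 * y) ltac:(lra)).
  apply pow_lt, Rdiv_lt_0_compat; lra.
Qed.

(** Transforming both theta values leaves the factor sqrt (3t) / sqrt t = sqrt 3, whose fourth power
    is 9. *)
Lemma rho_dual t : 0 < t -> rho (PI / (3 * t)) = 9 / rho (PI * t).
Proof.
  intros Ht; pose proof PI_RGT_0; unfold rho.
  replace (3 * (PI / (3 * t))) with (PI / t) by (field; lra).
  rewrite !theta_transform by lra.
  replace (PI * (3 * t)) with (3 * (PI * t)) by ring.
  rewrite sqrt_mult by lra.
  pose proof (theta_ge_1 (PI * t) ltac:(nra)); pose proof (theta_ge_1 (3 * (PI * t)) ltac:(nra)).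
  pose proof (sqrt_lt_R0 t Ht).
  transitivity (sqrt 3 ^ 4 / (theta (PI * t) / theta (3 * (PI * t))) ^ 4); [field; lra|].
  rewrite sqrt_sqrt_pow4 by lra; field; lra.
Qed.

(** Here y / 3 and 3y are dual, so the theta quotient is sqrt 3. *)
Lemma Vth_1 : Vth PI = (1 - sqrt 3) / 2.
Proof.
  unfold Vth; rewrite theta_transform, (Rmult_comm PI 3) by lra.
  pose proof PI_RGT_0; pose proof (theta_ge_1 (3 * PI) ltac:(lra)); field; lra.
Qed.

Lemma sqrt3_facts : 0 < sqrt 3 /\ sqrt 3 * sqrt 3 = 3 /\ 17/10 < sqrt 3 < 18/10.
Proof.
  assert (H : sqrt 3 * sqrt 3 = 3) by (apply sqrt_sqrt; lra).
  assert (H0 : 0 < sqrt 3) by (apply sqrt_lt_R0; lra).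
  repeat split; nra.
Qed.

Lemma Vth_cube y : 0 < y -> Vth y ^ 3 = (1 - rho y) / 8.
Proof. intros Hy; rewrite rho_Vth by assumption; field. Qed.

Lemma opp_inv_cbrt_cube x : 0 < x -> (- (1 / cbrt x)) ^ 3 = - / x.
Proof.
  intros Hx; destruct (cbrt_cube x Hx) as [H1 H2].
  transitivity (- / (cbrt x ^ 3)); [field; lra|now rewrite H2].
Qed.

(** Dual to y = pi through [rho_dual] at t = 1; the cubes of both sides are rational in sqrt 3. *)
Lemma Vth_one_ninth : Vth (PI / 3) = - (1 / cbrt (2 * (sqrt 3 - 1))).
Proof.
  pose proof PI_RGT_0; destruct sqrt3_facts as (H1 & H2 & H3); set (s := sqrt 3) in *.
  apply cube_inj; rewrite opp_inv_cbrt_cube, Vth_cube by lra.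
  replace (PI / 3) with (PI / (3 * 1)) by field; rewrite rho_dual, Rmult_1_r, rho_Vth, Vth_1 by lra.
  fold s; replace (1 - 8 * ((1 - s) / 2) ^ 3) with (6 * s - 9).
  - assert (E : (1 - 9 / (6 * s - 9)) / 8 - - / (2 * (s - 1)) =
        (3 * (s * s - 3) ) / (4 * (6 * s - 9) * (s - 1))) by (field; lra).
    rewrite H2 in E; replace (3 * (3 - 3)) with 0 in E by ring; unfold Rdiv in E at 2; lra.
  - replace (1 - 8 * ((1 - s) / 2) ^ 3) with (3 * s - 3 * (s * s) + s * (s * s)) by field.
    rewrite H2; ring.
Qed.

Lemma sqrt3_inv x : x / sqrt 3 = x * sqrt 3 / 3.
Proof.
  destruct sqrt3_facts as (H1 & H2 & _); rewrite <- H2 at 3; field; lra.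
Qed.

(** Here y and 3y are dual, so the theta quotient is the fourth root of 3. *)
Lemma rho_one_third : rho (PI / sqrt 3) = 3.
Proof.
  destruct sqrt3_facts as (H1 & H2 & H3); pose proof PI_RGT_0; unfold rho.
  replace (3 * (PI / sqrt 3)) with (PI * sqrt 3) by (rewrite sqrt3_inv; field).
  rewrite theta_transform by lra.
  pose proof (theta_ge_1 (PI * sqrt 3) ltac:(nra)).
  transitivity (sqrt (sqrt 3) ^ 4); [field; lra|].
  rewrite sqrt_sqrt_pow4 by lra; simpl; lra.
Qed.

Lemma Vth_one_third : Vth (PI / sqrt 3) = - (1 / cbrt 4).
Proof.
  destruct sqrt3_facts as (H1 & H2 & H3); pose proof PI_RGT_0.
  apply cube_inj; rewrite opp_inv_cbrt_cube, Vth_cube, rho_one_third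
    by (try apply Rdiv_lt_0_compat; lra); field.
Qed.

(** Here y / 3 is dual to y, so w = theta(y/3) / theta(3y) satisfies w^4 = 3 rho(y) = 3 (1 - (1 -
    w)^3), a cubic after division by w. *)
Lemma Vth_three : Vth (PI * sqrt 3) = (1 - cbrt 4) / (2 + cbrt 4).
Proof.
  destruct sqrt3_facts as (H1 & H2 & H3); pose proof PI_RGT_0.
  destruct (cbrt_cube 4 ltac:(lra)) as [Hc0 Hc]; set (c := cbrt 4) in *.
  assert (Hy : 0 < PI * sqrt 3) by nra.
  pose proof (rho_Vth _ Hy) as HR.
  pose proof (theta_ge_1 _ Hy) as Ht1; pose proof (theta_ge_1 (3 * (PI * sqrt 3)) ltac:(lra)) as Ht2.
  pose (w := sqrt (sqrt 3) * (theta (PI * sqrt 3) / theta (3 * (PI * sqrt 3)))).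
  assert (Hw0 : 0 < w).
  { unfold w; apply Rmult_lt_0_compat; [now apply sqrt_lt_R0|apply Rdiv_lt_0_compat; lra]. }
  assert (HV : Vth (PI * sqrt 3) = (1 - w) / 2).
  { unfold Vth; replace (PI * sqrt 3 / 3) with (PI / sqrt 3) by (rewrite sqrt3_inv; field).
    rewrite theta_transform by lra; unfold w; field; lra. }
  assert (Hw4 : w ^ 4 = 3 * rho (PI * sqrt 3)).
  { unfold w, rho; rewrite Rpow_mult_distr, sqrt_sqrt_pow4 by lra; simpl (sqrt 3 ^ 2).
    rewrite Rmult_1_r, H2; reflexivity. }
  rewrite HR, HV in Hw4; rewrite HV.
  assert (Hw3 : w ^ 3 - 3 * w ^ 2 + 9 * w - 9 = 0).
  { apply (Rmult_eq_reg_l w); [|lra].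
    replace (w * (w ^ 3 - 3 * w ^ 2 + 9 * w - 9)) with (w ^ 4 - 3 * (1 - 8 * ((1 - w) / 2) ^ 3)) by field.
    rewrite Hw4; ring. }
  assert (E : w = 3 * c / (2 + c)).
  { pose (v := 3 * c / (2 + c)).
    assert (Hv3 : v ^ 3 - 3 * v ^ 2 + 9 * v - 9 = 0).
    { transitivity (18 * (c ^ 3 - 4) / (2 + c) ^ 3); [unfold v; field; lra|].
      rewrite Hc; unfold Rdiv; ring. }
    (* The cofactor equals 3/4 (w + v - 2)^2 + 1/4 (w - v)^2 + 6, so the real root is unique. *)
    assert (HF : (w - v) * (w * w + w * v + v * v - 3 * (w + v) + 9) = 0).
    { transitivity ((w ^ 3 - 3 * w ^ 2 + 9 * w - 9) - (v ^ 3 - 3 * v ^ 2 + 9 * v - 9)); [ring|lra]. }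
    fold v; apply Rmult_integral in HF; destruct HF as [|HF]; [lra|exfalso].
    pose proof (Rle_0_sqr (w + v - 2)); pose proof (Rle_0_sqr (w - v)); unfold Rsqr in *; nra. }
  rewrite E; field; lra.
Qed.

(** Dual to pi sqrt 3. Modulo c^3 = 4 the radicand 1/3 (c - 1)^4 + 1 reduces to 2c^2 - 4, and the
    cubes of both sides agree. *)
Lemma Vth_one_27th : Vth (PI / (3 * sqrt 3)) = - (1 / cbrt (1 / 3 * (cbrt 4 - 1) ^ 4 + 1)).
Proof.
  destruct sqrt3_facts as (H1 & H2 & H3); pose proof PI_RGT_0.
  destruct (cbrt_cube 4 ltac:(lra)) as [Hc0 Hc].
  assert (Hy : 0 < PI * sqrt 3) by nra.
  pose proof (rho_pos _ Hy) as Hr.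
  assert (Hd : 0 < 1 / 3 * (cbrt 4 - 1) ^ 4 + 1).
  { assert (0 <= (cbrt 4 - 1) ^ 4); [|lra].
    replace ((cbrt 4 - 1) ^ 4) with (((cbrt 4 - 1) ^ 2) ^ 2) by ring; apply pow2_ge_0. }
  apply cube_inj; rewrite opp_inv_cbrt_cube by assumption.
  rewrite Vth_cube by (apply Rdiv_lt_0_compat; lra).
  rewrite rho_dual by assumption; rewrite rho_Vth, Vth_three in * by assumption.
  set (c := cbrt 4) in *.
  assert (Hcb : 1 < c < 2).
  { split; apply Rnot_le_lt; intros G.
    - assert (c * c <= 1) by nra; assert (c * c * c <= 1) by nra; simpl in Hc; lra.
    - assert (4 <= c * c) by nra; assert (8 <= c * c * c) by nra; simpl in Hc; lra. }
  assert (Hq : 0 < 2 + 2 * c - c ^ 2) by nra.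
  assert (ED : 1 / 3 * (c - 1) ^ 4 + 1 = 2 * c ^ 2 - 4).
  { transitivity ((c ^ 3 * (c - 4) + 6 * c ^ 2 - 4 * c + 1) / 3 + 1); [field|]; rewrite Hc; field. }
  assert (ER : 1 - 8 * ((1 - c) / (2 + c)) ^ 3 = 3 * (2 + 2 * c - c ^ 2) / (2 + 2 * c + c ^ 2)).
  { transitivity ((36 * c - 18 * c ^ 2 + 9 * c ^ 3) / (8 + 12 * c + 6 * c ^ 2 + c ^ 3)); [field; split; nra|].
    rewrite Hc; field; nra. }
  rewrite ED in *; rewrite ER.
  assert (E : (1 - 9 / (3 * (2 + 2 * c - c ^ 2) / (2 + 2 * c + c ^ 2))) / 8 - - / (2 * c ^ 2 - 4)
     = - ((c ^ 3 - 4) * (c + 1)) / (2 * (2 * c ^ 2 - 4) * (2 + 2 * c - c ^ 2)) * 2) by (field; nra).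
  rewrite Hc in E; replace ((4 - 4) * (c + 1)) with 0 in E by ring; unfold Rdiv in E at 4; lra.
Qed.

(** * The Jacobi triple product *)

Definition gterm (y z : R) (s : Z) : R := powerRZ z s * exp (- (y * IZR s ^ 2)).

(** Summand of the finite form of Jacobi's identity: with q = exp (- y) and up to the factor (q^2;
    q^2)_(2N), a q-binomial coefficient times q^(s^2) z^s. *)
Definition jterm (y z : R) (N : nat) (s : Z) : R :=
  gterm y z s * iqev (exp (- y)) (Z.of_nat N - s) * iqev (exp (- y)) (Z.of_nat N + s).

Definition jfactor (y z : R) (i : nat) : R :=
  (1 + z * exp (- y) ^ (2 * i + 1)) * (1 + exp (- y) ^ (2 * i + 1) / z).

Lemma gterm_shift y z s : z <> 0 ->
  z * gterm y z (s - 1) = powerRZ z s * exp (- (y * IZR (s - 1) ^ 2)) /\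
  gterm y z (s + 1) / z = powerRZ z s * exp (- (y * IZR (s + 1) ^ 2)).
Proof.
  intros Hz; unfold gterm; replace s with (s - 1 + 1)%Z at 3 by lia.
  rewrite (powerRZ_add z (s - 1)), (powerRZ_add z s) by assumption; rewrite powerRZ_1; 
  split; field; assumption.
Qed.

(** Telescoping certificate in s for the step from N to N + 1. For |s| <= N + 1 all reciprocals are
    expressed through those at d = N + 1 - s and e = N + 1 + s; beyond, every term vanishes. *)
Lemma jterm_step y z N s : 0 < y -> z <> 0 ->
  (1 - exp (- y) ^ (2 * (2 * N + 1))) * (1 - exp (- y) ^ (2 * (2 * N + 2))) * jterm y z (S N) s
   - jfactor y z N * jterm y z N s =
  exp (- y) ^ (2 * N + 1) * ((z * jterm y z N (s - 1) - jterm y z N s / z) -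
    (z * jterm y z N s - jterm y z N (s + 1) / z)).
Proof.
  intros Hy Hz; pose proof (exp_neg_bounds y Hy) as Hr; unfold jterm, jfactor.
  destruct (gterm_shift y z s Hz) as [G1 G2].
  assert (M1 : forall a b c, z * (a * b * c) = z * a * b * c) by (intros; ring).
  assert (M2 : forall a b c, a * b * c / z = a / z * b * c) by (intros; field; assumption).
  rewrite (M1 (gterm y z (s - 1))), (M2 (gterm y z (s + 1))); clear M1 M2.
  rewrite G1, G2; clear G1 G2; unfold gterm.
  destruct (Z_le_gt_dec (Z.abs s) (Z.of_nat (S N))) as [H|H].
  - destruct (Z_of_nat_complete (Z.of_nat (S N) - s)) as [d Ed]; [lia|].
    destruct (Z_of_nat_complete (Z.of_nat (S N) + s)) as [e Ee]; [lia|].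
    rewrite Ed, Ee.
    replace (Z.of_nat N - (s - 1))%Z with (Z.of_nat d) by lia.
    replace (Z.of_nat N - (s + 1))%Z with (Z.of_nat d - 1 - 1)%Z by lia.
    replace (Z.of_nat N - s)%Z with (Z.of_nat d - 1)%Z by lia.
    replace (Z.of_nat N + (s + 1))%Z with (Z.of_nat e) by lia.
    replace (Z.of_nat N + (s - 1))%Z with (Z.of_nat e - 1 - 1)%Z by lia.
    replace (Z.of_nat N + s)%Z with (Z.of_nat e - 1)%Z by lia.
    assert (HP : forall k, iqev (exp (- y)) (Z.of_nat k - 1 - 1) =
       iqev (exp (- y)) (Z.of_nat k) * (1 - exp (- y) ^ (2 * k)) * (1 - exp (- y) ^ (2 * k) / exp (- y) ^ 2)).
    { intros [|k].
      - rewrite iqev_neg by lia; simpl; ring.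
      - rewrite <- iqev_pred by assumption.
        replace (Z.of_nat (S k) - 1)%Z with (Z.of_nat k) by lia.
        rewrite iqev_pred by assumption; f_equal; f_equal.
        replace (2 * S k)%nat with (2 * k + 2)%nat by lia; rewrite pow_add.
        field; apply Rgt_not_eq, exp_pos. }
    rewrite !HP, !iqev_pred by assumption; clear HP.
    set (a := iqev (exp (- y)) (Z.of_nat d)); set (b := iqev (exp (- y)) (Z.of_nat e)).
    (* Exponents: (2N + 1) + (s - 1)^2 = s^2 + 2d, and symmetrically with e below. *)
    assert (E1 : exp (- y) ^ (2 * N + 1) * exp (- (y * IZR (s - 1) ^ 2)) =
       exp (- (y * IZR s ^ 2)) * exp (- y) ^ (2 * d)).
    { rewrite !exp_pow, <- !exp_plus; f_equal; rewrite minus_IZR.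
      assert (Ed' : INR d = INR N + 1 - IZR s)
        by (rewrite INR_IZR_INZ, <- Ed, minus_IZR, <- INR_IZR_INZ, S_INR; reflexivity).
      rewrite plus_INR, !mult_INR, Ed'; simpl (INR 2); simpl (INR 1); ring. }
    assert (E2 : exp (- y) ^ (2 * N + 1) * exp (- (y * IZR (s + 1) ^ 2)) =
       exp (- (y * IZR s ^ 2)) * exp (- y) ^ (2 * e)).
    { rewrite !exp_pow, <- !exp_plus; f_equal; rewrite plus_IZR.
      assert (Ee' : INR e = INR N + 1 + IZR s)
        by (rewrite INR_IZR_INZ, <- Ee, plus_IZR, <- INR_IZR_INZ, S_INR; reflexivity).
      rewrite plus_INR, !mult_INR, Ee'; simpl (INR 2); simpl (INR 1); ring. }
    (* d + e = 2N + 2 ties the two powers to [x]; the rest is algebra modulo this relation. *)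
    assert (E3 : exp (- y) ^ (2 * d) * exp (- y) ^ (2 * e) = (exp (- y) ^ (2 * N + 1)) ^ 2 * exp (- y) ^ 2).
    { rewrite <- !pow_mult, <- !pow_add; f_equal; lia. }
    replace (exp (- y) ^ (2 * (2 * N + 1))) with ((exp (- y) ^ (2 * N + 1)) ^ 2)
      by (rewrite <- pow_mult; f_equal; lia).
    replace (exp (- y) ^ (2 * (2 * N + 2))) with ((exp (- y) ^ (2 * N + 1)) ^ 2 * exp (- y) ^ 2)
      by (rewrite <- pow_mult, <- pow_add; f_equal; lia).
    assert (Hr0 : exp (- y) <> 0) by (apply Rgt_not_eq, exp_pos).
    set (r := exp (- y)) in *; set (x := r ^ (2 * N + 1)) in *.
    set (Dm := r ^ (2 * d)) in *; set (Dp := r ^ (2 * e)) in *; set (Q := exp (- (y * IZR s ^ 2))) in *.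
    set (Q1 := exp (- (y * IZR (s - 1) ^ 2))) in *; set (Q2 := exp (- (y * IZR (s + 1) ^ 2))) in *.
    set (u := powerRZ z s).
    transitivity (x * Q1 * u * a * (b * (1 - Dp) * (1 - Dp / r ^ 2)) +
      x * Q2 * u * (a * (1 - Dm) * (1 - Dm / r ^ 2)) * b
      - x * (z + / z) * (u * Q * (a * (1 - Dm)) * (b * (1 - Dp)))); [|field; repeat split; assumption].
    rewrite E1, E2.
    assert (E4 : Dm * Dp / r ^ 2 = x ^ 2) by (rewrite E3; field; repeat split; assumption).
    transitivity (u * Q * a * b * (Dm + Dp - 2 * (Dm * Dp) - 2 * (Dm * Dp / r ^ 2)
       + (Dm * Dp / r ^ 2) * (Dm + Dp)) - x * (z + / z) * (u * Q * (a * (1 - Dm)) * (b * (1 - Dp))));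
      [|field; repeat split; assumption].
    rewrite E4, E3.
    transitivity (u * Q * a * b * ((1 - x ^ 2) * (1 - x ^ 2 * r ^ 2)
       - (1 + x ^ 2) * (1 - Dm - Dp + Dm * Dp)) - x * (z + / z) * (u * Q * (a * (1 - Dm)) * (b * (1 - Dp))));
      [field; repeat split; assumption|rewrite E3; ring].
  - assert (C : (s < - Z.of_nat (S N) \/ Z.of_nat (S N) < s)%Z) by lia.
    destruct C as [C|C].
    + rewrite (iqev_neg _ (Z.of_nat (S N) + s)), (iqev_neg _ (Z.of_nat N + s)),
       (iqev_neg _ (Z.of_nat N + (s - 1))), (iqev_neg _ (Z.of_nat N + (s + 1))) by lia;
        field; assumption.
    + rewrite (iqev_neg _ (Z.of_nat (S N) - s)), (iqev_neg _ (Z.of_nat N - s)),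
       (iqev_neg _ (Z.of_nat N - (s - 1))), (iqev_neg _ (Z.of_nat N - (s + 1))) by lia;
        field; assumption.
Qed.

Lemma zpair_telescoping (f Y : Z -> R) N :
  (forall s, f s = Y s - Y (s + 1)%Z) ->
  (forall s, (Z.of_nat N < Z.abs s)%Z -> Y s = 0) -> Series (zpair f) = 0.
Proof.
  intros Hf HY; apply is_series_unique; change (is_lim_seq (sum_n (zpair f)) 0).
  assert (H : forall n, sum_n (zpair f) n = Y (- Z.of_nat n)%Z - Y (Z.of_nat (S n)) :> R).
  { induction n as [|n IH]; [rewrite sum_O; simpl zpair; rewrite Hf; reflexivity|].
    rewrite sum_Sn_R, IH; cbn [zpair]; rewrite !Hf.
    replace (- Z.of_nat (S n) + 1)%Z with (- Z.of_nat n)%Z by lia.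
    replace (Z.of_nat (S n) + 1)%Z with (Z.of_nat (S (S n))) by lia; ring. }
  apply (is_lim_seq_ext_loc (fun _ => 0)); [|apply is_lim_seq_const].
  exists (S N); intros n Hn; rewrite H, !HY by lia; ring.
Qed.

Lemma jterm_0 y z N s : (Z.of_nat N < Z.abs s)%Z -> jterm y z N s = 0.
Proof.
  intros H; unfold jterm; assert (C : (s < - Z.of_nat N \/ Z.of_nat N < s)%Z) by lia.
  destruct C; [rewrite (iqev_neg _ (_ + _)) by lia|rewrite (iqev_neg _ (_ - _)) by lia]; ring.
Qed.

Lemma ex_series_jterm y z N : ex_series (zpair (jterm y z N)).
Proof.
  apply (ex_series_eventually_0 _ (S N)); intros [|n] Hn; [lia|].
  cbn [zpair]; rewrite !jterm_0 by lia; ring.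
Qed.

Lemma finite_triple_product y z N : 0 < y -> z <> 0 ->
  prodn (jfactor y z) N = qev (exp (- y)) (2 * N) * Series (zpair (jterm y z N)).
Proof.
  intros Hy Hz; pose proof (exp_neg_bounds y Hy) as Hr; induction N as [|N IH].
  - rewrite (is_series_unique _ _ (zseries_single (jterm y z 0) 0
      ltac:(intros s Hs; apply jterm_0; lia))).
    assert (Hi : iqev (exp (- y)) 0 = 1)
      by (change 0%Z with (Z.of_nat 0); rewrite iqev_nat; unfold qev; simpl; field).
    unfold jterm, gterm; change (Z.of_nat 0 - 0)%Z with 0%Z; change (Z.of_nat 0 + 0)%Z with 0%Z.
    rewrite Hi; unfold qev; simpl; replace (- (y * (0 * (0 * 1)))) with 0 by ring; rewrite exp_0; field.
  - replace (2 * S N)%nat with (S (S (2 * N))) by lia; rewrite !qev_S.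
    cbn [prodn]; rewrite IH.
    assert (H : Series (zpair (fun s => (1 - exp (- y) ^ (2 * (2 * N + 1))) * (1 - exp (- y) ^ (2 * (2 * N + 2))) * jterm y z (S N) s
   - jfactor y z N * jterm y z N s)) = 0).
    { apply (zpair_telescoping _ (fun s => exp (- y) ^ (2 * N + 1) * (z * jterm y z N (s - 1) - jterm y z N s / z)) (S N)).
      - intros s; rewrite jterm_step by assumption.
        replace (s + 1 - 1)%Z with s by lia; ring.
      - intros s Hs; rewrite !jterm_0 by lia;
        field; assumption. }
    rewrite (Series_ext _ (fun n => (1 - exp (- y) ^ (2 * (2 * N + 1))) * (1 - exp (- y) ^ (2 * (2 * N + 2)))
       * zpair (jterm y z (S N)) n - jfactor y z N * zpair (jterm y z N) n)) in H
      by (intros [|n]; cbn [zpair]; ring).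
    rewrite Series_minus, !Series_scal_l in H by (apply ex_series_scal_R, ex_series_jterm).
    replace (S (2 * N) + 1)%nat with (2 * N + 2)%nat by lia.
    rewrite Rmult_assoc, (Rmult_comm (Series _)), <- (Rminus_diag_uniq _ _ H); ring.
Qed.

Lemma Rabs_powerRZ z s : Rabs (powerRZ z s) = powerRZ (Rabs z) s.
Proof. destruct s; simpl; [apply Rabs_R1|now rewrite RPow_abs|now rewrite Rabs_inv, RPow_abs]. Qed.

(** Completing the square: s a - y s^2 / 2 <= a^2 / (2y) with a = ln |z|; half of y pays for the
    power of z, whatever its sign. *)
Lemma gterm_bound y z : 0 < y -> z <> 0 -> exists C, 0 <= C /\
  forall s, Rabs (gterm y z s) <= C * exp (- (y / 2 * IZR s ^ 2)).
Proof.
  intros Hy Hz; pose (a := ln (Rabs z)); exists (exp (a ^ 2 / (2 * y))).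
  split; [left; apply exp_pos|]; intros s; unfold gterm.
  assert (Hz' : 0 < Rabs z) by now apply Rabs_pos_lt.
  assert (HZ : Rabs (powerRZ z s) = exp (IZR s * a)).
  { rewrite Rabs_powerRZ, powerRZ_Rpower by assumption; reflexivity. }
  rewrite Rabs_mult, HZ, (Rabs_right (exp _)) by (left; apply exp_pos).
  rewrite <- !exp_plus; apply exp_le.
  assert (E : a ^ 2 / (2 * y) + - (y / 2 * IZR s ^ 2) - (IZR s * a + - (y * IZR s ^ 2))
    = (a - y * IZR s) ^ 2 / (2 * y)) by (field; lra).
  assert (0 <= (a - y * IZR s) ^ 2 / (2 * y))
    by (apply Rmult_le_pos; [apply pow2_ge_0|left; apply Rinv_0_lt_compat; lra]).
  lra.
Qed.

Definition qev_lim (y : R) : R := real (Lim_seq (qev (exp (- y)))).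

Lemma qev_lim_correct y : 0 < y -> 0 < qev_lim y /\ is_lim_seq (qev (exp (- y))) (qev_lim y).
Proof.
  intros Hy; destruct (qev_cvg _ (exp_neg_bounds y Hy)) as (l & Hl & HL & _).
  unfold qev_lim; rewrite (is_lim_seq_unique _ _ HL); now split.
Qed.

(** Limit of the finite form: each reciprocal tends to 1 / P and the prefactor to P. The sum stays
    existential, to be identified for each z. *)
Lemma triple_product y z : 0 < y -> z <> 0 ->
  exists s, zseries (gterm y z) s /\ is_lim_seq (prodn (jfactor y z)) (s / qev_lim y).
Proof.
  intros Hy Hz; pose proof (exp_neg_bounds y Hy) as Hr.
  destruct (qev_lim_correct y Hy) as [HP HPl]; set (P := qev_lim y) in *.
  destruct (gterm_bound y z Hy Hz) as (C & HC & HB).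
  destruct (iqev_bound _ Hr) as (D & HD & HDb).
  assert (Hiq : forall s : Z, is_lim_seq (fun N => iqev (exp (- y)) (Z.of_nat N + s)) (/ P)).
  { intros s; apply (is_lim_seq_incr_n _ (Z.abs_nat s)).
    apply (is_lim_seq_ext (fun N => / qev (exp (- y)) (N + Z.to_nat (Z.abs s + s)))).
    - intros N; rewrite <- iqev_nat; f_equal; lia.
    - apply (is_lim_seq_incr_n (fun N => / qev (exp (- y)) N)).
      apply (is_lim_seq_inv _ P HPl); injection; lra. }
  destruct (tannery (fun N => zpair (jterm y z N))
    (fun n => C * (D * D) * (two_sided n * exp (- (y / 2 * INR n ^ 2))))
    (zpair (fun s => gterm y z s * / P * / P))) as [Ec L].
  - assert (Hs : forall s, is_lim_seq (fun N => jterm y z N s) (gterm y z s * / P * / P)).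
    { intros s; unfold jterm; apply is_lim_seq_mult'; [|apply Hiq].
      apply is_lim_seq_mult'; [apply is_lim_seq_const|].
      apply (is_lim_seq_ext (fun N => iqev (exp (- y)) (Z.of_nat N + - s)));
        [intros N; f_equal; lia|apply Hiq]. }
    intros [|n]; cbn [zpair]; [apply Hs|apply is_lim_seq_plus'; apply Hs].
  - assert (Hj : forall N s, Rabs (jterm y z N s) <= C * (D * D) * exp (- (y / 2 * IZR s ^ 2))).
    { intros N s; unfold jterm; rewrite !Rabs_mult.
      pose proof (HDb (Z.of_nat N - s)%Z); pose proof (HDb (Z.of_nat N + s)%Z).
      rewrite (Rabs_right (iqev _ (Z.of_nat N - s))), (Rabs_right (iqev _ (Z.of_nat N + s))) by lra.
      replace (C * (D * D) * exp (- (y / 2 * IZR s ^ 2)))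
        with (C * exp (- (y / 2 * IZR s ^ 2)) * D * D) by ring.
      pose proof (Rabs_pos (gterm y z s)); pose proof (HB s).
      apply Rmult_le_compat; [apply Rmult_le_pos; lra|lra| |lra].
      apply Rmult_le_compat; lra. }
    intros N [|n]; cbn [zpair two_sided].
    + eapply Rle_trans; [apply Hj|]; rewrite Rmult_1_l; right; reflexivity.
    + eapply Rle_trans; [apply Rabs_triang|].
      pose proof (Hj N (Z.of_nat (S n))) as H1; pose proof (Hj N (- Z.of_nat (S n))%Z) as H2.
      rewrite opp_IZR in H2; rewrite <- INR_IZR_INZ in H1, H2.
      replace ((- INR (S n)) ^ 2) with (INR (S n) ^ 2) in H2 by ring; lra.
  - apply ex_series_scal_R, ex_series_gauss; lra.
  - exists (Series (zpair (gterm y z))); split.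
    + apply Series_correct; eapply ex_series_ext;
        [|apply (ex_series_scal_R (P * P) _ Ec)].
      intros n; match goal with |- ?a = ?b => change (a = b :> R) end.
      destruct n as [|n]; cbn [zpair]; field; lra.
    + apply (is_lim_seq_ext (fun N => qev (exp (- y)) (2 * N) * Series (zpair (jterm y z N))));
        [intros N; now rewrite finite_triple_product|].
      replace (Series (zpair (gterm y z)) / P)
        with (P * Series (zpair (fun s => gterm y z s * / P * / P))).
      * apply is_lim_seq_mult'; [|exact L].
        apply (is_lim_seq_subseq (qev (exp (- y)))); [|exact HPl].
        intros Q [N HN]; exists N; intros n Hn; apply HN; lia.
      * rewrite <- Series_scal_l; unfold Rdiv; rewrite <- Series_scal_r; apply Series_ext.
        intros [|n]; cbn [zpair]; field; lra.
Qed.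

(** * Product formulas and Weber's function *)

Lemma lim_seq_unique (u : nat -> R) (a b : R) : is_lim_seq u a -> is_lim_seq u b -> a = b.
Proof.
  intros Ha Hb; apply is_lim_seq_unique in Ha; apply is_lim_seq_unique in Hb.
  rewrite Ha in Hb; now injection Hb.
Qed.

Lemma prodn_group d f N :
  prodn f (d * N) = prodn (fun i => prodn (fun j => f (d * i + j)%nat) d) N.
Proof.
  assert (H : forall a b, prodn f (a + b) = prodn f a * prodn (fun j => f (a + j)%nat) b).
  { intros a b; induction b as [|b IH]; [rewrite Nat.add_0_r; simpl; ring|].
    rewrite Nat.add_succ_r; simpl; rewrite IH; ring. }
  induction N as [|N IH]; [now rewrite Nat.mul_0_r|].
  replace (d * S N)%nat with (d * N + d)%nat by lia; now rewrite H, IH.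
Qed.

Lemma lim_seq_mul_index (u : nat -> R) (l : Rbar) d : (0 < d)%nat ->
  is_lim_seq u l -> is_lim_seq (fun n => u (d * n)%nat) l.
Proof.
  intros Hd; apply is_lim_seq_subseq; intros Q [N HN]; exists N; intros n Hn; apply HN; nia.
Qed.

Definition chi (y : R) : R := real (Lim_seq (prodn (fun i => 1 + exp (- y) ^ (2 * i + 1)))).

Lemma chi_correct y : 0 < y ->
  1 <= chi y /\ is_lim_seq (prodn (fun i => 1 + exp (- y) ^ (2 * i + 1))) (chi y).
Proof.
  intros Hy; pose proof (exp_neg_bounds y Hy) as Hr.
  destruct (prodn_cvg_incr (fun i => exp (- y) ^ (2 * i + 1))) as (l & HL & HB).
  - intros n; pose proof (pow_bounds _ (2 * n + 1) Hr); lra.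
  - apply ex_series_pow_le; [assumption|intros; lia].
  - unfold chi; rewrite (is_lim_seq_unique _ _ HL); specialize (HB 0%nat); simpl; split; [lra|exact HL].
Qed.

(** In (q^2; q^2)_(2n) the factors 1 - q^(2(2i+1)) and 1 - q^(4(i+1)) split as differences of
    squares; in the limit (q^2; q^2) cancels. *)
Lemma euler_product y K Q : 0 < y ->
  is_lim_seq (qodd (exp (- y)) 0) (Finite K) -> is_lim_seq (qevp (exp (- y))) (Finite Q) ->
  chi y * K * Q = 1.
Proof.
  intros Hy HK HQ; pose proof (exp_neg_bounds y Hy) as Hr.
  destruct (qev_lim_correct y Hy) as [HP HPl]; destruct (chi_correct y Hy) as [HX HXl].
  assert (E : chi y * K * (qev_lim y * Q) = qev_lim y).
  { apply (lim_seq_unique (fun n => qev (exp (- y)) (2 * n))); [|apply lim_seq_mul_index; [lia|assumption]].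
    apply (is_lim_seq_ext (fun n => prodn (fun i => 1 + exp (- y) ^ (2 * i + 1)) n * qodd (exp (- y)) 0 n *
      (qev (exp (- y)) n * qevp (exp (- y)) n))).
    - intros n; unfold qev at 2; rewrite prodn_group; unfold qodd, qev, qevp; rewrite <- !prodn_mult.
      apply prodn_ext; intros i; cbn [prodn]; rewrite Nat.add_0_l.
      replace (2 * (2 * i + 0 + 1))%nat with ((2 * i + 1) + (2 * i + 1))%nat by lia.
      replace (2 * (2 * i + 1 + 1))%nat with (2 * (i + 1) + 2 * (i + 1))%nat by lia.
      rewrite !(pow_add _ (2 * i + 1) (2 * i + 1)), (pow_add _ (2 * (i + 1)) (2 * (i + 1))); ring.
    - repeat apply is_lim_seq_mult'; assumption. }
  apply (Rmult_eq_reg_l (qev_lim y)); [|lra]; lra.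
Qed.

Lemma theta_product y : 0 < y -> theta y = qev_lim y * chi y ^ 2.
Proof.
  intros Hy; destruct (triple_product y 1 Hy R1_neq_R0) as (s & Hs & HL).
  destruct (qev_lim_correct y Hy) as [HP HPl]; destruct (chi_correct y Hy) as [HX HXl].
  assert (E : s = theta y).
  { apply (is_sum_unique (fun n : Z => exp (- (y * IZR n ^ 2)))); [|now apply theta_is_sum].
    apply (is_sum_ext (gterm y 1)).
    - intros n; unfold gterm; rewrite powerRZ_R1; ring.
    - apply zseries_is_sum; [|assumption].
      intros n; unfold gterm; rewrite powerRZ_R1, Rmult_1_l; left; apply exp_pos. }
  rewrite E in HL.
  assert (HX2 : theta y / qev_lim y = chi y * chi y).
  { apply (lim_seq_unique _ _ _ HL).
    apply (is_lim_seq_ext (fun n => prodn (fun i => 1 + exp (- y) ^ (2 * i + 1)) n *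
       prodn (fun i => 1 + exp (- y) ^ (2 * i + 1)) n)).
    - intros n; rewrite <- prodn_mult; apply prodn_ext; intros i; unfold jfactor; field.
    - now apply is_lim_seq_mult'. }
  transitivity (qev_lim y * (theta y / qev_lim y)); [field; lra|rewrite HX2; ring].
Qed.

(** * Jacobi's companion theta functions *)

Lemma theta_even_part y : 0 < y ->
  is_sum (fun n : Z => exp (- (y * IZR n ^ 2)) + powerRZ (-1) n * exp (- (y * IZR n ^ 2)))
    (2 * theta (4 * y)).
Proof.
  intros Hy.
  assert (He : forall k, powerRZ (-1) (2 * k) = 1).
  { intros k; destruct k as [|p|p]; simpl; rewrite ?Pos2Nat.inj_xO, ?pow_m1_even; try reflexivity.
    apply Rinv_1. }
  apply (is_sum_inj (fun n => 2 * n)%Z).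
  - intros; lia.
  - intros n Hn; destruct (Z.Even_or_Odd n) as [[k ->]|[k ->]]; [now exists k|exfalso; apply Hn].
    rewrite powerRZ_add, He, powerRZ_1 by lra; ring.
  - apply (is_sum_ext (fun n : Z => 2 * exp (- (4 * y * IZR n ^ 2)))).
    + intros n; rewrite He, mult_IZR.
      replace (y * (2 * IZR n) ^ 2) with (4 * y * IZR n ^ 2) by ring; ring.
    + apply is_sum_scal; [lra|]; apply theta_is_sum; lra.
Qed.

(** The sums of (-1)^n exp (- y n^2) and, next, of exp (- y (n + 1/2)^2), expressed by [theta] so
    that its transformation carries over. *)
Definition theta4 (y : R) : R := 2 * theta (4 * y) - theta y.
Definition theta2 (y : R) : R := theta (y / 4) - theta y.

Lemma theta4_product y K : 0 < y -> is_lim_seq (qodd (exp (- y)) 0) (Finite K) ->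
  theta4 y = qev_lim y * K ^ 2.
Proof.
  intros Hy HK; assert (Hm1 : -1 <> 0) by lra.
  destruct (triple_product y (-1) Hy Hm1) as (s & Hs & HL).
  destruct (qev_lim_correct y Hy) as [HP HPl].
  assert (E : s = theta4 y).
  { assert (H : theta y + s = 2 * theta (4 * y)); [|unfold theta4; lra].
    refine (is_sum_unique _ _ _ _ (theta_even_part y Hy)).
    assert (Habs : forall n, -1 <= powerRZ (-1) n <= 1).
    { intros n; apply Rabs_le_between; rewrite Rabs_powerRZ, Rabs_left by lra.
      replace (- -1) with 1 by ring; rewrite powerRZ_R1; lra. }
    apply zseries_is_sum.
    - intros n; specialize (Habs n); pose proof (exp_pos (- (y * IZR n ^ 2))); nra.
    - unfold zseries; eapply is_series_ext;
        [|exact (is_series_plus _ _ _ _ (theta_zseries y Hy) Hs)].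
      intros [|n]; unfold gterm, plus; simpl; ring. }
  rewrite E in HL.
  assert (HX2 : theta4 y / qev_lim y = K * K).
  { apply (lim_seq_unique _ _ _ HL).
    apply (is_lim_seq_ext (fun n => qodd (exp (- y)) 0 n * qodd (exp (- y)) 0 n)).
    - intros n; unfold qodd; rewrite <- prodn_mult; apply prodn_ext; intros i; unfold jfactor; simpl (0 + i)%nat; field.
    - now apply is_lim_seq_mult'. }
  transitivity (qev_lim y * (theta4 y / qev_lim y)); [field; lra|rewrite HX2; ring].
Qed.

Lemma exp_IZR_pow y n : exp (- (INR n * y)) = exp (- y) ^ n.
Proof. rewrite exp_pow; f_equal; ring. Qed.

(** Triple product with q^d for q and z = q^(2c), as d n^2 + 2 c n = ((d n + c)^2 - c^2) / d. The
    condition 2c <= d makes the subtraction in the second exponent genuine. *)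
Lemma coset_product y d c : 0 < y -> (0 < d)%nat -> (2 * c <= d)%nat ->
  is_lim_seq (prodn (fun i => (1 + exp (- y) ^ (2 * d * i + d + 2 * c)) *
      (1 + exp (- y) ^ (2 * d * i + (d - 2 * c)))))
    (coset_sum (y / INR d) (Z.of_nat d) (Z.of_nat c) * exp (y * INR c ^ 2 / INR d) / qev_lim (INR d * y)).
Proof.
  intros Hy Hd Hc; assert (HdR : 0 < INR d) by now apply lt_0_INR.
  assert (HY : 0 < INR d * y) by nra.
  pose (z := exp (- y) ^ (2 * c)); assert (Hz : z <> 0) by (apply pow_nonzero, Rgt_not_eq, exp_pos).
  destruct (triple_product (INR d * y) z HY Hz) as (s & Hs & HL).
  assert (Hg : forall n, gterm (INR d * y) z n =
    exp (y * INR c ^ 2 / INR d) * exp (- (y / INR d * IZR (Z.of_nat d * n + Z.of_nat c) ^ 2))).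
  { intros n; unfold gterm, z; rewrite powerRZ_Rpower by (apply pow_lt, exp_pos).
    rewrite exp_pow; unfold Rpower; rewrite ln_exp, <- !exp_plus; f_equal.
    rewrite plus_IZR, mult_IZR, <- !INR_IZR_INZ, mult_INR; simpl (INR 2); field; lra. }
  assert (E : s = coset_sum (y / INR d) (Z.of_nat d) (Z.of_nat c) * exp (y * INR c ^ 2 / INR d)).
  { apply (is_sum_unique (gterm (INR d * y) z)).
    - apply zseries_is_sum; [|assumption].
      intros n; rewrite Hg; apply Rmult_le_pos; left; apply exp_pos.
    - rewrite (Rmult_comm (coset_sum _ _ _)).
      apply (is_sum_ext (fun n : Z => exp (y * INR c ^ 2 / INR d) *
        exp (- (y / INR d * IZR (Z.of_nat d * n + Z.of_nat c) ^ 2)))); [intros n; symmetry; apply Hg|].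
      apply is_sum_scal; [left; apply exp_pos|].
      apply coset_sum_is_sum; [apply Rdiv_lt_0_compat; assumption|lia]. }
  rewrite <- E; refine (is_lim_seq_ext _ _ _ _ HL); intros n; apply prodn_ext; intros i.
  unfold jfactor, z; rewrite exp_IZR_pow, <- pow_mult; f_equal; f_equal.
  - rewrite <- pow_add; f_equal; nia.
  - replace (d * (2 * i + 1))%nat with (2 * c + (2 * d * i + (d - 2 * c)))%nat by nia.
    rewrite pow_add; field; apply pow_nonzero, Rgt_not_eq, exp_pos.
Qed.

Lemma theta_split2 y : 0 < y -> theta y = theta (4 * y) + coset_sum y 2 1.
Proof.
  intros Hy.
  apply (is_sum_unique _ _ _ (theta_is_sum y Hy)).
  replace (theta (4 * y) + coset_sum y 2 1) with (fsum (coset_sum y 2) (0 :: 1 :: nil)%Z).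
  2:{ simpl; rewrite coset_sum_0 by (lia || assumption).
      replace (y * 2 ^ 2) with (4 * y) by ring; ring. }
  apply (is_sum_cover _ (fun c n => 2 * n + c)%Z).
  - repeat constructor; cbn [In]; lia.
  - intros; left; apply exp_pos.
  - intros b _; destruct (Z.Even_or_Odd b) as [[k ->]|[k ->]];
      [exists 0%Z, k|exists 1%Z, k]; cbn [In]; lia.
  - cbn [In]; lia.
  - intros c _; apply coset_sum_is_sum; [assumption|lia].
Qed.

Lemma theta2_product y Q : 0 < y -> is_lim_seq (qevp (exp (- y))) (Finite Q) ->
  theta2 y = 2 * exp (- (y / 4)) * qev_lim y * Q ^ 2.
Proof.
  intros Hy HQ; destruct (qev_lim_correct y Hy) as [HP HPl].
  assert (E : theta2 y = coset_sum (y / 4) 2 1).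
  { unfold theta2; rewrite (theta_split2 (y / 4)) by lra; replace (4 * (y / 4)) with y by field; ring. }
  pose proof (coset_product (y / 2) 2 1 ltac:(lra) ltac:(lia) ltac:(lia)) as HL.
  simpl INR in HL; replace ((1 + 1) * (y / 2)) with y in HL by field.
  replace (y / 2 / (1 + 1)) with (y / 4) in HL by field.
  replace (y / 2 * 1 ^ 2 / (1 + 1)) with (y / 4) in HL by field.
  change (Z.of_nat 2) with 2%Z in HL; change (Z.of_nat 1) with 1%Z in HL; rewrite <- E in HL.
  assert (H : theta2 y * exp (y / 4) / qev_lim y = 2 * (Q * Q)).
  { apply (is_lim_seq_incr_1 _ _) in HL; apply (lim_seq_unique _ _ _ HL).
    apply (is_lim_seq_ext (fun n => 2 * (qevp (exp (- y)) (S n) * qevp (exp (- y)) n))).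
    - intros n; rewrite prodn_mult, (prodn_shift (fun i => 1 + exp (- (y / 2)) ^ (2 * 2 * i + (2 - 2 * 1)))).
      assert (Hp : forall k, exp (- (y / 2)) ^ (2 * k) = exp (- y) ^ k)
        by (intros k; rewrite pow_mult, !exp_pow; f_equal; simpl (INR 2); field).
      rewrite (prodn_ext _ (fun i => 1 + exp (- y) ^ (2 * (i + 1))) (S n)).
      2:{ intros i; rewrite <- Hp; do 2 f_equal; lia. }
      rewrite (prodn_ext _ (fun i => 1 + exp (- y) ^ (2 * (i + 1))) n).
      2:{ intros i; rewrite <- Hp; do 2 f_equal; lia. }
      unfold qevp; simpl (2 * 2 * 0 + _)%nat; simpl (_ ^ 0); ring.
    - apply is_lim_seq_mult'; [apply is_lim_seq_const|].
      apply is_lim_seq_mult'; [|assumption]; now apply (is_lim_seq_incr_1 (qevp (exp (- y)))). }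
  assert (He : exp (y / 4) * exp (- (y / 4)) = 1)
    by (rewrite <- exp_plus, <- exp_0; f_equal; ring).
  transitivity (theta2 y * exp (y / 4) / qev_lim y * qev_lim y * exp (- (y / 4))).
  - transitivity (theta2 y * (exp (y / 4) * exp (- (y / 4)))); [rewrite He; ring|field; lra].
  - rewrite H; ring.
Qed.

(* q^(-1/24) times the product of 1 + q^(2i+1). *)
Definition weber (y : R) : R := exp (y / 24) * chi y.

Lemma weber_pos y : 0 < y -> 0 < weber y.
Proof.
  intros Hy; apply Rmult_lt_0_compat; [apply exp_pos|]; destruct (chi_correct y Hy); lra.
Qed.

(** Expresses [weber] through functions whose behaviour under y -> pi^2/y is known; Euler's product
    removes [K] and [Q]. *)
Lemma weber_theta y : 0 < y -> weber y ^ 6 * (theta2 y * theta4 y) = 2 * theta y ^ 2 /\ 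
  theta2 y * theta4 y <> 0.
Proof.
  intros Hy; pose proof (exp_neg_bounds y Hy) as Hr.
  destruct (qodd_cvg _ 0 Hr) as (K & HK0 & HK & _).
  destruct (qevp_cvg _ Hr) as (Q & HQ & HQ1); specialize (HQ1 0%nat).
  destruct (qev_lim_correct y Hy) as [HP _].
  rewrite (theta4_product y K Hy HK), (theta2_product y Q Hy HQ), (theta_product y Hy).
  pose proof (euler_product y K Q Hy HK HQ) as HE.
  assert (He : exp (y / 24) ^ 6 * exp (- (y / 4)) = 1)
    by (rewrite exp_pow, <- exp_plus, <- exp_0; f_equal; simpl (INR 6); field).
  unfold weber; split.
  - transitivity (2 * (exp (y / 24) ^ 6 * exp (- (y / 4))) * qev_lim y ^ 2 * chi y ^ 4 *
      (chi y * K * Q) ^ 2); [ring|rewrite He, HE; ring].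
  - pose proof (exp_pos (- (y / 4))).
    apply Rgt_not_eq; repeat apply Rmult_lt_0_compat; try apply pow_lt; lra.
Qed.

(** The inversion turns 4y into y / 4, so it exchanges the two functions. *)
Lemma theta2_transform t : 0 < t ->
  theta2 (PI / t) = sqrt t * theta4 (PI * t) /\ theta4 (PI / t) = sqrt t * theta2 (PI * t).
Proof.
  intros Ht; unfold theta2, theta4; split.
  - replace (PI / t / 4) with (PI / (4 * t)) by (field; lra).
    rewrite !theta_transform, sqrt_mult by lra.
    replace (sqrt 4) with 2 by (replace 4 with (2 * 2) by ring; rewrite sqrt_square; lra).
    replace (PI * (4 * t)) with (4 * (PI * t)) by ring; ring.
  - replace (4 * (PI / t)) with (PI / (t / 4)) by (field; lra).
    rewrite !theta_transform by lra.
    replace (sqrt (t / 4)) with (sqrt t / 2).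
    + replace (PI * (t / 4)) with (PI * t / 4) by field; field.
    + unfold Rdiv; rewrite sqrt_mult by lra; f_equal.
      replace (/ 4) with (/ 2 * / 2) by field; rewrite sqrt_square; lra.
Qed.

Lemma pow_inj_pos a b n : 0 < a -> 0 < b -> (0 < n)%nat -> a ^ n = b ^ n -> a = b.
Proof.
  assert (L : forall x y, 0 < x -> x < y -> x ^ S (pred n) < y ^ S (pred n)).
  { intros x y Hx Hxy; generalize (pred n) as m; induction m as [|m IH]; [simpl; lra|].
    simpl in *; apply Rmult_le_0_lt_compat; try assumption; [lra|].
    left; apply Rmult_lt_0_compat; [assumption|now apply pow_lt]. }
  intros Ha Hb Hn E; replace n with (S (pred n)) in E by lia.
  destruct (Rtotal_order a b) as [H|[H|H]]; [exfalso|assumption|exfalso].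
  - pose proof (L a b Ha H); lra.
  - pose proof (L b a Hb H); lra.
Qed.

(** theta^2 and theta2 theta4 acquire the same factor t, so the sixth powers agree, and [weber] is
    positive. *)
Lemma weber_transform t : 0 < t -> weber (PI / t) = weber (PI * t).
Proof.
  intros Ht; pose proof PI_RGT_0.
  assert (H1 : 0 < PI / t) by (apply Rdiv_lt_0_compat; lra).
  assert (H2 : 0 < PI * t) by nra.
  destruct (weber_theta _ H1) as [E1 N1]; destruct (weber_theta _ H2) as [E2 N2].
  destruct (theta2_transform t Ht) as [T2 T4].
  rewrite T2, T4, theta_transform in E1 by assumption.
  apply (pow_inj_pos _ _ 6); [now apply weber_pos|now apply weber_pos|lia|].
  apply (Rmult_eq_reg_r (theta2 (PI * t) * theta4 (PI * t))); [|assumption].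
  rewrite E2; pose proof (sqrt_sqrt t ltac:(lra)) as Hs.
  apply (Rmult_eq_reg_l t); [|lra].
  transitivity (sqrt t * sqrt t * (weber (PI / t) ^ 6 * (theta2 (PI * t) * theta4 (PI * t))));
    [now rewrite Hs|].
  transitivity (weber (PI / t) ^ 6 * (sqrt t * theta4 (PI * t) * (sqrt t * theta2 (PI * t)))); [ring|].
  rewrite E1; transitivity (sqrt t * sqrt t * (2 * theta (PI * t) ^ 2)); [ring|now rewrite Hs].
Qed.

(** Odd exponents prime to 3 form [coset_product] with d = 3, c = 1; the multiples of 3 form chi
    (3y). The exponential prefactors match because 1/24 + 1/3 = 3 * (3/24). *)
Lemma Vth_weber y : 0 < y -> Vth y = - (weber y / weber (3 * y) ^ 3).
Proof.
  intros Hy; assert (Hy3 : 0 < 3 * y) by lra.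
  pose proof (coset_product y 3 1 Hy ltac:(lia) ltac:(lia)) as HL.
  replace (INR 3) with 3 in HL by (simpl; ring); simpl (INR 1) in HL.
  change (Z.of_nat 3) with 3%Z in HL; change (Z.of_nat 1) with 1%Z in HL.
  destruct (chi_correct y Hy) as [HX HXl]; destruct (chi_correct _ Hy3) as [HX3 HXl3].
  destruct (qev_lim_correct _ Hy3) as [HP _].
  set (B := coset_sum (y / 3) 3 1) in *.
  assert (E : B * exp (y * 1 ^ 2 / 3) / qev_lim (3 * y) * chi (3 * y) = chi y).
  { apply (lim_seq_unique (fun n => prodn (fun i => 1 + exp (- y) ^ (2 * i + 1)) (3 * n)));
      [|apply (lim_seq_mul_index (prodn (fun i => 1 + exp (- y) ^ (2 * i + 1)))); [lia|assumption]].
    refine (is_lim_seq_ext _ _ _ _ (is_lim_seq_mult' _ _ _ _ HL HXl3)).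
    intros n; rewrite prodn_group, <- prodn_mult; apply prodn_ext; intros i; cbn [prodn].
    replace (exp (- (3 * y))) with (exp (- y) ^ 3) by (rewrite exp_pow; f_equal; simpl (INR 3); ring).
    rewrite <- pow_mult.
    replace (2 * 3 * i + 3 + 2 * 1)%nat with (2 * (3 * i + 2) + 1)%nat by lia.
    replace (2 * 3 * i + (3 - 2 * 1))%nat with (2 * (3 * i + 0) + 1)%nat by lia.
    replace (3 * (2 * i + 1))%nat with (2 * (3 * i + 1) + 1)%nat by lia; ring. }
  pose proof (theta_split3 (y / 3) ltac:(lra)) as HS; fold B in HS.
  replace (9 * (y / 3)) with (3 * y) in HS by field.
  unfold Vth, weber; rewrite HS, (theta_product _ Hy3), <- E.
  assert (He : exp (y / 24) * exp (y * 1 ^ 2 / 3) = exp (3 * y / 24) ^ 3)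
    by (rewrite exp_pow, <- exp_plus; f_equal; simpl (INR 3); field).
  pose proof (exp_pos (3 * y / 24)) as Hp; set (e := exp (3 * y / 24)) in *.
  transitivity (- (B / (qev_lim (3 * y) * chi (3 * y) ^ 2))); [field; lra|].
  transitivity (- (B * (exp (y / 24) * exp (y * 1 ^ 2 / 3)) / qev_lim (3 * y) * chi (3 * y) / (e * chi (3 * y)) ^ 3));
    [rewrite He|]; field; lra.
Qed.

(** * The quintic relation *)

Lemma balanced_mod5 z : exists r k, In r (0 :: 1 :: -1 :: 2 :: -2 :: nil)%Z /\ z = (5 * k + r)%Z.
Proof.
  pose proof (Z.mod_pos_bound z 5 ltac:(lia)); pose proof (Z.div_mod z 5 ltac:(lia)).
  assert (z mod 5 = 0 \/ z mod 5 = 1 \/ z mod 5 = 2 \/ z mod 5 = 3 \/ z mod 5 = 4)%Z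
    as [H'|[H'|[H'|[H'|H']]]] by lia.
  - exists 0%Z, (z / 5)%Z; cbn [In]; lia.
  - exists 1%Z, (z / 5)%Z; cbn [In]; lia.
  - exists 2%Z, (z / 5)%Z; cbn [In]; lia.
  - exists (-2)%Z, (z / 5 + 1)%Z; cbn [In]; lia.
  - exists (-1)%Z, (z / 5 + 1)%Z; cbn [In]; lia.
Qed.

Lemma pair_sum y (c1 c2 d1 d2 : Z) : 0 < y -> (0 < d1)%Z -> (0 < d2)%Z ->
  is_sum (fun p : Z * Z => exp (- (y * (IZR (d1 * fst p + c1) ^ 2 + IZR (d2 * snd p + c2) ^ 2))))
    (coset_sum y d1 c1 * coset_sum y d2 c2).
Proof.
  intros Hy Hd1 Hd2.
  assert (Hp : forall x, 0 <= exp x) by (intros; left; apply exp_pos).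
  eapply is_sum_ext; [|exact (is_sum_prod _ _ _ _ (fun a => Hp _) (fun b => Hp _)
    (coset_sum_is_sum y d1 c1 Hy Hd1) (coset_sum_is_sum y d2 c2 Hy Hd2))].
  intros p; cbv beta; rewrite <- exp_plus; f_equal; ring.
Qed.

(* Multiplication by 1 + 2i maps Z[i] onto the pairs (5n + u, 5m + 2u). *)
Lemma theta_sq_quintic y : 0 < y ->
  theta y ^ 2 = theta (5 * y) ^ 2 + 4 * (coset_sum (y / 5) 5 1 * coset_sum (y / 5) 5 2).
Proof.
  intros Hy; assert (Hy5 : 0 < y / 5) by lra.
  pose proof (pair_sum y 0 0 1 1 Hy ltac:(lia) ltac:(lia)) as H.
  rewrite coset_sum_0 in H by (lra || lia); replace (y * 1 ^ 2) with y in H by ring.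
  replace (theta y ^ 2) with (theta y * theta y) by ring.
  apply (is_sum_unique _ _ _ H); clear H.
  assert (Hm1 : coset_sum (y / 5) 5 (-1) = coset_sum (y / 5) 5 1)
    by (apply (coset_sum_opp (y / 5) 5 1); [assumption|lia]).
  assert (Hm2 : coset_sum (y / 5) 5 (-2) = coset_sum (y / 5) 5 2)
    by (apply (coset_sum_opp (y / 5) 5 2); [assumption|lia]).
  assert (H4 : coset_sum (y / 5) 5 4 = coset_sum (y / 5) 5 1).
  { rewrite <- Hm1; apply (coset_sum_shift (y / 5) 5 (-1)); [assumption|lia]. }
  assert (Hm4 : coset_sum (y / 5) 5 (-4) = coset_sum (y / 5) 5 1).
  { rewrite <- H4; apply (coset_sum_opp (y / 5) 5 4); [assumption|lia]. }
  (* The class u = 0 gives theta(5y)^2; in each other class u and 2u are, in some order and up to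
     sign, 1 and 2 modulo 5. *)
  replace (theta (5 * y) ^ 2 + 4 * (coset_sum (y / 5) 5 1 * coset_sum (y / 5) 5 2))
    with (fsum (fun u => coset_sum (y / 5) 5 u * coset_sum (y / 5) 5 (2 * u))
       (0 :: 1 :: -1 :: 2 :: -2 :: nil)%Z).
  2:{ simpl; rewrite Hm1, Hm2, H4, Hm4, coset_sum_0 by (lia || assumption).
      replace (y / 5 * 5 ^ 2) with (5 * y) by field; ring. }
  apply (is_sum_cover _ (fun u p => let '(n, m) := p in (n + 2 * m + u, m - 2 * n)%Z)).
  - repeat constructor; cbn [In]; lia.
  - intros; left; apply exp_pos.
  - intros [a b] _; destruct (balanced_mod5 (a - 2 * b)) as (u & n & Hu & E).
    exists u, (n, b + 2 * n)%Z; split; [assumption|]; f_equal; lia.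
  - intros u u' [n m] [n' m'] Hu Hu' E; apply pair_equal_spec in E; destruct E as [E1 E2]; cbn [In] in Hu, Hu'.
    assert (5 * n + u = 5 * n' + u')%Z by lia; assert (u = u') by lia.
    split; [assumption|]; f_equal; lia.
  - intros u _; eapply is_sum_ext; [|apply (pair_sum (y / 5) u (2 * u) 5 5); [assumption|lia|lia]].
    intros [n m]; cbn [fst snd]; f_equal.
    rewrite !Z.add_0_r, !Z.mul_1_l, !plus_IZR, !minus_IZR, !mult_IZR; field.
Qed.

(** The cosets c = 1 and c = 2 with d = 5 exhaust the odd exponents prime to 5, and 1/24 + 1/5 + 4/5
    = 5 * (5/24). *)
Lemma theta_weber_quintic y : 0 < y ->
  theta y ^ 2 = theta (5 * y) ^ 2 * (1 + 4 * (weber y / weber (5 * y) ^ 5)).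
Proof.
  intros Hy; assert (Hy5 : 0 < 5 * y) by lra.
  pose proof (coset_product y 5 1 Hy ltac:(lia) ltac:(lia)) as HL1.
  pose proof (coset_product y 5 2 Hy ltac:(lia) ltac:(lia)) as HL2.
  replace (INR 5) with 5 in * by (simpl; ring); simpl (INR 1) in *; simpl (INR 2) in *.
  change (Z.of_nat 5) with 5%Z in *; change (Z.of_nat 1) with 1%Z in *; change (Z.of_nat 2) with 2%Z in *.
  destruct (chi_correct y Hy) as [HX HXl]; destruct (chi_correct _ Hy5) as [HX5 HXl5].
  destruct (qev_lim_correct _ Hy5) as [HP _].
  rewrite theta_sq_quintic by assumption.
  set (B := coset_sum (y / 5) 5 1) in *; set (C := coset_sum (y / 5) 5 2) in *.
  assert (E : (B * exp (y * 1 ^ 2 / 5) / qev_lim (5 * y)) * (C * exp (y * (1 + 1) ^ 2 / 5) / qev_lim (5 * y))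
     * chi (5 * y) = chi y).
  { apply (lim_seq_unique (fun n => prodn (fun i => 1 + exp (- y) ^ (2 * i + 1)) (5 * n)));
      [|apply (lim_seq_mul_index (prodn (fun i => 1 + exp (- y) ^ (2 * i + 1)))); [lia|assumption]].
    refine (is_lim_seq_ext _ _ _ _
      (is_lim_seq_mult' _ _ _ _ (is_lim_seq_mult' _ _ _ _ HL1 HL2) HXl5)).
    intros n; rewrite prodn_group, <- !prodn_mult; apply prodn_ext; intros i; cbn [prodn].
    replace (exp (- (5 * y))) with (exp (- y) ^ 5) by (rewrite exp_pow; f_equal; simpl (INR 5); ring).
    rewrite <- pow_mult.
    replace (2 * 5 * i + 5 + 2 * 1)%nat with (2 * (5 * i + 3) + 1)%nat by lia.
    replace (2 * 5 * i + (5 - 2 * 1))%nat with (2 * (5 * i + 1) + 1)%nat by lia.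
    replace (2 * 5 * i + 5 + 2 * 2)%nat with (2 * (5 * i + 4) + 1)%nat by lia.
    replace (2 * 5 * i + (5 - 2 * 2))%nat with (2 * (5 * i + 0) + 1)%nat by lia.
    replace (5 * (2 * i + 1))%nat with (2 * (5 * i + 2) + 1)%nat by lia; ring. }
  unfold weber; rewrite (theta_product _ Hy5), <- E.
  assert (He : exp (y / 24) * exp (y * 1 ^ 2 / 5) * exp (y * (1 + 1) ^ 2 / 5) = exp (5 * y / 24) ^ 5)
    by (rewrite exp_pow, <- !exp_plus; f_equal; simpl (INR 5); field).
  pose proof (exp_pos (5 * y / 24)) as Hp; set (e := exp (5 * y / 24)) in *.
  transitivity ((qev_lim (5 * y) * chi (5 * y) ^ 2) ^ 2 *
    (1 + 4 * (B * C * (exp (y / 24) * exp (y * 1 ^ 2 / 5) * exp (y * (1 + 1) ^ 2 / 5))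
      / qev_lim (5 * y) ^ 2 * chi (5 * y) / (e * chi (5 * y)) ^ 5)));
    [rewrite He|]; field; lra.
Qed.

(** * The evaluations at sqrt 5 *)

Lemma sqrt5_facts : 0 < sqrt 5 /\ sqrt 5 * sqrt 5 = 5 /\ 22/10 < sqrt 5 < 23/10.
Proof.
  assert (H : sqrt 5 * sqrt 5 = 5) by (apply sqrt_sqrt; lra).
  assert (H0 : 0 < sqrt 5) by (apply sqrt_lt_R0; lra).
  repeat split; nra.
Qed.

(** At y = pi / sqrt 5 the points y and 5y are dual: theta^2 gains the factor sqrt 5, [weber] is
    unchanged, and sqrt 5 = 1 + 4 / F^4. *)
Lemma weber_sqrt5 : weber (PI * sqrt 5) ^ 4 = sqrt 5 + 1.
Proof.
  destruct sqrt5_facts as (H1 & H2 & H3); pose proof PI_RGT_0.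
  assert (Hy : 0 < PI / sqrt 5) by (apply Rdiv_lt_0_compat; lra).
  pose proof (theta_weber_quintic _ Hy) as HQ.
  replace (5 * (PI / sqrt 5)) with (PI * sqrt 5) in HQ by
    (apply (Rmult_eq_reg_r (sqrt 5)); [transitivity (5 * PI); [rewrite Rmult_assoc, H2; ring|field; lra]|lra]).
  rewrite theta_transform, weber_transform in HQ by assumption.
  pose proof (theta_ge_1 (PI * sqrt 5) ltac:(nra)) as Ht.
  pose proof (weber_pos (PI * sqrt 5) ltac:(nra)) as Hw.
  set (T := theta (PI * sqrt 5)) in *; set (F := weber (PI * sqrt 5)) in *.
  replace ((sqrt (sqrt 5) * T) ^ 2) with (sqrt (sqrt 5) * sqrt (sqrt 5) * T ^ 2) in HQ by ring.
  rewrite sqrt_sqrt in HQ by lra.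
  replace (F / F ^ 5) with (/ F ^ 4) in HQ by (field; lra).
  assert (HF : 0 < F ^ 4) by now apply pow_lt.
  assert (HT : 0 < T ^ 2) by (apply pow_lt; lra).
  assert (E : sqrt 5 = 1 + 4 * / F ^ 4) by (apply (Rmult_eq_reg_l (T ^ 2)); lra).
  assert (E' : (sqrt 5 - 1) * F ^ 4 = 4) by (rewrite E; field; lra).
  apply (Rmult_eq_reg_l (sqrt 5 - 1)); [|lra]; rewrite E'; lra.
Qed.

(** With F and G the values of [weber] at pi sqrt 5 and 3 pi sqrt 5, V = - F / G^3, and by
    invariance the value at pi / (3 sqrt 5) is - G / F^3. Its cube is 1 / (V F^8), so [rho_dual] at
    t = sqrt 5 becomes an equation in V alone. *)
Lemma Vth_sqrt5_quartic :
  (6 + 2 * sqrt 5) * Vth (PI * sqrt 5) ^ 4 - 8 * Vth (PI * sqrt 5) ^ 3 +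
  (6 + 2 * sqrt 5) * Vth (PI * sqrt 5) + 1 = 0.
Proof.
  destruct sqrt5_facts as (H1 & H2 & H3); pose proof PI_RGT_0.
  assert (Hy : 0 < PI * sqrt 5) by nra.
  assert (Hy' : 0 < PI / (3 * sqrt 5)) by (apply Rdiv_lt_0_compat; lra).
  pose proof (Vth_weber _ Hy) as HV.
  pose proof (Vth_weber _ Hy') as HV'.
  rewrite weber_transform in HV' by lra.
  replace (3 * (PI / (3 * sqrt 5))) with (PI / sqrt 5) in HV' by (field; lra).
  rewrite weber_transform in HV' by lra.
  replace (PI * (3 * sqrt 5)) with (3 * (PI * sqrt 5)) in HV' by ring.
  pose proof (rho_dual (sqrt 5) H1) as HR.
  rewrite !rho_Vth in HR by assumption.
  pose proof (rho_pos _ Hy) as Hr0; rewrite rho_Vth in Hr0 by assumption.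
  pose proof weber_sqrt5 as HF4.
  pose proof (weber_pos _ Hy) as HFp; pose proof (weber_pos (3 * (PI * sqrt 5)) ltac:(lra)) as HGp.
  set (V := Vth (PI * sqrt 5)) in *; set (F := weber (PI * sqrt 5)) in *.
  set (G := weber (3 * (PI * sqrt 5))) in *; rewrite HV' in HR.
  assert (HG3 : G ^ 3 = - F / V) by (rewrite HV; field; split; lra).
  assert (HVn : V < 0).
  { rewrite HV; enough (0 < F / G ^ 3) by lra; apply Rdiv_lt_0_compat; [assumption|now apply pow_lt]. }
  assert (HK : F ^ 8 = 6 + 2 * sqrt 5).
  { replace (F ^ 8) with (F ^ 4 * F ^ 4) by ring; rewrite HF4; lra. }
  assert (E : (- (G / F ^ 3)) ^ 3 = / (V * F ^ 8)).
  { transitivity (- (G ^ 3) / F ^ 9); [field; lra|]; rewrite HG3; field; lra. }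
  rewrite E, HK in HR.
  set (K := 6 + 2 * sqrt 5) in *; assert (HKp : 0 < K) by (unfold K; lra).
  assert (E2 : (1 - 8 * / (V * K)) * (1 - 8 * V ^ 3) = 9) by (rewrite HR; field; lra).
  assert (E3 : (V * K - 8) * (1 - 8 * V ^ 3) = 9 * (V * K)).
  { rewrite <- E2; field; lra. }
  lra.
Qed.

Lemma theta_le_geom y : 0 < y -> theta y <= 1 + 2 * (exp (- y) / (1 - exp (- y))).
Proof.
  intros Hy; pose proof (exp_neg_bounds y Hy) as Hr; unfold theta.
  pose proof (ex_series_gauss y Hy) as E; rewrite Series_incr_1 by exact E.
  replace (two_sided 0 * exp (- (y * INR 0 ^ 2))) with 1
    by (simpl; replace (- (y * (0 * (0 * 1)))) with 0 by ring; rewrite exp_0; ring).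
  apply Rplus_le_compat_l.
  replace (2 * (exp (- y) / (1 - exp (- y)))) with (Series (fun n => 2 * exp (- y) * exp (- y) ^ n)).
  - apply Series_le; [|apply ex_series_scal_R, ex_series_pow; lra].
    intros n; cbn [two_sided]; split; [pose proof (exp_pos (- (y * INR (S n) ^ 2))); lra|].
    rewrite Rmult_assoc; apply Rmult_le_compat_l; [lra|].
    change (exp (- y) * exp (- y) ^ n) with (exp (- y) ^ S n); rewrite exp_pow; apply exp_le.
    pose proof (INR_sq_ge (S n)); nra.
  - rewrite Series_scal_l, Series_geom by (rewrite Rabs_right; lra); field; lra.
Qed.

(** Separates the real roots of the quartic, about -0.096 and -0.758. As 1 - 2V = theta(y/3) /
    theta(3y) and theta(3y) >= 1, the bound theta(y/3) < 2 suffices. *)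
Lemma Vth_sqrt5_bound : - (1 / 2) < Vth (PI * sqrt 5).
Proof.
  destruct sqrt5_facts as (H1 & H2 & H3); pose proof PI2_3_2.
  pose proof (theta_ge_1 (3 * (PI * sqrt 5)) ltac:(nra)) as Ht.
  assert (Hy : 2 <= PI * sqrt 5 / 3) by nra.
  pose proof (theta_le_geom (PI * sqrt 5 / 3) ltac:(lra)) as Hg.
  set (x := exp (- (PI * sqrt 5 / 3))) in *.
  assert (Hx : 0 < x <= 1 / 4).
  { split; [apply exp_pos|]; apply Rle_trans with (exp (- (2))); [apply exp_le; lra|].
    rewrite exp_Ropp; replace (1 / 4) with (/ 4) by field; apply Rinv_le_contravar; [lra|].
    replace 2 with (1 + 1) by ring; rewrite exp_plus; pose proof (exp_ineq1_le 1); nra. }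
  assert (Hx2 : x / (1 - x) <= 1 / 3).
  { apply (Rmult_le_reg_r (1 - x)); [lra|]; replace (x / (1 - x) * (1 - x)) with x by (field; lra); lra. }
  unfold Vth; set (A := theta (3 * (PI * sqrt 5))) in *; set (B := theta (PI * sqrt 5 / 3)) in *.
  assert (B / A < 2).
  { apply (Rmult_lt_reg_r A); [lra|]; replace (B / A * A) with B by (field; lra); lra. }
  lra.
Qed.

(** The quartic splits over Q(sqrt 5) into two quadratics. One has as roots the claimed values at pi
    sqrt 5 and pi / sqrt 5, conjugate under sqrt 3 -> - sqrt 3; the other has no real root. *)
Lemma Vth_sqrt5 : Vth (PI * sqrt 5) = (3 - sqrt 5) * (sqrt 3 - sqrt 5) / 4.
Proof.
  pose proof Vth_sqrt5_quartic as HQ; pose proof Vth_sqrt5_bound as HB.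
  destruct sqrt5_facts as (H1 & H2 & H3); destruct sqrt3_facts as (G1 & G2 & G3).
  set (V := Vth (PI * sqrt 5)) in *; set (s := sqrt 5) in *; set (r := sqrt 3) in *.
  assert (E : ((V - (3 - s) * (r - s) / 4) * (V - (r + s) * (s - 3) / 4)) *
     (V ^ 2 - (1 + s) / 2 * V + (3 + s) / 4) * (6 + 2 * s) = 0).
  { replace ((V - (3 - s) * (r - s) / 4) * (V - (r + s) * (s - 3) / 4)) with
      (V ^ 2 + (3 * s - 5) / 2 * V + (7 - 3 * s) / 4).
    - assert (P2 : forall a, a * (s * s) = 5 * a) by (intros; rewrite H2; ring).
      pose proof (P2 1); pose proof (P2 s); pose proof (P2 V); pose proof (P2 (V * s)).
      pose proof (P2 (V ^ 2)); pose proof (P2 (V ^ 2 * s)); pose proof (P2 (V ^ 3)).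
      pose proof (P2 (V ^ 3 * s)); lra.
    - assert (r * r * s = 3 * s) by (rewrite G2; ring).
      assert (s * s * s = 5 * s) by (rewrite H2; ring).
      assert (r * r * (s * s) = 15) by (rewrite G2, H2; ring).
      assert (s * s * (s * s) = 25) by (rewrite H2; ring).
      assert (V * (s * s) = 5 * V) by (rewrite H2; ring).
      lra. }
  apply Rmult_integral in E; destruct E as [E|E]; [|lra].
  apply Rmult_integral in E; destruct E as [E|E].
  - apply Rmult_integral in E; destruct E as [E|E]; [lra|exfalso].
    nra.
  (* This factor is (V - (1 + s) / 4)^2 + (3 + s) / 8. *)
  - exfalso; pose proof (Rle_0_sqr (V - (1 + s) / 4)); unfold Rsqr in *; nra.
Qed.

(** The quotient 1 - 2V = theta(y/3) / theta(3y) is sent by y -> pi^2/y to 3 over itself, so this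
    value follows from the one at pi sqrt 5 by division. *)
Lemma Vth_inv_sqrt5 : Vth (PI / sqrt 5) = (sqrt 3 + sqrt 5) * (sqrt 5 - 3) / 4.
Proof.
  destruct sqrt5_facts as (H1 & H2 & H3); destruct sqrt3_facts as (G1 & G2 & G3); pose proof PI_RGT_0.
  assert (E : (1 - 2 * Vth (PI / sqrt 5)) * (1 - 2 * Vth (PI * sqrt 5)) = 3).
  { unfold Vth.
    replace (PI / sqrt 5 / 3) with (PI / (3 * sqrt 5)) by (field; lra).
    replace (3 * (PI / sqrt 5)) with (PI / (sqrt 5 / 3)) by (field; lra).
    rewrite !theta_transform by lra.
    replace (PI * (3 * sqrt 5)) with (3 * (PI * sqrt 5)) by ring.
    replace (PI * (sqrt 5 / 3)) with (PI * sqrt 5 / 3) by field.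
    replace (sqrt (3 * sqrt 5)) with (3 * sqrt (sqrt 5 / 3)).
    - pose proof (theta_ge_1 (3 * (PI * sqrt 5)) ltac:(nra)); pose proof (theta_ge_1 (PI * sqrt 5 / 3) ltac:(nra)).
      pose proof (sqrt_lt_R0 (sqrt 5 / 3) ltac:(lra)); field; repeat split; lra.
    - replace (3 * sqrt 5) with (3 * 3 * (sqrt 5 / 3)) by field.
      rewrite sqrt_mult, sqrt_square by lra; reflexivity. }
  rewrite Vth_sqrt5 in E.
  set (s := sqrt 5) in *; set (r := sqrt 3) in *; set (V := Vth (PI / s)) in *.
  apply (Rmult_eq_reg_r (1 - 2 * ((3 - s) * (r - s) / 4))); [|nra].
  assert (E2 : V * (1 - 2 * ((3 - s) * (r - s) / 4)) = (1 - 2 * ((3 - s) * (r - s) / 4) - 3) / 2) by lra.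
  rewrite E2.
  assert (r * r * s = 3 * s) by (rewrite G2; ring).
  assert (s * s * s = 5 * s) by (rewrite H2; ring).
  assert (r * r * (s * s) = 15) by (rewrite G2, H2; ring).
  assert (s * s * (s * s) = 25) by (rewrite H2; ring).
  lra.
Qed.

Theorem theorem5p6 :
  V_eq (- exp (- (PI * sqrt 5))) ((3 - sqrt 5) * (sqrt 3 - sqrt 5) / 4) /\
  V_eq (- exp (- (PI / sqrt 5))) ((sqrt 3 + sqrt 5) * (sqrt 5 - 3) / 4) /\
  V_eq (- exp (- (PI / sqrt 3))) (- (1 / cbrt 4)) /\
  V_eq (- exp (- (PI * sqrt 3))) ((1 - cbrt 4) / (2 + cbrt 4)) /\
  V_eq (- exp (- (PI / (3 * sqrt 3))))
       (- (1 / cbrt (1/3 * (cbrt 4 - 1) ^ 4 + 1))) /\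
  V_eq (- exp (- PI)) ((1 - sqrt 3) / 2) /\
  V_eq (- exp (- (PI / 3))) (- (1 / cbrt (2 * (sqrt 3 - 1)))).
Proof.
  destruct sqrt5_facts as (H1 & _); destruct sqrt3_facts as (G1 & _); pose proof PI_RGT_0.
  rewrite <- Vth_sqrt5, <- Vth_inv_sqrt5, <- Vth_one_third, <- Vth_three, <- Vth_one_27th,
    <- Vth_1, <- Vth_one_ninth.
  repeat split; apply V_eq_theta; first [lra | nra | apply Rdiv_lt_0_compat; lra].
Qed.
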